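(* Let $(M,\langle\,,\rangle)$ be a connected Riemannian manifold of dimension $m\ge2$, and let $A$, $T$, $X$ satisfy assumptions (A1), (A2), (A3), (T1), (T2) of the context, with $L=L_{A,T,X}$, that is (weakly) $$Lu=\operatorname{div}\big(A(|\nabla u|)\,T(\nabla u,\cdot)^\sharp\big)-\langle X,\nabla u\rangle,\qquad u\in\mathcal C^1(M).$$ Let $q\in\mathcal C^0(M)$, $q\ge0$, with $q(x)>0$ outside some compact set $K\subset M$ and $1/q\in L^1_{loc}(M)$. Assume that the (q-SK$\nabla$) condition of the context holds. If $u\in\mathcal C^1(M)$ and $u^*=\sup_Mu<+\infty$, then for each $\eta>0$ $$\inf_{B_\eta}\{q(x)Lu(x)\}\le0$$ holds in the weak sense (defined in the context), where $B_\eta=\{x\in M:\ u(x)>u^*-\eta\ \text{ and }\ |\nabla u(x)|<\eta\}$.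
   Context: Notation: $\mathbb R^+=(0,+\infty)$; $A:\mathbb R^+\to\mathbb R$ and $\varphi(t)=tA(t)$. Standing assumptions: (A1) $A\in\mathcal C^1(\mathbb R^+)$. (A2) $\varphi'(t)>0$ on $\mathbb R^+$, and $\varphi(t)\to0$ as $t\to0^+$. (A3) $\varphi(t)\le Ct^\delta$ on $(0,\omega)$ for some $\omega,C,\delta>0$. (T1) $T$ is a positive definite, symmetric, 2-covariant tensor field on $M$. (T2) For every $x\in M$ and every $\xi\in T_xM$, $\xi\ne0$, the bilinear form $\frac{A'(|\xi|)}{|\xi|}\langle\xi,\cdot\rangle\odot T(\xi,\cdot)+A(|\xi|)T(\cdot,\cdot)$ is symmetric and positive definite, where $\odot$ is the symmetric tensor product; i.e. for every $v\in T_xM$, $v\neq0$, $\frac1{|\xi|^2}\big(\varphi'(|\xi|)-\frac{\varphi(|\xi|)}{|\xi|}\big)\langle\xi,v\rangle T(\xi,v)+\frac{\varphi(|\xi|)}{|\xi|}T(v,v)>0$. $X$ is a fixed vector field on $M$, and $\sharp:T^*M\to TM$ is the musical isomorphism. $L$ is understood in the weak sense (with $A(|\nabla u|)T(\nabla u,\cdot)$ read as $0$ where $\nabla u=0$). (q-SK$\nabla$) condition: there exists a telescoping exhaustion of $M$ by relatively compact open sets $\{\Sigma_j\}_{j\in\mathbb N}$ such that $K\subset\Sigma_1$, $\overline\Sigma_j\subset\Sigma_{j+1}$ for every $j$ and, for any pair $\Omega_1=\Sigma_{j_1}$, $\Omega_2=\Sigma_{j_2}$ with $j_1<j_2$, and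 for each $\varepsilon>0$, there exists $\gamma\in\mathcal C^0(M\setminus\Omega_1)\cap\mathcal C^1(M\setminus\overline\Omega_1)$ such that: i) $\gamma\equiv0$ on $\partial\Omega_1$; ii) $\gamma>0$ on $M\setminus\overline{\Omega}_1$; iii) $\gamma\le\varepsilon$ on $\Omega_2\setminus\Omega_1$; iv) $\gamma(x)\to+\infty$ as $x\to\infty$ (as $x$ leaves every compact set); v) $q(x)L\gamma\le\varepsilon$ weakly on $M\setminus\overline\Omega_1$, that is, for all $\psi\in\mathcal C_0^\infty(M\setminus\overline\Omega_1)$, $\psi\ge0$, $$\int_{M\setminus\overline\Omega_1}\Big(A(|\nabla\gamma|)T(\nabla\gamma,\nabla\psi)+\langle X,\nabla\gamma\rangle\psi+\frac\varepsilon q\psi\Big)\ge0 ;$$ vi) $|\nabla\gamma|<\varepsilon$ on $M\setminus\overline\Omega_1$. Weak sense of the infimum inequality: for an open set $\Omega\subset M$ and $u\in\mathcal C^1(\Omega)$, ''$\inf_\Omega\{q(x)Lu(x)\}\le0$ holds in the weak sense'' means that for no $\varepsilon>0$ does $Lu\ge\varepsilon/q$ hold weakly on $\Omega$; that is, for each $\varepsilon>0$ there exists $\psi\in\mathcal C_0^\infty(\Omega)$, $\psi\ge0$, with $$-\int_\Omega\big(A(|\nabla u|)T(\nabla u,\nabla\psi)+\langle X,\nabla u\rangle\psi\big)<\int_\Omega\frac\varepsilon q\psi .$$ *)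

(* Defs.v *)
From HB Require Import structures.
From mathcomp Require Import all_boot all_order all_algebra.
From mathcomp Require Import all_classical all_reals all_analysis.

Set Implicit Arguments.
Unset Strict Implicit.
Unset Printing Implicit Defensive.

Import Order.TTheory GRing.Theory Num.Theory.
Import numFieldNormedType.Exports.

Local Open Scope classical_set_scope.
Local Open Scope ring_scope.

(** Calculus on R^m, whose vectors are rows ['rV[R]_m]. *)

Definition pderiv {R : realType} {m : nat} (i : 'I_m) (f : 'rV[R]_m -> R) :
    'rV[R]_m -> R :=
  fun y => 'D_(delta_mx 0 i) f y.

(* [f] is of class C^k on the open set [U]; values off [U] are irrelevant. *)
Fixpoint Ck {R : realType} {m : nat} (k : nat) (U : set 'rV[R]_m)
    (f : 'rV[R]_m -> R) : Prop :=
  match k with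
  | 0 => forall y, U y -> {for y, continuous f}
  | k'.+1 => (forall y, U y -> differentiable f y) /\
             (forall i : 'I_m, Ck k' U (pderiv i f))
  end.

Definition Cinfty {R : realType} {m : nat} (U : set 'rV[R]_m)
    (f : 'rV[R]_m -> R) : Prop :=
  forall k, Ck k U f.

(* The Lebesgue integral over R^m, computed by iterated integration.  It is only
   applied to nonnegative Borel functions, where Tonelli's theorem identifies it
   with the integral against m-dimensional Lebesgue measure. *)
Fixpoint leb_int {R : realType} (m : nat) : ('rV[R]_m -> \bar R) -> \bar R :=
  match m with
  | 0 => fun f => f 0
  | n.+1 => fun f => (\int[@lebesgue_measure R]_t
                        leb_int (fun y : 'rV[R]_n => f (row_mx t%:M y)))%E
  end.

(** Bilinear algebra. *)

Definition bilin {R : realType} {m : nat} (h : 'M[R]_m) (v w : 'rV[R]_m) : R :=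
  (v *m h *m w^T) 0 0.

Definition sym_posdef {R : realType} {m : nat}
    (B : 'rV[R]_m -> 'rV[R]_m -> R) : Prop :=
  (forall v w, B v w = B w v) /\ (forall v, v != 0 -> 0 < B v v).

(* Symmetric product of two covectors, normalized so that
   (a (.) b)(v, v) = a(v) b(v). *)
Definition sym_prod {R : realType} {m : nat} (a b : 'rV[R]_m -> R)
    (v w : 'rV[R]_m) : R :=
  2^-1 * (a v * b w + a w * b v).

(** Smooth manifolds. *)

(* A chart is a homeomorphism from the open set [cdom] onto an open subset of
   R^m, with inverse [cinv]; both maps are total, with junk values elsewhere. *)
Record chart (R : realType) (M : ptopologicalType) (m : nat) := Chart {
  cdom : set M;
  cmap :> M -> 'rV[R]_m;
  cinv : 'rV[R]_m -> M;
  cdom_open : open cdom;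
  cimg_open : open (cmap @` cdom);
  cmapK : forall x, cdom x -> cinv (cmap x) = x;
  cmap_cont : forall x, cdom x -> {for x, continuous cmap};
  cinv_cont : forall y, (cmap @` cdom) y -> {for y, continuous cinv}
}.

(* The tangent space at [x] is identified with R^m through the coordinates of a
   preferred chart [chart_at x]; no continuity of [chart_at] in [x] is implied. *)
Record manifold (R : realType) (M : ptopologicalType) (m : nat) := Manifold {
  mfd_hausdorff : hausdorff_space M;
  mfd_countable : @second_countable M;
  atlas : set (chart R M m);
  atlas_compat : forall c c', atlas c -> atlas c' -> forall i : 'I_m,
    Cinfty (c @` (cdom c `&` cdom c')) (fun y => c' (cinv c y) 0 i);
  chart_at : M -> chart R M m;
  chart_at_atlas : forall x, atlas (chart_at x);
  chart_at_dom : forall x, cdom (chart_at x) x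
}.

Section Manifold.
Context {R : realType} {M : ptopologicalType} {m : nat}.
Variable S : manifold R M m.

Definition Ck_on (k : nat) (Omega : set M) (f : M -> R) : Prop :=
  forall c, atlas S c -> Ck k (c @` (cdom c `&` Omega)) (f \o cinv c).

(* C_0^oo(Omega), its elements being extended by 0 to M. *)
Definition test_function (Omega : set M) (psi : M -> R) : Prop :=
  (forall k, Ck_on k setT psi) /\
  (exists C, [/\ compact C, C `<=` Omega & forall x, ~ C x -> psi x = 0]).

(* Row [i] is the i-th coordinate vector field of [c] at [x], as an element of
   the tangent space at [x] (that is, in the coordinates of [chart_at S x]). *)
Definition frame (c : chart R M m) (x : M) : 'M[R]_m :=
  'J (chart_at S x \o cinv c) (c x).

(* Components in the chart [c] of a field of bilinear forms. *)
Definition tensor_in (h : M -> 'M[R]_m) (c : chart R M m) (x : M) : 'M[R]_m :=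
  frame c x *m h x *m (frame c x)^T.

(* Components in the chart [c] of a vector field. *)
Definition vector_in (X : M -> 'rV[R]_m) (c : chart R M m) (x : M) : 'rV[R]_m :=
  X x *m 'J (c \o cinv (chart_at S x)) (chart_at S x x).

(* Fields of bilinear forms and vector fields are only required to be continuous,
   which is what the weak formulation needs; smooth fields are a special case. *)
Definition tensor_field (h : M -> 'M[R]_m) : Prop :=
  forall c, atlas S c -> forall (i j : 'I_m) x, cdom c x ->
    {for x, continuous (fun z => tensor_in h c z i j)}.

Definition vector_field (X : M -> 'rV[R]_m) : Prop :=
  forall c, atlas S c -> forall (i : 'I_m) x, cdom c x ->
    {for x, continuous (fun z => vector_in X c z 0 i)}.

Definition T1 (T : M -> 'M[R]_m) : Prop :=
  tensor_field T /\ forall x, sym_posdef (bilin (T x)).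

Definition differential (u : M -> R) (x : M) : 'rV[R]_m :=
  \row_i pderiv i (u \o cinv (chart_at S x)) (chart_at S x x).

Record riemannian_metric := RiemannianMetric {
  metric :> M -> 'M[R]_m;
  metric_sym_posdef : forall x, sym_posdef (bilin (metric x));
  metric_smooth : forall c, atlas S c -> forall i j : 'I_m,
    Cinfty (c @` cdom c) (fun y => tensor_in metric c (cinv c y) i j)
}.

End Manifold.

Section Riemannian.
Context {R : realType} {M : ptopologicalType} {m : nat} {S : manifold R M m}.
Variable g : riemannian_metric S.

Definition inner (x : M) (v w : 'rV[R]_m) : R := bilin (g x) v w.

Definition tnorm (x : M) (v : 'rV[R]_m) : R := Num.sqrt (inner x v v).

Definition grad (u : M -> R) (x : M) : 'rV[R]_m :=
  differential S u x *m invmx (g x).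

(* The local formula dvol = sqrt(det g_ij) dy in every chart of the atlas; as M
   is second countable, it determines the Borel measure [vol] uniquely. *)
Definition is_riemannian_volume
    (vol : {measure set (g_sigma_algebraType (@open M)) -> \bar R}) : Prop :=
  forall c, atlas S c -> forall B : set (g_sigma_algebraType (@open M)),
    measurable B -> B `<=` cdom c ->
    vol B = leb_int (fun y : 'rV[R]_m =>
      (\1_(c @` B) y * Num.sqrt (\det (tensor_in S g c (cinv c y))))%:E).

(** The data of the operator L_{A,T,X}. *)

Definition phi (A : R -> R) (t : R) : R := t * A t.

Definition A1 (A : R -> R) : Prop :=
  forall t, 0 < t -> derivable A t 1 /\ {for t, continuous (derive1 A)}.

Definition A2 (A : R -> R) : Prop :=
  (forall t, 0 < t -> 0 < derive1 (phi A) t) /\ phi A t @[t --> 0^'+] --> 0.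

Definition A3 (A : R -> R) : Prop :=
  exists omega C delta : R, [/\ 0 < omega, 0 < C, 0 < delta &
    forall t, 0 < t < omega -> phi A t <= C * t `^ delta].

Definition T2 (A : R -> R) (T : M -> 'M[R]_m) : Prop :=
  forall (x : M) (xi : 'rV[R]_m), xi != 0 ->
    sym_posdef (fun v w =>
      derive1 A (tnorm x xi) / tnorm x xi *
        sym_prod (inner x xi) (bilin (T x) xi) v w +
      A (tnorm x xi) * bilin (T x) v w).

(* A(|grad u|) T(grad u, grad psi) + <X, grad u> psi.  Where grad u = 0 the first
   term is 0 whatever the junk value [A 0] is. *)
Definition weak_form (A : R -> R) (T : M -> 'M[R]_m) (X : M -> 'rV[R]_m)
    (u psi : M -> R) (x : M) : R :=
  A (tnorm x (grad u x)) * bilin (T x) (grad u x) (grad psi x) +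
  inner x (X x) (grad u x) * psi x.

Variable vol : {measure set (g_sigma_algebraType (@open M)) -> \bar R}.

(* 1/q is extended-real valued: it is +oo where q vanishes. *)
Definition inv_locally_integrable (q : M -> R) : Prop :=
  forall C : set M, compact C -> vol.-integrable C (fun x => (q x)%:E^-1%E).

Definition exhaustion (Sigma : nat -> set M) : Prop :=
  [/\ forall j, open (Sigma j) /\ compact (closure (Sigma j)),
      forall j, closure (Sigma j) `<=` Sigma j.+1 &
      \bigcup_j Sigma j = setT].

(* q L u <= eps weakly on Omega. *)
Definition weak_qL_le (A : R -> R) (T : M -> 'M[R]_m) (X : M -> 'rV[R]_m)
    (q : M -> R) (Omega : set M) (u : M -> R) (eps : R) : Prop :=
  forall psi, test_function S Omega psi -> (forall x, 0 <= psi x) ->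
    (0 <= \int[vol]_(x in Omega)
       ((weak_form A T X u psi x)%:E + eps%:E / (q x)%:E * (psi x)%:E))%E.

(* The condition (q-SK grad), with Sigma 0 in the role of Sigma_1. *)
Definition qSKgrad (A : R -> R) (T : M -> 'M[R]_m) (X : M -> 'rV[R]_m)
    (q : M -> R) (K : set M) : Prop :=
  exists Sigma : nat -> set M, exhaustion Sigma /\ K `<=` Sigma 0 /\
  forall j1 j2 : nat, (j1 < j2)%N -> forall eps : R, 0 < eps ->
  let Omega1 := Sigma j1 in
  let Omega2 := Sigma j2 in
  exists gamma : M -> R,
    {within ~` Omega1, continuous gamma} /\
    Ck_on S 1 (~` closure Omega1) gamma /\
    (forall x, (closure Omega1 `\` interior Omega1) x -> gamma x = 0) /\
    (forall x, (~` closure Omega1) x -> 0 < gamma x) /\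
    (forall x, (Omega2 `\` Omega1) x -> gamma x <= eps) /\
    (forall B : R, exists C : set M, compact C /\
       forall x, ~ Omega1 x -> ~ C x -> B < gamma x) /\
    weak_qL_le A T X q (~` closure Omega1) gamma eps /\
    (forall x, (~` closure Omega1) x -> tnorm x (grad gamma x) < eps).

(* inf_Omega { q L u } <= 0 in the weak sense. *)
Definition weak_inf_qL_le0 (A : R -> R) (T : M -> 'M[R]_m) (X : M -> 'rV[R]_m)
    (q : M -> R) (Omega : set M) (u : M -> R) : Prop :=
  forall eps : R, 0 < eps ->
  exists psi : M -> R,
  [/\ test_function S Omega psi,
      forall x, 0 <= psi x &
      (- (\int[vol]_(x in Omega) (weak_form A T X u psi x)%:E) <
       \int[vol]_(x in Omega) (eps%:E / (q x)%:E * (psi x)%:E))%E].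

End Riemannian.

(* Main.v *)
Require Import Defs.
From HB Require Import structures.
From mathcomp Require Import all_boot all_order all_algebra.
From mathcomp Require Import all_classical all_reals all_analysis.
From mathcomp Require Import measurable_realfun.
From mathcomp Require Import lra ring.

Set Implicit Arguments.
Unset Strict Implicit.
Unset Printing Implicit Defensive.

Import Order.TTheory GRing.Theory Num.Theory.
Import numFieldNormedType.Exports.

Local Open Scope classical_set_scope.
Local Open Scope ring_scope.

(** Suppose that [L u >= eps / q] weakly on [B_eta] for some [eps > 0].

    If [u] does not attain its supremum, choose [gamma] from (q-SK grad) so small
    at a point where [u] is almost maximal that [u - gamma] has its maximum over
    the complement of [Sigma 0] in a compact part of the exterior of [closure
    (Sigma 0)].  At a maximum point the gradients of [u] and [gamma] agree, hence a
    neighbourhood of the maximum set lies in [B_eta] and the two drift terms almost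
    cancel there.  Testing both inequalities with the square of the positive part
    of [u - gamma - lam], [lam] close to the maximum, contradicts the monotonicity
    of [xi |-> A (|xi|) T (xi, .)], which follows from (T2).

    If [u] attains its supremum at [x0], the gradient of [u] vanishes at [x0].  In a
    chart centred at [x0] put [w = u - u x0 + t (sigma - |y|^2)] and test with
    [(max w 0)^N].  By (A3) the flux term is bounded below up to [O (t^(1 + delta))]
    times the derivative of the power, and Young's inequality gives
    [\int (max w 0)^N = O (t^((1 + delta) N))].  On the other hand
    [u >= u x0 - |y|] near [x0], so [w >= t sigma / 2] on a cube of side
    comparable to [t], and the integral is at least a constant times [t^(N + m)].
    For [delta N > m] this fails as [t] tends to [0].

    These test functions are only C^1; Bernstein polynomials in charts, multiplied
    by smooth cutoffs, approximate them together with their first derivatives. *)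

(** * Differential calculus on R^m *)

Section Calculus.
Context {R : realType}.


(** If [u] stays below its supremum, its maximum over the compact [closure (Sigma 0)] leaves a gap,
    and this gap keeps the maximum of [u - gamma] off the boundary, in the region where [q > 0]. An
    attained maximum may lie in [K], where [q] may vanish and no gamma is defined, and it need not
    be isolated. The paraboloid then gives the test function a compact support that is independent
    of [t], at the price of a flux error. The exponent [N] is left free because the gain
    [t^(delta N)] has to beat the loss [t^m], the volume of the small cube. Test functions must be
    nonnegative, and Bernstein operators are positive while still converging together with first
    derivatives; only the support is lost, and a cutoff restores it. As [1/q] is merely locally
    integrable, approximations must be uniform with supports in one fixed compact set. Integrability
    of [1/q] also makes the volume of compact sets finite and the zeros of [q] negligible there, so
    a real-valued inverse with default 0 can stand under the integrals. *)

Lemma differentiable_near0 (V W : normedModType R) (h : V -> W) (x : V) :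
  (\forall y \near x, h y = 0) -> differentiable h x.
Proof.
move=> h0; have hx : h x = 0 by exact: nbhs_singleton h0.
have hE : h \o shift x = cst (h x) + (\0 : {linear V -> W}) +o_ (0 : V) id.
  apply/eqaddoP => _/posnumP[e].
  have : \forall y \near (0 : V), h (y + x) = 0.
    by move: h0; rewrite (near_shift 0); apply: filterS => y /=; rewrite subr0.
  apply: filterS => y hy; rewrite [X in `|X|](_ : _ = 0) ?normr0 ?mulr_ge0//.
  by rewrite !fctE /= hx hy /= addr0 subr0.
have c0 : continuous (\0 : {linear V -> W}) by exact: cst_continuous.
by apply/diff_locallyP; rewrite (diff_unique c0 hE).
Qed.

Lemma near_eq_differentiable (V W : normedModType R) (f g : V -> W) (x : V) :
  {near x, f =1 g} -> differentiable f x -> differentiable g x.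
Proof.
move=> fg df; have -> : g = f + (g - f) by rewrite addrC subrK.
apply: differentiableD => //; apply: differentiable_near0.
by apply: filterS fg => y; rewrite !fctE => ->; rewrite subrr.
Qed.

Lemma near_eq_continuous (S T : topologicalType) (f g : S -> T) (x : S) :
  {near x, f =1 g} -> {for x, continuous f} -> {for x, continuous g}.
Proof.
move=> fg cf; have : f @ x --> f x by [].
rewrite (nbhs_singleton fg) => h.
exact: cvg_trans (near_eq_cvg fg) h.
Qed.

Variable m : nat.
Implicit Types (f g : 'rV[R]_m -> R) (U W : set 'rV[R]_m).

Lemma CkS k U W f : U `<=` W -> Ck k W f -> Ck k U f.
Proof.
elim: k f => [|k IH] f UW /=; first by move=> h y /UW/h.
by move=> [h1 h2]; split=> [y /UW/h1//|i]; exact: IH.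
Qed.

Lemma near_eq_pderiv i f g y : {near y, f =1 g} -> pderiv i f y = pderiv i g y.
Proof. exact: near_eq_derive. Qed.

Lemma Ck_eq k U f g : open U -> {in U, f =1 g} -> Ck k U f -> Ck k U g.
Proof.
move=> oU; have near_eq f' g' : {in U, f' =1 g'} -> forall y, U y -> {near y, f' =1 g'}.
  move=> fg y Uy; apply: filterS (open_nbhs_nbhs (conj oU Uy)) => z Uz.
  by rewrite fg// inE.
elim: k f g => [|k IH] f g fg /=.
  move=> h y Uy; have e := near_eq _ _ fg y Uy.
  exact: near_eq_continuous e (h y Uy).
move=> [h1 h2]; split=> [y Uy|i].
  exact: near_eq_differentiable (near_eq _ _ fg y Uy) (h1 y Uy).
apply: IH (h2 i) => y; rewrite inE => Uy.
exact/near_eq_pderiv/near_eq.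
Qed.

Lemma Ck_local k U f :
  (forall y, U y -> exists W, [/\ open W, W y & Ck k W f]) -> Ck k U f.
Proof.
elim: k f => [|k IH] f h /=.
  by move=> y /h[W [_ Wy]]; exact.
split=> [y /h[W [_ Wy [h1 _]]]|i]; first exact: h1.
by apply: IH => y /h[W [oW Wy [_ h2]]]; exists W; split => //; exact: h2.
Qed.

Lemma Ck_continuous k U f y : Ck k U f -> U y -> {for y, continuous f}.
Proof.
by case: k => [h|k [h _]] Uy; [exact: h|exact/differentiable_continuous/h].
Qed.

Lemma CkW k U f : Ck k.+1 U f -> Ck k U f.
Proof.
elim: k f => [|k IH] f; first by move=> h y; exact: Ck_continuous h.
by move=> [h1 h2]; split=> // i; exact: IH.
Qed.

Lemma pderiv_diff i f y : differentiable f y ->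
  pderiv i f y = 'd f y (delta_mx 0 i).
Proof. exact: deriveE. Qed.

Lemma row_sum_pderiv f y v : differentiable f y ->
  'd f y v = \sum_i v 0 i * pderiv i f y.
Proof.
move=> df; rewrite [in LHS](row_sum_delta v) linear_sum /=.
by apply: eq_bigr => i _; rewrite linearZ/= pderiv_diff.
Qed.

Lemma pderiv_cst i (a : R) : pderiv i (cst a : 'rV[R]_m -> R) = cst 0.
Proof. by apply/funext => y; rewrite /pderiv derive_cst. Qed.

Lemma Ck_cst k U (a : R) : Ck k U (cst a).
Proof.
elim: k a => [|k IH] a /=; first by move=> y _; exact: cst_continuous.
by split=> [y _|i]; [exact: differentiable_cst|rewrite pderiv_cst].
Qed.

Lemma pderivD i f g y : differentiable f y -> differentiable g y ->
  pderiv i (f + g) y = pderiv i f y + pderiv i g y.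
Proof. by move=> df dg; rewrite /pderiv deriveD//; exact: diff_derivable. Qed.

Lemma pderivM i f g y : differentiable f y -> differentiable g y ->
  pderiv i (f * g) y = f y * pderiv i g y + g y * pderiv i f y.
Proof. by move=> df dg; rewrite /pderiv deriveM//; exact: diff_derivable. Qed.

Lemma CkD k U f g : open U -> Ck k U f -> Ck k U g -> Ck k U (f + g).
Proof.
move=> oU; elim: k f g => [|k IH] f g.
  by move=> h1 h2 y Uy; apply: continuousD; [exact: h1|exact: h2].
move=> [f1 f2] [g1 g2]; split=> [y Uy|i].
  by apply: differentiableD; [exact: f1|exact: g1].
apply: (@Ck_eq _ _ (pderiv i f + pderiv i g)) => //; last first.
  by apply: IH; [exact: f2|exact: g2].
by move=> y; rewrite inE => Uy; rewrite pderivD//; [exact: f1|exact: g1].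
Qed.

Lemma CkM k U f g : open U -> Ck k U f -> Ck k U g -> Ck k U (f * g).
Proof.
move=> oU; elim: k f g => [|k IH] f g.
  by move=> h1 h2 y Uy; apply: continuousM; [exact: h1|exact: h2].
move=> hf hg; have [f1 f2] := hf; have [g1 g2] := hg; split=> [y Uy|i].
  by apply: differentiableM; [exact: f1|exact: g1].
apply: (@Ck_eq _ _ (f * pderiv i g + g * pderiv i f)) => //.
  by move=> y; rewrite inE => Uy; rewrite pderivM//; [exact: f1|exact: g1].
by apply: CkD => //; apply: IH; do [exact: CkW|exact: f2|exact: g2].
Qed.

Lemma CkN k U f : open U -> Ck k U f -> Ck k U (- f).
Proof.
move=> oU hf; have -> : - f = cst (-1) * f.
  by apply/funext => y; rewrite !fctE /= mulN1r.
by apply: CkM => //; exact: Ck_cst.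
Qed.

Lemma Ck_sum k U (I : Type) (r : seq I) (F : I -> 'rV[R]_m -> R) : open U ->
  (forall i, Ck k U (F i)) -> Ck k U (fun y => \sum_(i <- r) F i y).
Proof.
move=> oU hF; elim: r => [|i r IH].
  rewrite [X in Ck _ _ X](_ : _ = cst 0); first exact: Ck_cst.
  by apply/funext => y; rewrite big_nil.
rewrite [X in Ck _ _ X](_ : _ = F i + (fun y => \sum_(i <- r) F i y)).
  exact: CkD.
by apply/funext => y; rewrite big_cons.
Qed.

Lemma Ck_prod k U (I : Type) (r : seq I) (F : I -> 'rV[R]_m -> R) : open U ->
  (forall i, Ck k U (F i)) -> Ck k U (fun y => \prod_(i <- r) F i y).
Proof.
move=> oU hF; elim: r => [|i r IH].
  rewrite [X in Ck _ _ X](_ : _ = cst 1); first exact: Ck_cst.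
  by apply/funext => y; rewrite big_nil.
rewrite [X in Ck _ _ X](_ : _ = F i * (fun y => \prod_(i <- r) F i y)).
  exact: CkM.
by apply/funext => y; rewrite big_cons.
Qed.

Definition coor (j : 'I_m) : 'rV[R]_m -> R := fun y => y 0 j.

Lemma differentiable_coor j y : differentiable (coor j) y.
Proof. exact: differentiable_coord. Qed.

Lemma pderiv_coor i j : pderiv i (coor j) = cst (i == j)%:R.
Proof.
apply/funext => y; rewrite /pderiv.
have := derive_mx (@derivable_id R _ y (delta_mx 0 i : 'rV[R]_m)).
by rewrite derive_id => /matrixP/(_ 0 j); rewrite !mxE eqxx eq_sym => ->.
Qed.

Lemma Ck_coor k U j : Ck k U (coor j).
Proof.
case: k => [|k].
  by move=> y _; exact/differentiable_continuous/differentiable_coor.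
split=> [y _|i]; first exact: differentiable_coor.
by rewrite pderiv_coor; exact: Ck_cst.
Qed.

(** The outer functions form a family closed under differentiation: in the induction on [k] the
    derivative of [h n] must again be covered by the induction hypothesis, and it is, as
    [h (d n)]. *)
Lemma Ck_comp1 (I : Type) (h : I -> R -> R) (d : I -> I) k U f : open U ->
  (forall n (t : R), is_derive t (1 : R) (h n) (h (d n) t)) ->
  Ck k U f -> forall n, Ck k U (h n \o f).
Proof.
move=> oU dh.
have dhn n t : differentiable (h n) t by apply/derivable1_diffP; case: (dh n t).
elim: k f => [|k IH] f hf n.
  move=> y Uy; apply: continuous_comp; first exact: hf.
  exact/differentiable_continuous/dhn.
have [f1 f2] := hf.
split=> [y Uy|i]; first by apply: differentiable_comp => //; exact: f1.
apply: (@Ck_eq _ _ ((h (d n) \o f) * pderiv i f)) => //.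
  move=> y; rewrite inE => Uy; have dfy := f1 y Uy.
  rewrite /pderiv !deriveE//; last exact: differentiable_comp.
  rewrite diff_comp//= deriv1E; last by case: (dh n (f y)).
  have -> : (h n)^`()%classic (f y) = h (d n) (f y).
    by rewrite derive1E; case: (dh n (f y)).
  by rewrite mulrC -deriveE.
by apply: CkM => //; [apply: IH; exact: CkW|exact: f2].
Qed.

End Calculus.

(** * Chain rule for maps between coordinate spaces *)

Section Composition.
Context {R : realType} {m n : nat}.
Implicit Types (f : 'rV[R]_n -> R) (G : 'rV[R]_m -> 'rV[R]_n).

Lemma differentiable_row G y :
  (forall j, differentiable (fun z => G z 0 j) y) -> differentiable G y.
Proof.
move=> dG; have -> : G = \sum_(j < n) (fun z => (G z 0 j) *: (delta_mx 0 j : 'rV[R]_n)).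
  by apply/funext => z; rewrite [LHS]row_sum_delta fct_sumE.
by apply: differentiable_sum => j; apply: differentiableZl.
Qed.

Lemma diff_row G y v j : differentiable G y ->
  ('d G y v) 0 j = 'd (fun z => G z 0 j) y v.
Proof.
move=> dG; rewrite (_ : (fun z => _) = coor j \o G)//.
rewrite (diff_comp dG (differentiable_coor j (G y))) /=.
rewrite row_sum_pderiv; last exact: differentiable_coor.
rewrite (bigD1 j)//= pderiv_coor eqxx mulr1 big1 ?addr0// => i ij.
by rewrite pderiv_coor (negbTE ij) mulr0.
Qed.

Lemma pderiv_comp i f G y : differentiable f (G y) -> differentiable G y ->
  pderiv i (f \o G) y =
  \sum_j pderiv i (fun z => G z 0 j) y * pderiv j f (G y).
Proof.
move=> df dG; rewrite pderiv_diff; last exact: differentiable_comp.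
rewrite diff_comp//= row_sum_pderiv//; apply: eq_bigr => j _; congr (_ * _).
rewrite diff_row// pderiv_diff//.
rewrite (_ : (fun z => _) = coor j \o G)//.
by apply: differentiable_comp => //; exact: differentiable_coor.
Qed.

Lemma continuous_row (T : topologicalType) (G : T -> 'rV[R]_n) y :
  (forall j, {for y, continuous (fun z => G z 0 j)}) -> {for y, continuous G}.
Proof.
move=> h; suff : G z @[z --> y] --> G y by [].
apply/cvgrPdist_lt => e e0; near=> z.
rewrite [ltLHS]/Num.Def.normr/= mx_normrE; apply/bigmax_ltP; split=> // -[i j] _ /=.
rewrite !mxE (ord1 i); move: j {i}; near: z.
apply: filter_forall => j; have : G z 0 j @[z --> y] --> G y 0 j by exact: h.
by move=> /cvgrPdist_lt/(_ e e0).
Unshelve. all: by end_near. Qed.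

Lemma Ck_comp k (U : set 'rV[R]_m) (W : set 'rV[R]_n) f G :
  open U -> (forall y, U y -> W (G y)) ->
  (forall j, Ck k U (fun z => G z 0 j)) -> Ck k W f -> Ck k U (f \o G).
Proof.
move=> oU UW; elim: k f => [|k IH] f hG hf.
  move=> y Uy; apply: continuous_comp; last exact/hf/UW.
  by apply: continuous_row => j; exact: hG.
have [f1 f2] := hf.
have dG y : U y -> differentiable G y.
  by move=> Uy; apply: differentiable_row => j; exact: (hG j).1.
split=> [y Uy|i].
  by apply: differentiable_comp; [exact: dG|exact/f1/UW].
apply: (@Ck_eq _ _ _ _ (fun y => \sum_j pderiv i (fun z => G z 0 j) y * pderiv j f (G y))) => //.
  by move=> y; rewrite inE => Uy; rewrite pderiv_comp//; [exact/f1/UW|exact: dG].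
apply: Ck_sum => // j; apply: (@CkM _ _ _ _ (pderiv i (fun z => G z 0 j)) (pderiv j f \o G)) => //.
  exact: (hG j).2.
by apply: IH; [move=> l; exact: CkW|exact: f2].
Qed.

End Composition.

(** * Cubes in the sup norm *)

Section Norm.
Context {R : realType} {m : nat}.
Implicit Types v : 'rV[R]_m.

Lemma norm_coord_le v i : `|v 0 i| <= `|v|.
Proof. by rewrite [leRHS]/Num.Def.normr/= mx_normrE (le_bigmax _ _ (0, i)). Qed.

Lemma norm_le_coord v (r : R) : 0 <= r -> (forall i, `|v 0 i| <= r) -> `|v| <= r.
Proof.
move=> r0 h; rewrite [leLHS]/Num.Def.normr/= mx_normrE.
by apply/bigmax_leP; split=> // -[i j] _; rewrite /= (ord1 i).
Qed.

Lemma norm_lt_coord v (r : R) : 0 < r -> (forall i, `|v 0 i| < r) -> `|v| < r.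
Proof.
move=> r0 h; rewrite [ltLHS]/Num.Def.normr/= mx_normrE.
by apply/bigmax_ltP; split=> // -[i j] _; rewrite /= (ord1 i).
Qed.

(** The norm of a row is its largest coordinate in absolute value, so balls are cubes, which suit
    both Bernstein polynomials and iterated integrals. *)
Definition box (a : 'rV[R]_m) (r : R) : set 'rV[R]_m := [set y | `|y - a| < r].
Definition cbox (a : 'rV[R]_m) (r : R) : set 'rV[R]_m := [set y | `|y - a| <= r].

Lemma box_open a r : open (box a r).
Proof.
have -> : box a r = ball a r.
  by rewrite -ball_normE; apply/funext => y; rewrite /box /= distrC.
exact: ball_open.
Qed.

Lemma cbox_closed a r : closed (cbox a r).
Proof.
have -> : cbox a r = closed_ball_ Num.norm a r.
  by apply/funext => y; rewrite /cbox /closed_ball_ /= distrC.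
exact: closed_closed_ball_.
Qed.

Lemma cbox_compact a r : compact (cbox a r).
Proof.
apply: bounded_closed_compact; last exact: cbox_closed.
exists (`|a| + r); split; first exact: num_real.
move=> M hM y /= hy; apply: le_trans (ltW hM).
by rewrite -(subrK a y) addrC; apply: le_trans (ler_normD _ _) _; rewrite lerD2l.
Qed.

Lemma box_cbox a r : box a r `<=` cbox a r.
Proof. by move=> y /ltW. Qed.

Lemma box_center a r : 0 < r -> box a r a.
Proof. by move=> r0; rewrite /box /= subrr normr0. Qed.

Lemma nbhs_box a r : 0 < r -> nbhs a (box a r).
Proof. by move=> r0; apply: open_nbhs_nbhs; split; [exact: box_open|exact: box_center]. Qed.

Lemma nbhs_cbox (a : 'rV[R]_m) (U : set 'rV[R]_m) : nbhs a U ->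
  exists2 r, 0 < r & cbox a r `<=` U.
Proof.
move=> /nbhs_ballP[r /= r0 h]; exists (r / 2); first by rewrite divr_gt0.
move=> y hy; apply: h; rewrite -ball_normE /= distrC.
by apply: le_lt_trans hy _; rewrite ltr_pdivrMr// mulr_natr mulr2n ltrDl.
Qed.

End Norm.

(** * Smooth approximation *)

Section Bump.
Context {R : realType}.

(* The factor [p] makes the family closed under differentiation; [flat 1] is the
   usual function [exp (- 1 / t)]. *)
Definition flat (p : {poly R}) (t : R) : R :=
  if 0 < t then p.[t^-1] * expR (- t^-1) else 0.

(** From [expR x >= 1 + x^(n+1) / (n+1)!]. One power of [x] is kept in the denominator so that at
    [x = t^-1] the bound is linear in [t]. *)
Lemma exprn_expRN_le (n : nat) (x : R) : 0 < x ->
  x ^+ n * expR (- x) <= (n.+1)`!%:R / x.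
Proof.
move=> x0; rewrite expRN ler_pdivrMr ?expR_gt0// mulrAC ler_pdivlMr//.
rewrite -exprSr; have := @expR_ge1Dxn _ x n (ltW x0).
have f0 : (0 : R) < (n.+1)`!%:R by rewrite ltr0n fact_gt0.
move=> h; rewrite mulrC -ler_pdivrMr//; apply: le_trans h.
by rewrite lerDr.
Qed.

Lemma horner_expRN_le (p : {poly R}) : exists2 C, 0 <= C &
  forall x, 0 < x -> `|p.[x]| * expR (- x) <= C / x.
Proof.
exists (\sum_(i < size p) `|p`_i| * (i.+1)`!%:R).
  by apply: sumr_ge0 => i _; rewrite mulr_ge0.
move=> x x0; rewrite horner_coef mulr_suml.
apply: (@le_trans _ _ ((\sum_(i < size p) `|p`_i * x ^+ i|) * expR (- x))).
  by rewrite ler_wpM2r ?expR_ge0// ler_norm_sum.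
rewrite mulr_suml; apply: ler_sum => i _.
rewrite normrM (ger0_norm (exprn_ge0 _ (ltW x0))) -!mulrA ler_wpM2l//.
exact: exprn_expRN_le.
Qed.

Lemma continuous_flat0 (p : {poly R}) : {for 0, continuous (flat p)}.
Proof.
have [C C0 hC] := horner_expRN_le p.
suff : flat p t @[t --> (0 : R)] --> flat p 0 by [].
rewrite {2}/flat ltxx; apply/cvgrPdist_lt => e e0.
have C1 : 0 < C + 1 by rewrite ltr_wpDl.
near=> t; rewrite sub0r normrN /flat; case: ifP => [t0|_]; last by rewrite normr0.
rewrite normrM (ger0_norm (expR_ge0 _)).
apply: le_lt_trans (hC _ _) _; first by rewrite invr_gt0.
rewrite invrK; apply: (@le_lt_trans _ _ ((C + 1) * t)).
  by rewrite ler_wpM2r ?(ltW t0)// lerDl.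
rewrite mulrC -ltr_pdivlMr//.
by near: t; apply: num_topology.nbhs0_lt; rewrite divr_gt0.
Unshelve. all: by end_near. Qed.

Lemma is_derive_flat (p : {poly R}) (t : R) :
  is_derive t (1 : R) (flat p) (flat ('X^2 * (p - p^`())) t).
Proof.
have [t0|t0|->] := ltgtP t 0.
- rewrite [flat _ t]/flat ltNge (ltW t0) /=.
  apply: (@near_eq_is_derive _ _ _ (cst 0)).
    near=> s; rewrite /flat ifF//; apply/negbTE; rewrite -leNgt ltW//.
    by near: s; apply: lt_nbhsl.
- rewrite [flat _ t]/flat t0.
  apply: (@near_eq_is_derive R R R (fun s : R => p.[s^-1] * expR (- s^-1))).
    near=> s; rewrite /flat ifT//.
    by near: s; apply: lt_nbhsr.
  have dV : is_derive t (1 : R) (fun s : R => s^-1) (- t ^- 2).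
    have := @is_deriveV R id t 1 1 (lt0r_neq0 t0) (is_derive_id _ _).
    by rewrite /= [X in is_derive _ _ _ X -> _]mulr1.
  have dP : is_derive t (1 : R) (fun s : R => p.[s^-1]) (p^`().[t^-1] * - t ^- 2).
    exact: (is_derive1_comp (is_derive_poly p t^-1) dV).
  have dE : is_derive t (1 : R) (fun s : R => expR (- s^-1)) (expR (- t^-1) * t ^- 2).
    have dN : is_derive t (1 : R) (fun s : R => - s^-1) (t ^- 2).
      by rewrite -[X in is_derive _ _ _ X]opprK; exact: is_deriveN.
    exact: (@is_derive1_comp R expR (fun s : R => - s^-1) t _ _ (is_derive_expR (- t^-1)) dN).
  apply: is_derive_eq.
  rewrite hornerM hornerD hornerN hornerXn.
  change (p.[t^-1] * (expR (- t^-1) / t ^+ 2) + expR (- t^-1) * (p^`().[t^-1] * - t ^- 2)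
    = t^-1 ^+ 2 * (p.[t^-1] - p^`().[t^-1]) * expR (- t^-1)).
  by field; exact: lt0r_neq0.
(* The difference quotient of [flat p] at 0 is itself in the family, namely [flat ('X * p)], so its
   continuity at 0 is already known. *)
- apply/is_derive1_caratheodory; exists (flat ('X * p)); split.
  + move=> z; rewrite subr0 /flat ltxx subr0; case: ifP => [z0|_]; last by rewrite mul0r.
    by rewrite hornerM hornerX; field; exact: lt0r_neq0.
  + exact: continuous_flat0.
  + by rewrite /flat ltxx.
Unshelve. all: by end_near. Qed.

Lemma Ck_flat m k (U : set 'rV[R]_m) (f : 'rV[R]_m -> R) p : open U ->
  Ck k U f -> Ck k U (flat p \o f).
Proof.
move=> oU hf.
exact: (@Ck_comp1 _ _ _ flat (fun p => 'X^2 * (p - p^`())) _ _ _ _ is_derive_flat).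
Qed.

Lemma flat1_gt0 (t : R) : (0 < flat 1 t) = (0 < t).
Proof. by rewrite /flat; case: ifP => // t0; rewrite hornerE mul1r expR_gt0. Qed.

Lemma flat1_ge0 (t : R) : 0 <= flat 1 t.
Proof. by rewrite /flat; case: ifP => // t0; rewrite hornerE mul1r expR_ge0. Qed.

Variable m : nat.

Definition bump (a : 'rV[R]_m) (r : R) (y : 'rV[R]_m) : R :=
  \prod_i (flat 1 (r - (y 0 i - a 0 i)) * flat 1 (r + (y 0 i - a 0 i))).

Lemma Ck_bump a r k (U : set 'rV[R]_m) : open U -> Ck k U (bump a r).
Proof.
move=> oU; apply: Ck_prod => // i.
apply: (@CkM _ _ _ _ (flat 1 \o (fun y => r - (y 0 i - a 0 i)))
  (flat 1 \o (fun y => r + (y 0 i - a 0 i)))) => //; apply: Ck_flat => //.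
  apply: (@CkD _ _ _ _ (cst r) (- (coor i + cst (- a 0 i)))) => //; first exact: Ck_cst.
  by apply: CkN => //; apply: CkD => //; [exact: Ck_coor|exact: Ck_cst].
apply: (@CkD _ _ _ _ (cst r) (coor i + cst (- a 0 i))) => //; first exact: Ck_cst.
by apply: CkD => //; [exact: Ck_coor|exact: Ck_cst].
Qed.

Lemma bump_ge0 a r y : 0 <= bump a r y.
Proof. by apply: prodr_ge0 => i _; rewrite mulr_ge0 ?flat1_ge0. Qed.

Lemma bump_gt0 a r y : box a r y -> 0 < bump a r y.
Proof.
move=> yr; apply: prodr_gt0 => i _.
have : `|(y - a) 0 i| < r by apply: le_lt_trans yr; exact: norm_coord_le.
rewrite !mxE ltr_norml => /andP[h1 h2].
by rewrite mulr_gt0 ?flat1_gt0// ?subr_gt0// -ltrBlDl sub0r.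
Qed.

Lemma bump_eq0 a r y : 0 < r -> ~ box a r y -> bump a r y = 0.
Proof.
move=> r0 nyr; suff [i hi] : exists i, ~~ (`|(y - a) 0 i| < r).
  rewrite /bump (bigD1 i)//=; move: hi; rewrite !mxE ltr_norml negb_and -!leNgt.
  have flat0 t : t <= 0 -> flat 1 t = 0 by rewrite /flat ltNge => ->.
  case/orP => h; first by rewrite [X in _ * X * _]flat0 ?mulr0 ?mul0r// addrC -lerBrDr sub0r.
  by rewrite flat0 ?mul0r// subr_le0.
apply: contrapT => h; apply: nyr; apply: norm_lt_coord => // i.
by apply: contrapT => hi; apply: h; exists i; apply/negP.
Qed.

End Bump.

(** * Bernstein polynomials as means over random walks *)

Section Walk.
Context {R : realType} {m : nat}.
Variables (lo : 'rV[R]_m) (s h : R).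
Implicit Types (L : seq 'I_m) (f : 'rV[R]_m -> R) (x y z : 'rV[R]_m).

Definition bias (i : 'I_m) (x : 'rV[R]_m) : R := s * (x 0 i - lo 0 i).

(* The mean of [f] at the end of a random walk started at [y] that, for each [i]
   in [L], moves by [h] in direction [i] with probability [bias i x].  For N steps
   in each direction and [s * h * N = 1] this is the Bernstein polynomial of [f] in
   [x] on the cube with lower corner [lo] and side [h * N]. *)
Fixpoint walk L f y x : R :=
  if L is i :: L' then
    bias i x * walk L' f (y + h *: delta_mx 0 i) x + (1 - bias i x) * walk L' f y x
  else f y.

Lemma Ck_bias k U i : open U -> Ck k U (bias i).
Proof.
move=> oU; apply: (@CkM _ _ _ _ (cst s) (coor i + cst (- lo 0 i))) => //.
  exact: Ck_cst.
by apply: CkD => //; [exact: Ck_coor|exact: Ck_cst].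
Qed.

Lemma pderiv_bias k i x : pderiv k (bias i) x = s * (k == i)%:R.
Proof.
have dc : differentiable (coor i + cst (- lo 0 i)) x.
  by apply: differentiableD; [exact: differentiable_coor|exact: differentiable_cst].
rewrite [LHS](@pderivM _ _ _ (cst s) (coor i + cst (- lo 0 i)))//.
rewrite pderiv_cst mulr0 addr0 pderivD//.
- by rewrite pderiv_coor pderiv_cst addr0.
- exact: differentiable_coor.
Qed.

Lemma Ck_walk k U L f y : open U -> Ck k U (walk L f y).
Proof.
move=> oU; elim: L y => [|i L IH] y; first exact: Ck_cst.
have cb := Ck_bias k i oU.
apply: (@CkD _ _ _ _ (bias i * walk L f (y + h *: delta_mx 0 i))
  ((cst 1 - bias i) * walk L f y)) => //; first exact: CkM.
apply: CkM => //; apply: CkD => //; [exact: Ck_cst|exact: CkN].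
Qed.

Lemma pderiv_walk k i L f y x :
  pderiv k (walk (i :: L) f y) x =
  s * (k == i)%:R * (walk L f (y + h *: delta_mx 0 i) x - walk L f y x) +
  (bias i x * pderiv k (walk L f (y + h *: delta_mx 0 i)) x +
   (1 - bias i x) * pderiv k (walk L f y) x).
Proof.
have db : differentiable (bias i) x by apply: (@Ck_bias 1 setT i openT).1.
have dw y' : differentiable (walk L f y') x by apply: (@Ck_walk 1 setT L f y' openT).1.
have d1 : differentiable (cst 1 - bias i) x by apply: differentiableB => //; exact: differentiable_cst.
rewrite [LHS](@pderivD _ _ _ (bias i * walk L f (y + h *: delta_mx 0 i))
  ((cst 1 - bias i) * walk L f y)); [|exact: differentiableM|exact: differentiableM].
rewrite (pderivM _ db (dw _)) (pderivM _ d1 (dw _)).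
rewrite (@pderivD _ _ k (cst 1) (- bias i) x); [|exact: differentiable_cst|exact: differentiableN].
have -> : pderiv k (- bias i) x = - (s * (k == i)%:R).
  by rewrite /pderiv deriveN ?[X in - X]pderiv_bias//; exact: diff_derivable.
rewrite pderiv_bias pderiv_cst !fctE /=; ring.
Qed.

(** Thus the difference of two walks started [h] apart is the walk of a finite difference of [f]. *)
Lemma walk_shift L f y v x :
  walk L f (y + v) x = walk L (fun z => f (z + v)) y x.
Proof.
elim: L y => [//|i L IH] y /=; rewrite addrAC !IH; congr (_ * _ + _).
Qed.

Variable x : 'rV[R]_m.
Hypothesis x01 : forall i, 0 <= bias i x <= 1.

Lemma ler_walk L f g y : (forall z, f z <= g z) -> walk L f y x <= walk L g y x.
Proof.
move=> fg; elim: L y => [//|i L IH] y /=.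
by have /andP[b0 b1] := x01 i; rewrite lerD// ler_wpM2l// subr_ge0.
Qed.

Lemma walk_lin L f g (c : R) y :
  walk L (fun z => c * f z + g z) y x = c * walk L f y x + walk L g y x.
Proof. by elim: L y => [//|i L IH] y /=; rewrite !IH; ring. Qed.

Lemma walk_cst L c y : walk L (fun=> c) y x = c.
Proof. by elim: L y => [//|i L IH] y /=; rewrite !IH; ring. Qed.

Lemma walk_dist L f g e y : (forall z, `|f z - g z| <= e z) ->
  `|walk L f y x - walk L g y x| <= walk L e y x.
Proof.
move=> fg; rewrite ler_norml; apply/andP; split.
  rewrite lerBrDr.
  have -> : - walk L e y x + walk L g y x = -1 * walk L e y x + walk L g y x by ring.
  rewrite -walk_lin; apply: ler_walk => z; have := fg z.
  by rewrite ler_norml => /andP[+ _]; rewrite mulN1r lerBrDr.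
rewrite lerBlDr -[X in X + _]mul1r -walk_lin; apply: ler_walk => z.
by have := fg z; rewrite ler_norml mul1r => /andP[_ ]; rewrite lerBlDr.
Qed.

Variables (e C : R).

(* [e + C * E |Y - x|^2] where [Y] is the end of the walk from [y] with [n i]
   steps in direction [i]. *)
Definition spread (n : 'I_m -> R) y : R :=
  e + C * \sum_i ((y 0 i + h * n i * bias i x - x 0 i) ^+ 2 +
                  h ^+ 2 * n i * (bias i x * (1 - bias i x))).

(** Moduli of continuity at [x] are majorized by such quadratics because the mean of a quadratic
    over the walk is explicit. *)
Definition dist2 z : R := e + C * \sum_i (z 0 i - x 0 i) ^+ 2.

(** Averaging over one Bernoulli step: its mean joins the squared displacement and its variance,
    [h ^+ 2 * b * (1 - b)] with [b = bias j x], is added. The counts are real numbers so that a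
    count can later be lowered by one without truncation. *)
Lemma spread_step j (n : 'I_m -> R) y :
  bias j x * spread n (y + h *: delta_mx 0 j) + (1 - bias j x) * spread n y =
  spread (fun i => n i + (i == j)%:R) y.
Proof.
rewrite /spread.
set S3 := \sum_i (_ + h ^+ 2 * (_ + _) * _).
set S1 := \sum_i _; set S2 := \sum_i _.
have -> : S3 = bias j x * S1 + (1 - bias j x) * S2; last by ring.
rewrite !mulr_sumr -big_split; apply: eq_bigr => i _ /=; rewrite !mxE eqxx /=.
have [->|_] := eqVneq i j; rewrite ?mulr1n ?mulr0n; first by move: (bias j x) => t; ring.
by move: (bias i x) (bias j x) => t u; ring.
Qed.

Lemma walk_dist2 L y : walk L dist2 y x = spread (fun i => (count_mem i L)%:R) y.
Proof.
elim: L y => [|j L IH] y.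
  rewrite /= /dist2 /spread; congr (_ + _ * _); apply: eq_bigr => i _.
  by rewrite mulr0 !mul0r mulr0 mul0r !addr0.
rewrite [LHS]/= !IH spread_step; congr spread; apply/funext => i /=.
by rewrite addrC natrD eq_sym.
Qed.

(** Only the biases of the steps in direction [k] depend on [x 0 k]. Differentiating one of them
    yields [s] times a finite difference of [f], averaged over the walk with that step removed;
    hence the count lowered by one in direction [k]. If [L] has no such step the lowered count is
    -1, but the factor in front is then 0. *)
Lemma pderiv_walk_dist k f (p : R) L y : 0 <= s -> 0 <= h ->
  (forall z, `|f (z + h *: delta_mx 0 k) - f z - h * p| <= h * dist2 z) ->
  `|pderiv k (walk L f y) x - s * (count_mem k L)%:R * h * p| <=
  s * (count_mem k L)%:R * h * spread (fun i => (count_mem i L)%:R - (i == k)%:R) y.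
Proof.
move=> s0 h0 hf; elim: L y => [|j L IH] y.
  by rewrite /= pderiv_cst !mulr0 !mul0r subrr normr0.
rewrite pderiv_walk.
set D1 := pderiv k _ x; set D2 := pderiv k _ x.
have /andP[b0 b1] := x01 j.
have b1' : 0 <= 1 - bias j x by rewrite subr_ge0.
pose q := fun i : 'I_m => (count_mem i L)%:R - (i == k)%:R : R.
have -> : (fun i : 'I_m => (count_mem i (j :: L))%:R - (i == k)%:R : R) =
          (fun i : 'I_m => q i + (i == j)%:R).
  by apply/funext => i; rewrite /= natrD /q (eq_sym j); ring.
rewrite -spread_step.
have I1 := IH (y + h *: delta_mx 0 j); have I2 := IH y.
rewrite -/D1 in I1; rewrite -/D2 in I2; rewrite -/q in I1 I2.
set c : R := s * (count_mem k L)%:R * h in I1 I2.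
have H : `|bias j x * D1 + (1 - bias j x) * D2 - c * p| <=
    c * (bias j x * spread q (y + h *: delta_mx 0 j) + (1 - bias j x) * spread q y).
  have -> : bias j x * D1 + (1 - bias j x) * D2 - c * p =
    bias j x * (D1 - c * p) + (1 - bias j x) * (D2 - c * p) by ring.
  apply: le_trans (ler_normD _ _) _; rewrite (normrM (bias j x)) (normrM (1 - _)) (ger0_norm b0) (ger0_norm b1').
  by rewrite mulrDr !(mulrCA c) lerD// ler_wpM2l.
(* For [k != j] the average of the two induction hypotheses is the claim; for [k = j] the derivative
   of the bias adds one finite difference, estimated by [K] below. *)
have [jk|jk] := eqVneq k j; last first.
  rewrite /= eq_sym (negbTE jk) mulr0 mul0r add0r add0n.
  exact: H.
move: H; rewrite -jk => H; rewrite /= eqxx mulr1 natrD.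
have -> : s * (1%:R + (count_mem k L)%:R) * h = s * h + c by rewrite /c; ring.
rewrite walk_shift.
have K : `|walk L (fun z => f (z + h *: delta_mx 0 k)) y x - walk L f y x - h * p|
   <= h * spread (fun i => (count_mem i L)%:R) y.
  rewrite -walk_dist2.
  have -> : h * walk L dist2 y x = walk L (fun z => h * dist2 z) y x.
    by have := walk_lin L dist2 (fun=> 0) h y; rewrite walk_cst addr0 => <-;
       congr (walk _ _ _ _); apply/funext => z; rewrite addr0.
  rewrite -addrA -opprD -[X in _ - (_ + X)](walk_cst L (h * p) y).
  rewrite -[X in _ - (X + _)]mul1r -walk_lin; apply: walk_dist => z.
  by rewrite mul1r opprD addrA.
have -> : bias k x * spread q (y + h *: delta_mx 0 k) + (1 - bias k x) * spread q y
   = spread (fun i => (count_mem i L)%:R) y.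
  by rewrite spread_step; congr spread; apply/funext => i; rewrite /q subrK.
rewrite spread_step in H.
rewrite [X in `|X|](_ : _ =
  s * (walk L (fun z => f (z + h *: delta_mx 0 k)) y x - walk L f y x - h * p) +
  (bias k x * D1 + (1 - bias k x) * D2 - c * p)); last by ring.
apply: le_trans (ler_normD _ _) _; rewrite [leRHS]mulrDl; apply: lerD.
  by rewrite normrM (ger0_norm s0) -mulrA ler_wpM2l.
apply: le_trans H _; rewrite le_eqVlt; apply/orP; left; apply/eqP.
by congr (_ * spread _ _); apply/funext => i; rewrite /q subrK.
Qed.

End Walk.

Lemma continuous_at_within (T U : topologicalType) (K : set T) (f : T -> U) :
  (forall x, K x -> {for x, continuous f}) -> {within K, continuous f}.
Proof. by move=> cf; apply: continuous_in_subspaceT => x; rewrite inE; exact: cf. Qed.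

(** * Bounds for continuous functions on compact sets *)

Section CompactBound.
Context {R : realType} {T : topologicalType}.
Implicit Types (K : set T) (f : T -> R).

Lemma compact_bound K f : compact K ->
  (forall x, K x -> {for x, continuous f}) ->
  exists2 M, 0 <= M & forall x, K x -> `|f x| <= M.
Proof.
move=> cK cf.
have [M [_ hM]] := compact_bounded (continuous_compact (continuous_at_within cf) cK).
exists (`|M| + 1); first by rewrite addr_ge0.
move=> x Kx; apply: (hM (`|M| + 1)); last by exists x.
by apply: le_lt_trans (ler_norm M) _; rewrite ltrDl.
Qed.

Lemma compact_pos_bound K f : compact K ->
  (forall x, K x -> {for x, continuous f}) -> (forall x, K x -> 0 < f x) ->
  exists2 c, 0 < c & forall x, K x -> c <= f x.
Proof.
move=> cK cf fp; have [K0|] := pselect (K !=set0); last first.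
  by move=> /set0P/negP/negPn/eqP ->; exists 1.
have [z /[!inE] Kz hz] := compact_EVT_min K0 cK (continuous_at_within cf).
by exists (f z); [exact: fp|move=> x Kx; apply: hz; rewrite inE].
Qed.

End CompactBound.

(** * Approximation in C^1 on a cube *)

Section Approximation.
Context {R : realType} {m : nat}.
Implicit Types (f F : 'rV[R]_m -> R) (x y z : 'rV[R]_m).

Lemma sum_sqr_ge z i : (z 0 i) ^+ 2 <= \sum_i (z 0 i) ^+ 2.
Proof. by rewrite (bigD1 i)//= lerDl; apply: sumr_ge0 => j _; exact: sqr_ge0. Qed.

Lemma norm_sqr_le_sum z : `|z| ^+ 2 <= \sum_i (z 0 i) ^+ 2.
Proof.
set S := \sum_i _; have S0 : 0 <= S by apply: sumr_ge0 => i _; exact: sqr_ge0.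
rewrite -[leRHS]sqr_sqrtr// ler_pXn2r ?nnegrE ?sqrtr_ge0//.
apply: norm_le_coord; first exact: sqrtr_ge0.
by move=> i; rewrite -sqrtr_sqr ler_sqrt//; exact: sum_sqr_ge.
Qed.

(** Within a distance [d] given by uniform continuity the term [e] suffices; farther away the
    quadratic with [C = 2 * M / d ^+ 2] exceeds the trivial bound [2 * M]. *)
Lemma compact_quadratic_modulus (K : set 'rV[R]_m) F (M e : R) : compact K ->
  (forall x, K x -> {for x, continuous F}) -> (forall x, `|F x| <= M) -> 0 < e ->
  exists2 C, 0 <= C & forall x z, K x ->
    `|F z - F x| <= e + C * \sum_i (z 0 i - x 0 i) ^+ 2.
Proof.
move=> cK cF FM e0.
have M0 : 0 <= M by exact: le_trans (FM 0).
have : \forall d \near (0 : R)^'+, K `<=` [set x | forall z, `|z - x| < d -> `|F z - F x| < e].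
  apply: ((compact_near_coveringP K).1 cK) => x Kx.
  have /cvgrPdist_lt/(_ (e / 2) (divr_gt0 e0 (ltr0Sn _ 1))) : F z @[z --> x] --> F x by exact: cF.
  move=> /nbhs_ballP[r /= r0 hr].
  exists (box x (r / 2), [set d | d < r / 2]) => /=.
    split; first by apply: nbhs_box; rewrite divr_gt0.
    by apply: nbhs_right_lt; rewrite divr_gt0.
  move=> [y d] [/= xy dr] z zy.
  have hb w : `|w - x| < r -> `|F x - F w| < e / 2.
    by move=> wx; apply: hr; rewrite -ball_normE /= distrC.
  rewrite (splitr e) -(subrKA (F x)); apply: le_lt_trans (ler_normD _ _) _.
  rewrite ltrD//; last first.
    by apply: hb; apply: lt_trans xy _; rewrite ltr_pdivrMr// mulr_natr mulr2n ltrDl.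
  rewrite distrC; apply: hb; rewrite -(subrKA y) (splitr r).
  apply: le_lt_trans (ler_normD _ _) _; rewrite ltrD//.
  exact: lt_trans zy dr.
move=> H.
have [d [d0 hd]] := filter_ex (filterI (nbhs_right_gt (0 : R)) H).
have C0 : 0 <= 2 * M / d ^+ 2 by apply: divr_ge0; [exact: mulr_ge0|exact: sqr_ge0].
exists (2 * M / d ^+ 2) => //.
move=> x z Kx; have S0 : 0 <= \sum_i (z 0 i - x 0 i) ^+ 2.
  by apply: sumr_ge0 => i _; exact: sqr_ge0.
have [zx|zx] := ltP `|z - x| d.
  apply: le_trans (ltW (hd x Kx z zx)) _.
  by rewrite lerDl mulr_ge0.
apply: (@le_trans _ _ (2 * M)).
  by apply: le_trans (ler_normB _ _) _; rewrite mulr_natl mulr2n lerD.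
apply: ler_wpDl; first exact: ltW.
rewrite mulrAC ler_pdivlMr ?exprn_gt0// ler_wpM2l ?mulr_ge0//.
apply: le_trans (_ : `|z - x| ^+ 2 <= _); first by rewrite ler_pXn2r ?nnegrE// ltW.
apply: le_trans (norm_sqr_le_sum _) _.
by apply: ler_sum => i _; rewrite !mxE.
Qed.

Lemma pderiv_MVT f i z h : 0 <= h -> (forall y, differentiable f y) ->
  exists2 c, 0 <= c <= h &
    f (z + h *: delta_mx 0 i) - f z = h * pderiv i f (z + c *: delta_mx 0 i).
Proof.
move=> h0 df; pose g (t : R) := f (z + t *: delta_mx 0 i).
have dg (t : R) : is_derive t (1 : R) g (pderiv i f (z + t *: delta_mx 0 i)).
  have E : (fun k : R => k^-1 *: ((g \o shift t) (k *: (1 : R)) - g t)) =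
    (fun k : R => k^-1 *: ((f \o shift (z + t *: delta_mx 0 i)) (k *: delta_mx 0 i)
                            - f (z + t *: delta_mx 0 i))).
    apply/funext => k; congr (_ *: (_ - _)); rewrite /g /=; congr (f _).
    by rewrite scalerDl [k *: 1]mulr1 addrCA.
  apply: DeriveDef; last by rewrite /derive E.
  by rewrite /derivable E; exact/diff_derivable/df.
have [|c] := @MVT_segment _ g (fun t => pderiv i f (z + t *: delta_mx 0 i)) 0 h h0 (fun t _ => dg t).
  apply: continuous_at_within => t _; apply: differentiable_continuous.
  by apply/derivable1_diffP; case: (dg t).
rewrite in_itv /= => hc; rewrite subr0 /g scale0r addr0 mulrC => ->.
by exists c.
Qed.

Definition steps (N : nat) : seq 'I_m := flatten [seq nseq N i | i <- enum 'I_m].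

Lemma count_steps N i : count_mem i (steps N) = N.
Proof.
rewrite /steps count_flatten -map_comp.
rewrite (eq_map (g := fun j => if j == i then N else 0%N)); last first.
  by move=> j /=; rewrite count_nseq /=; case: (j == i); rewrite ?mul1n ?mul0n.
rewrite sumnE big_map big_enum /= (bigD1 i)//= eqxx big1 ?addn0// => j.
by move=> /negbTE ->.
Qed.

Lemma eq_pderiv0 f i (U : set 'rV[R]_m) y : open U -> U y ->
  (forall z, U z -> f z = 0) -> pderiv i f y = 0.
Proof.
move=> oU Uy f0; rewrite (@near_eq_pderiv _ _ i f (cst 0)) ?pderiv_cst//.
by apply: filterS (open_nbhs_nbhs (conj oU Uy)).
Qed.

(** Bernstein's theorem in C^1. Vanishing off the cube makes [f] and its derivatives bounded on the
    whole space, as the quadratic moduli require. On the cube [g] is a mean of values of [f], hence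
    nonnegative; off the cube the biases are no longer probabilities, and nothing is claimed about
    sign or distance. *)
Lemma C1_approx f (a : 'rV[R]_m) (r e : R) : 0 < r -> Ck 1 setT f ->
  (forall y, ~ cbox a r y -> f y = 0) -> (forall y, 0 <= f y) -> 0 < e ->
  exists g : 'rV[R]_m -> R, [/\ forall k U, open U -> Ck k U g,
    forall x, cbox a r x -> 0 <= g x,
    forall x, cbox a r x -> `|g x - f x| <= e &
    forall x, cbox a r x -> forall k, `|pderiv k g x - pderiv k f x| <= e].
Proof.
move=> r0 [df cf] f0 fge0 e0.
have ck := @cbox_compact R m a r.
have modulus F : (forall y, {for y, continuous F}) -> (forall y, ~ cbox a r y -> F y = 0) ->
    exists2 C, 0 <= C & forall x z, cbox a r x ->
      `|F z - F x| <= e / 2 + C * \sum_i (z 0 i - x 0 i) ^+ 2.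
  move=> cF F0; have [M M0 hM] := compact_bound ck (fun x _ => cF x).
  apply: (@compact_quadratic_modulus _ _ M) => //; last by rewrite divr_gt0.
  move=> x; have [/hM//|/F0 ->] := pselect (cbox a r x); by rewrite normr0.
have [C0 C00 hC0] := modulus f (fun y => differentiable_continuous (df y Logic.I)) f0.
have dfk k : exists C, 0 <= C /\ forall x z, cbox a r x ->
      `|pderiv k f z - pderiv k f x| <= e / 2 + C * \sum_i (z 0 i - x 0 i) ^+ 2.
  have [|y yr|C ? ?] := modulus (pderiv k f); [by move=> y; exact: cf| |by exists C].
  apply: (@eq_pderiv0 _ _ (~` cbox a r)) => //; exact/closed_openC/cbox_closed.
have [Ck hCk] := choice dfk.
pose C := C0 + \sum_k Ck k.
have Ck0 k : 0 <= Ck k by case: (hCk k).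
have C_ge0 : 0 <= C by rewrite addr_ge0// sumr_ge0.
have CkC k : Ck k <= C.
  by rewrite /C (bigD1 k)//= addrCA lerDl addr_ge0// sumr_ge0.
(* The error of the derivatives beyond [e / 2] is at most [2 * C * (1 + 2 * m) * (h ^+ 2 * N)],
   where [h ^+ 2 * N = 4 * r ^+ 2 / N]; it is at most [e / 2] as soon as [N >= B]. *)
pose B := 16 * C * (1 + 2 * m%:R) * r ^+ 2 / e.
have B0 : 0 <= B.
  by rewrite /B divr_ge0 ?(ltW e0)// mulr_ge0 ?sqr_ge0// !mulr_ge0// addr_ge0// mulr_ge0.
have [N [N1 BN]] : exists N : nat, (1 : R) <= N%:R /\ B <= N%:R.
  exists (Num.bound B).+1; split; first by rewrite ler1n.
  by apply: le_trans (ltW (archi_boundP B0)) _; rewrite ler_nat.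
have N0 : (0 : R) < N%:R by apply: lt_le_trans N1.
clear modulus dfk.
pose h := 2 * r / N%:R; pose s := (2 * r)^-1.
have r2 : 0 < 2 * r by rewrite mulr_gt0.
have h0 : 0 <= h by rewrite /h divr_ge0 ?ltW.
have s0 : 0 <= s by rewrite /s invr_ge0 ltW.
have sNh : s * N%:R * h = 1.
  by rewrite /s /h; field; rewrite !lt0r_neq0// mulr_gt0.
have hN : h ^+ 2 * N%:R = 4 * r ^+ 2 / N%:R.
  by rewrite /h; field; rewrite lt0r_neq0.
have bnd : 2 * C * (1 + 2 * m%:R) * (h ^+ 2 * N%:R) <= e / 2.
  rewrite hN mulrA ler_pdivrMr// -ler_pdivrMl ?divr_gt0//.
  apply: le_trans BN; rewrite le_eqVlt /B; apply/orP; left; apply/eqP.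
  by field; rewrite lt0r_neq0.
have h2N : h ^+ 2 <= h ^+ 2 * N%:R by rewrite ler_peMr ?sqr_ge0.
pose lo : 'rV[R]_m := a - const_mx r.
have b01 x : cbox a r x -> forall i, 0 <= bias lo s i x <= 1.
  move=> xr i; have : `|(x - a) 0 i| <= r by apply: le_trans xr; exact: norm_coord_le.
  rewrite !mxE ler_norml /bias /lo !mxE => /andP[h1 h2].
  rewrite mulrC ler_pdivlMr// mul0r ler_pdivrMr// mul1r.
  by apply/andP; split; lra.
have hNb x i : h * N%:R * bias lo s i x = x 0 i - lo 0 i.
  rewrite /bias mulrA; have -> : h * N%:R * s = 1 by rewrite mulrC (mulrC h) mulrA.
  by rewrite mul1r.
have b4 x : cbox a r x -> forall i, 0 <= bias lo s i x * (1 - bias lo s i x) <= 1.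
  move=> /b01 hx i; have /andP[h1 h2] := hx i.
  have h3 : 0 <= 1 - bias lo s i x by rewrite subr_ge0.
  by rewrite mulr_ge0//= mulr_ile1// gerBl.
exists (walk lo s h (steps N) f lo); split.
- by move=> k U oU; exact: Ck_walk.
- move=> x xr; rewrite -(walk_cst lo s h x (steps N) 0 lo); apply: ler_walk => //; exact: b01.
- move=> x xr.
  rewrite -(walk_cst lo s h x (steps N) (f x) lo).
  apply: (@le_trans _ _ (walk lo s h (steps N) (dist2 x (e / 2) C) lo x)).
    apply: walk_dist; first exact: b01.
    move=> z; apply: le_trans (hC0 x z xr) _; rewrite lerD2l ler_wpM2r//.
      by apply: sumr_ge0 => i _; exact: sqr_ge0.
    by rewrite lerDl sumr_ge0.
  rewrite walk_dist2 /spread [leRHS]splitr lerD2l.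
  apply: le_trans bnd.
  apply: (@le_trans _ _ (C * \sum_(i < m) (h ^+ 2 * N%:R))).
    rewrite ler_wpM2l//; apply: ler_sum => i _; rewrite count_steps.
    have -> : lo 0 i + h * N%:R * bias lo s i x - x 0 i = 0 by rewrite hNb; ring.
    have /andP[_ ?] := b4 x xr i; rewrite expr0n add0r.
    by rewrite ler_piMr// mulr_ge0 ?sqr_ge0// ltW.
  rewrite sumr_const card_ord -[X in C * X <= _]mulr_natl.
  have -> : 2 * C * (1 + 2 * m%:R) * (h ^+ 2 * N%:R) =
    C * (m%:R * (h ^+ 2 * N%:R)) + C * ((2 + 3 * m%:R) * (h ^+ 2 * N%:R)) by ring.
  rewrite lerDl; apply: mulr_ge0 => //.
  apply: mulr_ge0; first by have := ler0n R m; lra.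
  by apply: mulr_ge0; [exact: sqr_ge0|exact: ltW].
- move=> x xr k.
  (* By the mean value theorem the difference quotient at [z] is a partial derivative at a point
     moved by some [c <= h] in direction [k]. Since [(p + c)^2 <= 2 p^2 + 2 h^2], this doubles [C]
     and adds [2 * C * h ^+ 2]. *)
  have := @pderiv_walk_dist _ _ lo s h x (b01 x xr) (e / 2 + 2 * C * h ^+ 2) (2 * C) k f
    (pderiv k f x) (steps N) lo s0 h0.
  rewrite count_steps sNh mul1r mul1r => H.
  apply: le_trans (H _) _ => {H}.
    move=> z; have [c /andP[c0 ch] ->] := pderiv_MVT k z h0 (fun y => df y I).
    rewrite -mulrBr normrM (ger0_norm h0) ler_wpM2l//.
    apply: le_trans ((hCk k).2 _ _ xr) _; rewrite /dist2 -addrA lerD2l.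
    set S := \sum_i _; set S' := \sum_i _.
    have S0 : 0 <= S by apply: sumr_ge0 => i _; exact: sqr_ge0.
    apply: (@le_trans _ _ (C * S)); first exact: ler_wpM2r.
    have -> : 2 * C * h ^+ 2 + 2 * C * S' = C * (2 * h ^+ 2 + 2 * S') by ring.
    rewrite ler_wpM2l// /S /S'.
    rewrite (bigD1 k)//= [in leRHS](bigD1 k)//= !mxE !eqxx mulr1.
    have -> : \sum_(i | i != k) ((z + c *: delta_mx 0 k) 0 i - x 0 i) ^+ 2 =
              \sum_(i | i != k) (z 0 i - x 0 i) ^+ 2.
      by apply: eq_bigr => i /negbTE ik; rewrite !mxE ik andbF mulr0 addr0.
    set Q := \sum_(i | _) _.
    have Q0 : 0 <= Q by apply: sumr_ge0 => i _; exact: sqr_ge0.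
    have c2 : c ^+ 2 <= h ^+ 2 by rewrite ler_pXn2r// nnegrE.
    have := sqr_ge0 (z 0 k - x 0 k - c).
    by nra.
  rewrite /spread -addrA [leRHS]splitr lerD2l.
  apply: le_trans bnd.
  apply: (@le_trans _ _ (2 * C * (h ^+ 2 * N%:R) + 2 * C * \sum_(i < m) (2 * (h ^+ 2 * N%:R)))).
    apply: lerD; first by rewrite ler_wpM2l// mulr_ge0.
    rewrite ler_wpM2l ?mulr_ge0//; apply: ler_sum => i _; rewrite count_steps.
    (* The step missing in direction [k] moves the mean of the walk away from [x], by at most
       [h]. *)
    set d := (i == k)%:R : R.
    have d0 : 0 <= d by rewrite /d; case: (i == k).
    have d1 : d <= 1 by rewrite /d; case: (i == k).
    have -> : lo 0 i + h * (N%:R - d) * bias lo s i x - x 0 i = - (d * (h * bias lo s i x)).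
      by have := hNb x i; lra.
    have /andP[b0 b1] := b01 x xr i; have /andP[q0 q1] := b4 x xr i.
    rewrite sqrrN exprMn mulr_natl mulr2n; apply: lerD.
      apply: le_trans h2N; rewrite exprMn mulrCA ler_piMr ?sqr_ge0//.
      by rewrite mulr_ile1 ?sqr_ge0// expr_le1.
    apply: (@le_trans _ _ (h ^+ 2 * (N%:R - d))).
      rewrite ler_piMr// mulr_ge0 ?sqr_ge0// subr_ge0; exact: le_trans d1 N1.
    by rewrite ler_wpM2l ?sqr_ge0// gerBl.
  rewrite sumr_const card_ord -[X in _ + _ * X]mulr_natl le_eqVlt; apply/orP; left; apply/eqP; ring.
Qed.

End Approximation.

(** * Functions on manifolds *)

Lemma open_preimageI (T T' : topologicalType) (f : T -> T') (A : set T) (B : set T') :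
  open A -> (forall x, A x -> {for x, continuous f}) -> open B -> open (A `&` f @^-1` B).
Proof.
move=> oA cf oB; rewrite openE => x [Ax Bfx]; apply: filterI.
  exact: open_nbhs_nbhs.
have : nbhs (f x) B by exact: open_nbhs_nbhs.
exact: (cf x Ax).
Qed.

Section Chart.
Context {R : realType} {M : ptopologicalType} {m : nat}.
Implicit Types (c : chart R M m) (Omega : set M).

Lemma cdom_cinv c y : (c @` cdom c) y -> cdom c (cinv c y).
Proof. by move=> [x cx <-]; rewrite cmapK. Qed.

Lemma cinvK c y : (c @` cdom c) y -> c (cinv c y) = y.
Proof. by move=> [x cx <-]; rewrite cmapK. Qed.

Lemma cimgE c Omega : c @` (cdom c `&` Omega) = c @` cdom c `&` cinv c @^-1` Omega.
Proof.
apply/seteqP; split=> y.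
  by move=> [x [cx Ox] <-]; split; [exists x|rewrite /= cmapK].
by move=> [[x cx <-]] /=; rewrite cmapK// => Ox; exists x.
Qed.

Lemma cimg_openI c Omega : open Omega -> open (c @` (cdom c `&` Omega)).
Proof.
move=> oO; rewrite cimgE; apply: open_preimageI => //; first exact: cimg_open.
exact: cinv_cont.
Qed.

Lemma cpre_open c (U : set 'rV[R]_m) : open U -> open (cdom c `&` c @^-1` U).
Proof. by move=> oU; apply: open_preimageI => //; [exact: cdom_open|exact: cmap_cont]. Qed.

Lemma cimg_mem c Omega x : cdom c x -> Omega x -> (c @` (cdom c `&` Omega)) (c x).
Proof. by move=> cx Ox; exists x. Qed.

End Chart.

Section Smooth.
Context {R : realType} {M : ptopologicalType} {m : nat} (S : manifold R M m).
Implicit Types (c : chart R M m) (Omega W : set M) (f g : M -> R).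

Lemma Ck_transition k c c' Omega i : atlas S c -> atlas S c' -> open Omega ->
  Ck k (c @` (cdom c `&` (cdom c' `&` Omega))) (fun y => c' (cinv c y) 0 i).
Proof.
move=> ac ac' oO; apply: CkS (atlas_compat ac ac' i k).
by move=> _ [x [cx [c'x _]] <-]; exists x.
Qed.

(** Smooth transition maps carry regularity from one chart around each point to every chart of the
    atlas. *)
Lemma Ck_on_chart k Omega f :
  (forall x, Omega x -> exists c W, [/\ atlas S c, cdom c x, open W, W x &
     Ck k (c @` (cdom c `&` W)) (f \o cinv c)]) -> Ck_on S k Omega f.
Proof.
move=> h c' ac'; apply: Ck_local => _ [x [c'x Ox] <-].
have [c [W [ac cx oW Wx ck]]] := h x Ox.
pose V := c' @` (cdom c' `&` (cdom c `&` W)).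
have oV : open V by apply: cimg_openI; apply: openI => //; exact: cdom_open.
exists V; split=> //; first by exists x.
apply: (@Ck_eq _ _ _ _ ((f \o cinv c) \o (fun y => c (cinv c' y)))) => //.
  move=> y; rewrite inE => -[z [c'z [cz Wz]] <-].
  by rewrite /= cmapK// cmapK.
apply: Ck_comp ck => //.
  by move=> _ [z [c'z [cz Wz]] <-]; exists z => //; rewrite cmapK.
by move=> j; exact: Ck_transition.
Qed.

Lemma Ck_on_local k Omega f :
  (forall x, Omega x -> exists W, [/\ open W, W x & Ck_on S k W f]) ->
  Ck_on S k Omega f.
Proof.
move=> h; apply: Ck_on_chart => x /h[W [oW Wx ck]].
exists (chart_at S x), W; split=> //; [exact: chart_at_atlas|exact: chart_at_dom|].
by apply: ck; exact: chart_at_atlas.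
Qed.

Lemma Ck_onS k Omega W f : Omega `<=` W -> Ck_on S k W f -> Ck_on S k Omega f.
Proof.
move=> OW ck c ac; apply: CkS (ck c ac).
by move=> _ [x [cx Ox] <-]; exists x => //; split=> //; exact: OW.
Qed.

Lemma Ck_on_eq k Omega f g : open Omega -> {in Omega, f =1 g} ->
  Ck_on S k Omega f -> Ck_on S k Omega g.
Proof.
move=> oO fg ck c ac; apply: Ck_eq (ck c ac); first exact: cimg_openI.
move=> y; rewrite inE => -[x [cx Ox] <-]; rewrite /= cmapK//.
by apply: fg; rewrite inE.
Qed.

Lemma Ck_on_cst k Omega (a : R) : Ck_on S k Omega (cst a).
Proof. by move=> c ac; exact: Ck_cst. Qed.

Lemma Ck_onD k Omega f g : open Omega -> Ck_on S k Omega f -> Ck_on S k Omega g ->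
  Ck_on S k Omega (f + g).
Proof.
move=> oO hf hg c ac.
by apply: (@CkD _ _ _ _ (f \o cinv c) (g \o cinv c)); [exact: cimg_openI|exact: hf|exact: hg].
Qed.

Lemma Ck_onM k Omega f g : open Omega -> Ck_on S k Omega f -> Ck_on S k Omega g ->
  Ck_on S k Omega (f * g).
Proof.
move=> oO hf hg c ac.
by apply: (@CkM _ _ _ _ (f \o cinv c) (g \o cinv c)); [exact: cimg_openI|exact: hf|exact: hg].
Qed.

Lemma Ck_onN k Omega f : open Omega -> Ck_on S k Omega f -> Ck_on S k Omega (- f).
Proof.
move=> oO hf c ac.
by apply: (@CkN _ _ _ _ (f \o cinv c)); [exact: cimg_openI|exact: hf].
Qed.

Lemma Ck_on_pull k c (U : set 'rV[R]_m) (F : 'rV[R]_m -> R) : atlas S c -> open U ->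
  Ck k U F -> Ck_on S k (cdom c `&` c @^-1` U) (F \o c).
Proof.
move=> ac oU hF; apply: Ck_on_chart => x [cx Ux].
have oW := cpre_open c oU.
exists c, (cdom c `&` c @^-1` U); split=> //.
apply: (@Ck_eq _ _ _ _ F); first exact: cimg_openI.
  by move=> y; rewrite inE => -[z [cz _] <-]; rewrite /= cmapK.
by apply: CkS hF => _ [z [cz [_ Uz]] <-].
Qed.

Lemma Ck_on_continuous k Omega f x : open Omega -> Ck_on S k Omega f -> Omega x ->
  {for x, continuous f}.
Proof.
move=> oO ck Ox; have ac := chart_at_atlas S x; have cx := chart_at_dom S x.
set c := chart_at S x in ac cx.
apply: (@near_eq_continuous _ _ (f \o cinv c \o c)).
  have oc := @cdom_open _ _ _ c.
  by apply: filterS (open_nbhs_nbhs (conj oc cx)) => z cz; rewrite /= cmapK.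
apply: continuous_comp; first exact: cmap_cont.
by apply: Ck_continuous (ck c ac) _; exact: cimg_mem.
Qed.

(** The manifold is Hausdorff, so [C] is closed and [f] is 0 on the open set that [Omega] may
    miss. *)
Lemma Ck_on_extend0 k Omega C f : open Omega -> compact C -> C `<=` Omega ->
  Ck_on S k Omega f -> (forall x, ~ C x -> f x = 0) -> Ck_on S k setT f.
Proof.
move=> oO cC CO ck f0; have clC := compact_closed (mfd_hausdorff S) cC.
apply: Ck_on_local => x _; have [Cx|Cx] := pselect (C x).
  by exists Omega; split=> //; exact: CO.
exists (~` C); split=> //; first exact: closed_openC.
apply: (@Ck_on_eq _ _ (cst 0)); last exact: Ck_on_cst.
  exact: closed_openC.
by move=> z; rewrite inE => Cz; rewrite f0.
Qed.

(** The differential in a chart that stays fixed while [x] moves. [differential] uses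
    [chart_at S x], which may jump with [x], so continuity can only be expressed through fixed
    charts. *)
Definition dchart c f (x : M) : 'rV[R]_m := \row_i pderiv i (f \o cinv c) (c x).

Lemma continuous_dchart c Omega f x i : atlas S c -> open Omega ->
  Ck_on S 1 Omega f -> Omega x -> cdom c x ->
  {for x, continuous (fun z => dchart c f z 0 i)}.
Proof.
move=> ac oO ck Ox cx.
have -> : (fun z => dchart c f z 0 i) = pderiv i (f \o cinv c) \o c.
  by apply/funext => z; rewrite mxE.
apply: continuous_comp; first exact: cmap_cont.
by apply: ((ck c ac).2 i); exact: cimg_mem.
Qed.

Lemma Ck_on_differentiable c Omega f x : atlas S c -> Ck_on S 1 Omega f ->
  Omega x -> cdom c x -> differentiable (f \o cinv c) (c x).
Proof. by move=> ac ck Ox cx; apply: (ck c ac).1; exact: cimg_mem. Qed.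

Lemma dchart_near c f g x : cdom c x -> {near x, f =1 g} -> dchart c f x = dchart c g x.
Proof.
move=> cx fg; apply/rowP => i; rewrite !mxE; apply: near_eq_pderiv.
have : {for c x, continuous (cinv c)} by apply: cinv_cont; exists x.
move=> cc; have : nbhs (cinv c (c x)) [set z | f z = g z] by rewrite cmapK.
exact: cc.
Qed.

Lemma dchart_cst c (a : R) x : dchart c (cst a) x = 0.
Proof.
apply/rowP => i; rewrite !mxE.
by rewrite (_ : cst a \o cinv c = cst a)// pderiv_cst.
Qed.

Lemma dchartD c Omega f g x : atlas S c -> Ck_on S 1 Omega f -> Ck_on S 1 Omega g ->
  Omega x -> cdom c x -> dchart c (f + g) x = dchart c f x + dchart c g x.
Proof.
move=> ac hf hg Ox cx; apply/rowP => i; rewrite !mxE.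
exact: (pderivD _ (Ck_on_differentiable ac hf Ox cx) (Ck_on_differentiable ac hg Ox cx)).
Qed.

Lemma dchartN c Omega f x : atlas S c -> Ck_on S 1 Omega f ->
  Omega x -> cdom c x -> dchart c (- f) x = - dchart c f x.
Proof.
move=> ac hf Ox cx; apply/rowP => i; rewrite !mxE.
have := Ck_on_differentiable ac hf Ox cx => df.
by rewrite [LHS](@deriveN _ _ _ (f \o cinv c))//; exact: diff_derivable.
Qed.

Lemma dchart_comp1 c Omega (h h' : R -> R) f x : atlas S c -> Ck_on S 1 Omega f ->
  Omega x -> cdom c x -> is_derive (f x) (1 : R) h (h' (f x)) ->
  dchart c (h \o f) x = h' (f x) *: dchart c f x.
Proof.
move=> ac hf Ox cx dh; apply/rowP => i; rewrite !mxE.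
have df := Ck_on_differentiable ac hf Ox cx.
have dh1 : derivable h (f x) 1 by case: dh.
have dhd : differentiable h ((f \o cinv c) (c x)).
  by rewrite /= cmapK//; exact/derivable1_diffP.
rewrite pderiv_diff; last exact: (differentiable_comp df dhd).
rewrite (diff_comp df dhd) /= deriv1E /= cmapK//.
rewrite derive1E; have -> : 'D_1 h (f x) = h' (f x) by case: dh.
by rewrite [LHS]mulrC pderiv_diff.
Qed.

End Smooth.

(** * Continuity of matrix-valued maps *)

Section MatrixContinuity.
Context {R : realType} {T : topologicalType}.

Lemma continuous_big_sum (I : Type) (r : seq I) (P : pred I) (F : I -> T -> R) x :
  (forall i, {for x, continuous (F i)}) ->
  {for x, continuous (fun z => \sum_(i <- r | P i) F i z)}.
Proof.
move=> cF; elim: r => [|i r IH].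
  by rewrite (_ : (fun z => _) = cst 0); [exact: cst_continuous|apply/funext => z; rewrite big_nil].
case Pi : (P i); last first.
  by rewrite (_ : (fun z => _) = (fun z => \sum_(i <- r | P i) F i z))//;
     apply/funext => z; rewrite big_cons Pi.
rewrite (_ : (fun z => _) = F i + (fun z => \sum_(i <- r | P i) F i z)).
  exact: continuousD.
by apply/funext => z; rewrite big_cons Pi.
Qed.

Lemma continuous_big_prod (I : Type) (r : seq I) (P : pred I) (F : I -> T -> R) x :
  (forall i, {for x, continuous (F i)}) ->
  {for x, continuous (fun z => \prod_(i <- r | P i) F i z)}.
Proof.
move=> cF; elim: r => [|i r IH].
  by rewrite (_ : (fun z => _) = cst 1); [exact: cst_continuous|apply/funext => z; rewrite big_nil].
case Pi : (P i); last first.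
  by rewrite (_ : (fun z => _) = (fun z => \prod_(i <- r | P i) F i z))//;
     apply/funext => z; rewrite big_cons Pi.
rewrite (_ : (fun z => _) = F i * (fun z => \prod_(i <- r | P i) F i z)).
  exact: continuousM.
by apply/funext => z; rewrite big_cons Pi.
Qed.

Definition mx_continuous p q (f : T -> 'M[R]_(p, q)) (x : T) : Prop :=
  forall i j, {for x, continuous (fun z => f z i j)}.

Lemma mx_continuous_mul p q r (f : T -> 'M[R]_(p, q)) (g : T -> 'M[R]_(q, r)) x :
  mx_continuous f x -> mx_continuous g x -> mx_continuous (fun z => f z *m g z) x.
Proof.
move=> cf cg i j; rewrite (_ : (fun z => _) = (fun z => \sum_k f z i k * g z k j)).
  by apply: continuous_big_sum => k; apply: continuousM; [exact: cf|exact: cg].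
by apply/funext => z; rewrite mxE.
Qed.

Lemma mx_continuous_tr p q (f : T -> 'M[R]_(p, q)) x :
  mx_continuous f x -> mx_continuous (fun z => (f z)^T) x.
Proof.
move=> cf i j; rewrite (_ : (fun z => _) = (fun z => f z j i)); first exact: cf.
by apply/funext => z; rewrite mxE.
Qed.

Lemma mx_continuous_near p q (f g : T -> 'M[R]_(p, q)) x :
  {near x, f =1 g} -> mx_continuous f x -> mx_continuous g x.
Proof.
move=> fg cf i j; apply: near_eq_continuous (cf i j).
by apply: filterS fg => z ->.
Qed.

Lemma continuous_det n (f : T -> 'M[R]_n) x :
  mx_continuous f x -> {for x, continuous (fun z => \det (f z))}.
Proof.
move=> cf; apply: continuous_big_sum => s.
apply: continuousM; first exact: cst_continuous.
by apply: continuous_big_prod => i; exact: cf.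
Qed.

(** Cramer's rule. On singular matrices [invmx] returns its argument, hence invertibility is assumed
    on a whole neighbourhood. *)
Lemma mx_continuous_inv n (f : T -> 'M[R]_n) x :
  (\forall z \near x, f z \in unitmx) ->
  mx_continuous f x -> mx_continuous (fun z => invmx (f z)) x.
Proof.
move=> fu cf; have fux := nbhs_singleton fu.
apply: (@mx_continuous_near _ _ (fun z => (\det (f z))^-1 *: \adj (f z))).
  by apply: filterS fu => z fz; rewrite /invmx fz.
move=> i j; rewrite (_ : (fun z => _) = (fun z => (\det (f z))^-1 * (\adj (f z)) i j)); last first.
  by apply/funext => z; rewrite mxE.
apply: continuousM.
  apply: continuousV; last exact: continuous_det.
  by move: fux; rewrite unitmxE unitfE.
rewrite (_ : (fun z => _) = (fun z => (-1) ^+ (j + i) * \det (row' j (col' i (f z))))); last first.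
  by apply/funext => z; rewrite mxE.
apply: continuousM; first exact: cst_continuous.
apply: continuous_det => k l.
rewrite (_ : (fun z => _) = (fun z => f z (lift j k) (lift i l))); first exact: cf.
by apply/funext => z; rewrite !mxE.
Qed.

End MatrixContinuity.

(** * Positive definite forms *)

Section PosDef.
Context {R : realType} {m : nat}.
Implicit Types (h : 'M[R]_m) (v w : 'rV[R]_m).

Lemma bilinDl h u v w : bilin h (u + v) w = bilin h u w + bilin h v w.
Proof. by rewrite /bilin !mulmxDl mxE. Qed.

Lemma bilinDr h u v w : bilin h u (v + w) = bilin h u v + bilin h u w.
Proof. by rewrite /bilin linearD mulmxDr mxE. Qed.

Lemma bilinZl h (a : R) v w : bilin h (a *: v) w = a * bilin h v w.
Proof. by rewrite /bilin -!scalemxAl mxE. Qed.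

Lemma bilinZr h (a : R) v w : bilin h v (a *: w) = a * bilin h v w.
Proof. by rewrite /bilin linearZ -scalemxAr mxE. Qed.

Lemma bilin0l h w : bilin h 0 w = 0.
Proof. by rewrite /bilin !mul0mx mxE. Qed.

Lemma bilin0r h w : bilin h w 0 = 0.
Proof. by rewrite /bilin trmx0 mulmx0 mxE. Qed.

Lemma bilinNl h v w : bilin h (- v) w = - bilin h v w.
Proof. by rewrite -scaleN1r bilinZl mulN1r. Qed.

Lemma bilinNr h v w : bilin h v (- w) = - bilin h v w.
Proof. by rewrite -scaleN1r bilinZr mulN1r. Qed.

Lemma bilinE h v w : bilin h v w = \sum_j (\sum_i v 0 i * h i j) * w 0 j.
Proof. by rewrite /bilin mxE; apply: eq_bigr => j _; rewrite !mxE. Qed.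

Lemma posdef_ge0 h v : sym_posdef (bilin h) -> 0 <= bilin h v v.
Proof.
by move=> [_ p]; have [->|/p/ltW//] := eqVneq v 0; rewrite bilin0l.
Qed.

Lemma posdef_unit h : sym_posdef (bilin h) -> h \in unitmx.
Proof.
move=> [_ p]; rewrite unitmxE unitfE; apply/det0P => -[v v0 vh].
by have := p v v0; rewrite /bilin vh mul0mx mxE ltxx.
Qed.

Lemma sum_ord_const (a : R) : \sum_(j < m) a = m%:R * a.
Proof. by rewrite sumr_const card_ord [RHS]mulr_natl. Qed.

Lemma bilin_norm_le h (b : R) v w : 0 <= b -> (forall i j, `|h i j| <= b) ->
  `|bilin h v w| <= (m%:R ^+ 2 * b) * (`|v| * `|w|).
Proof.
move=> b0 hb; rewrite bilinE; apply: le_trans (ler_norm_sum _ _ _) _.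
apply: (@le_trans _ _ (\sum_(j < m) (m%:R * b * (`|v| * `|w|)))); last first.
  by rewrite sum_ord_const !mulrA -expr2.
apply: ler_sum => j _; rewrite normrM -!mulrA (mulrCA b) mulrA -(mulrA _ b).
have -> : m%:R * (`|v| * (b * `|w|)) = (m%:R * (`|v| * b)) * `|w| by ring.
apply: ler_pM => //; last exact: norm_coord_le.
apply: le_trans (ler_norm_sum _ _ _) _.
apply: (@le_trans _ _ (\sum_(i < m) (`|v| * b))); last by rewrite sum_ord_const.
by apply: ler_sum => i _; rewrite normrM ler_pM//; exact: norm_coord_le.
Qed.

Lemma posdef_coercive h : sym_posdef (bilin h) ->
  exists2 a, 0 < a & forall v, a * `|v| ^+ 2 <= bilin h v v.
Proof.
move=> [_ p].
have cB : continuous (fun v => bilin h v v).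
  move=> v; rewrite (_ : (fun v => _) = (fun v => \sum_j (\sum_i v 0 i * h i j) * v 0 j)); last first.
    by apply/funext => u; rewrite bilinE.
  apply: continuous_big_sum => j; apply: continuousM; last exact: coord_continuous.
  apply: continuous_big_sum => i; apply: continuousM; first exact: coord_continuous.
  exact: cst_continuous.
have cK : compact [set v : 'rV[R]_m | `|v| = 1].
  apply: (subclosed_compact _ (@cbox_compact R m 0 1)).
    have := @preimage_closed _ _ (fun v : 'rV[R]_m => `|v|) [set 1 : R].
    by apply; [move=> v _; exact: norm_continuous|exact: closed_eq].
  by move=> v /= v1; rewrite /cbox /= subr0 v1.
have [a a0 ha] : exists2 a, 0 < a & forall v, [set v : 'rV[R]_m | `|v| = 1] v -> a <= bilin h v v.
  apply: (compact_pos_bound cK) => [v _|v /= v1]; first exact: cB.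
  by apply: p; apply/eqP => v0; move: v1; rewrite v0 normr0 => /eqP; rewrite eq_sym oner_eq0.
exists a => // v; have [->|v0] := eqVneq v 0; first by rewrite normr0 expr0n mulr0 bilin0l.
have nv0 : 0 < `|v| by rewrite normr_gt0.
have /ha : [set v : 'rV[R]_m | `|v| = 1] (`|v|^-1 *: v).
  by rewrite /= normrZ normfV normr_id mulVf// lt0r_neq0.
rewrite bilinZl bilinZr mulrA -expr2 exprVn mulrC ler_pdivlMr ?exprn_gt0//.
Qed.

End PosDef.

Lemma mxBE (R : realType) p q (B C : 'M[R]_(p, q)) i j : (B - C) i j = B i j - C i j.
Proof. by rewrite !mxE. Qed.

Lemma posdef_coercive_near (R : realType) m (Y : topologicalType) (h : Y -> 'M[R]_m) x :
  sym_posdef (bilin (h x)) -> mx_continuous h x ->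
  exists2 a, 0 < a & \forall z \near x, forall v, a * `|v| ^+ 2 <= bilin (h z) v v.
Proof.
move=> hx ch; have [a a0 ha] := posdef_coercive hx.
(* Changing every entry by at most [b] changes the form at [v] by at most [m ^ 2 * b * |v| ^ 2],
   which is below [a / 2 * |v| ^ 2]. The [+ 1] covers [m = 0]. *)
pose b := a / (2 * (m%:R ^+ 2 + 1)).
have m0 : (0 : R) <= m%:R ^+ 2 by exact: sqr_ge0.
have m1 : (0 : R) < m%:R ^+ 2 + 1 by lra.
have b0 : 0 < b by rewrite /b divr_gt0// mulr_gt0.
exists (a / 2); first by rewrite divr_gt0.
have : \forall z \near x, forall i j, `|(h x - h z) i j| <= b.
  apply: filter_forall => i; apply: filter_forall => j.
  have : h z i j @[z --> x] --> h x i j by exact: ch.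
  by move=> /cvgrPdist_le/(_ b b0); apply: filterS => z; rewrite mxBE.
apply: filterS => z hz v.
have hb := bilin_norm_le v v (ltW b0) hz.
have e : bilin (h x - h z) v v = bilin (h x) v v - bilin (h z) v v.
  by rewrite /bilin mulmxBr mulmxBl mxBE.
have := ha v; rewrite e in hb.
have h1 := le_trans (ler_norm _) hb.
have : m%:R ^+ 2 * b * (`|v| * `|v|) <= a / 2 * `|v| ^+ 2.
  rewrite -expr2 ler_wpM2r ?sqr_ge0// /b mulrA ler_pdivrMr ?mulr_gt0//.
  by rewrite (_ : a / 2 * _ = a * m%:R ^+ 2 + a); [rewrite mulrC lerDl ltW|field].
by lra.
Qed.

(** * Change of coordinates *)

Section Frame.
Context {R : realType} {M : ptopologicalType} {m : nat} (S : manifold R M m).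
Implicit Types (c : chart R M m) (Omega W : set M) (f : M -> R).

Lemma jacobianE n k (f : 'rV[R]_n -> 'rV[R]_k) y i j : differentiable f y ->
  ('J f y) i j = pderiv i (fun z => f z 0 j) y.
Proof.
move=> df; rewrite /jacobian mxE diff_row// pderiv_diff//.
rewrite (_ : (fun z => _) = coor j \o f)//.
by apply: differentiable_comp => //; exact: differentiable_coor.
Qed.

Lemma transition_mem c c' x : cdom c x -> cdom c' x ->
  (c @` (cdom c `&` (cdom c' `&` setT))) (c x).
Proof. by move=> cx c'x; exists x. Qed.

Lemma differentiable_transition c c' x : atlas S c -> atlas S c' ->
  cdom c x -> cdom c' x -> differentiable (c' \o cinv c) (c x).
Proof.
move=> ac ac' cx c'x; apply: differentiable_row => j.
by apply: (Ck_transition 1 j ac ac' openT).1; exact: transition_mem.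
Qed.

Definition jac c c' (x : M) : 'M[R]_m := 'J (c' \o cinv c) (c x).

Lemma jacE c c' x i j : atlas S c -> atlas S c' -> cdom c x -> cdom c' x ->
  jac c c' x i j = pderiv i (fun z => (c' \o cinv c) z 0 j) (c x).
Proof. by move=> ac ac' cx c'x; apply/jacobianE/differentiable_transition. Qed.

Lemma dchart_change c c' Omega f x : atlas S c -> atlas S c' -> Ck_on S 1 Omega f ->
  Omega x -> cdom c x -> cdom c' x ->
  dchart c f x = dchart c' f x *m (jac c c' x)^T.
Proof.
move=> ac ac' hf Ox cx c'x; apply/rowP => i; rewrite [LHS]mxE [RHS]mxE.
have dt := differentiable_transition ac ac' cx c'x.
have df : differentiable (f \o cinv c') ((c' \o cinv c) (c x)).
  by rewrite /= cmapK//; exact: Ck_on_differentiable hf Ox c'x.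
have e : {near c x, (f \o cinv c') \o (c' \o cinv c) =1 f \o cinv c}.
  have oV : open (c @` (cdom c `&` cdom c')) by apply: cimg_openI; exact: cdom_open.
  apply: filterS (open_nbhs_nbhs (conj oV (cimg_mem cx c'x))) => _ [z [cz c'z] <-].
  by rewrite /= cmapK// cmapK.
rewrite -(near_eq_pderiv i e) pderiv_comp//; apply: eq_bigr => j _.
by rewrite [_^T _ _]mxE jacE// mulrC [dchart _ _ _ _ _]mxE /= cmapK.
Qed.

(** The two transition maps are inverse to each other near [c x]; the chain rule differentiates this
    local identity coordinate by coordinate. *)
Lemma jac_mul c c' x : atlas S c -> atlas S c' -> cdom c x -> cdom c' x ->
  jac c c' x *m jac c' c x = 1%:M.
Proof.
move=> ac ac' cx c'x; apply/matrixP => i k; rewrite [LHS]mxE [RHS]mxE.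
have dt := differentiable_transition ac ac' cx c'x.
have dt' := differentiable_transition ac' ac c'x cx.
have e0 : (c' \o cinv c) (c x) = c' x by rewrite /= cmapK.
have dk : differentiable (coor k \o (c \o cinv c')) ((c' \o cinv c) (c x)).
  by rewrite e0; exact: (differentiable_comp dt' (differentiable_coor k _)).
have e : {near c x, (coor k \o (c \o cinv c')) \o (c' \o cinv c) =1 coor k}.
  have oV : open (c @` (cdom c `&` cdom c')) by apply: cimg_openI; exact: cdom_open.
  apply: filterS (open_nbhs_nbhs (conj oV (cimg_mem cx c'x))) => _ [z [cz c'z] <-].
  by rewrite /= cmapK// cmapK.
have := near_eq_pderiv i e.
rewrite pderiv_coor /= pderiv_comp// => <-; apply: eq_bigr => j _.
by rewrite e0 -(jacE i j ac ac' cx c'x) -(jacE j k ac' ac c'x cx).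
Qed.

Lemma jac_unit c c' x : atlas S c -> atlas S c' -> cdom c x -> cdom c' x ->
  jac c c' x \in unitmx.
Proof.
by move=> ac ac' cx c'x; case: (mulmx1_unit (jac_mul ac ac' cx c'x)) => h _; exact: h.
Qed.

Variables (c : chart R M m) (x : M).
Hypotheses (ac : atlas S c) (cx : cdom c x).

Lemma frame_unit : frame S c x \in unitmx.
Proof. by apply: jac_unit => //; [exact: chart_at_atlas|exact: chart_at_dom]. Qed.

Lemma dchart_frame Omega f : Ck_on S 1 Omega f -> Omega x ->
  dchart c f x = differential S f x *m (frame S c x)^T.
Proof.
move=> hf Ox; apply: (dchart_change ac) hf Ox cx _.
  exact: chart_at_atlas.
exact: chart_at_dom.
Qed.

Lemma bilin_frame (h : M -> 'M[R]_m) (v w : 'rV[R]_m) :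
  bilin (h x) (v *m frame S c x) (w *m frame S c x) = bilin (tensor_in S h c x) v w.
Proof. by rewrite /bilin /tensor_in trmx_mul !mulmxA. Qed.

Lemma vector_frame (X : M -> 'rV[R]_m) :
  X x = vector_in S X c x *m frame S c x.
Proof.
rewrite /vector_in -/(jac (chart_at S x) c x) -mulmxA jac_mul ?mulmx1//.
  exact: chart_at_atlas.
exact: chart_at_dom.
Qed.

Lemma tensor_in_posdef (h : M -> 'M[R]_m) : sym_posdef (bilin (h x)) ->
  sym_posdef (bilin (tensor_in S h c x)).
Proof.
move=> [hs hp]; split=> [v w|v v0]; rewrite -!bilin_frame; first exact: hs.
apply: hp.
apply: contra_neq v0 => v0.
by rewrite -(mulmxK frame_unit v) v0 mul0mx.
Qed.

End Frame.

(** * Gradients in a fixed chart *)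

Section Metric.
Context {R : realType} {M : ptopologicalType} {m : nat} {S : manifold R M m}.
Variable g : riemannian_metric S.
Implicit Types (c : chart R M m) (Omega W : set M) (f u psi : M -> R).

Definition gchart c (x : M) : 'M[R]_m := tensor_in S g c x.

Definition gradc c f (x : M) : 'rV[R]_m := dchart c f x *m invmx (gchart c x).

Lemma gchart_posdef c x : atlas S c -> cdom c x -> sym_posdef (bilin (gchart c x)).
Proof. by move=> ac cx; apply: tensor_in_posdef => //; exact: metric_sym_posdef. Qed.

Lemma gchart_unit c x : atlas S c -> cdom c x -> gchart c x \in unitmx.
Proof. by move=> ac cx; apply: posdef_unit; exact: gchart_posdef. Qed.

(** Raising an index commutes with a change of frame [F]: the differential brings [F^T], the inverse
    metric brings [F^-T] on its left and [F^-1] on its right, and everything cancels against the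
    final [F]. *)
Lemma grad_chart c Omega f x : atlas S c -> Ck_on S 1 Omega f -> Omega x -> cdom c x ->
  grad g f x = gradc c f x *m frame S c x.
Proof.
move=> ac hf Ox cx; rewrite /grad /gradc (dchart_frame ac cx hf Ox).
have Fu := frame_unit ac cx.
have gu : g x \in unitmx by apply: posdef_unit; exact: metric_sym_posdef.
set F := frame S c x in Fu *.
have FTu : F^T \in unitmx by rewrite unitmx_tr.
have -> : invmx (gchart c x) = invmx F^T *m invmx (g x) *m invmx F.
  have Bu : F *m g x *m F^T \in unitmx by rewrite !unitmx_mul Fu gu FTu.
  have e : invmx F^T *m invmx (g x) *m invmx F *m (F *m g x *m F^T) = 1%:M.
    by rewrite !mulmxA mulmxKV// -(mulmxA _ (invmx (g x))) mulVmx// mulmx1 mulVmx.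
  rewrite -[RHS](mulmxK Bu) e mul1mx.
  by [].
by rewrite !mulmxA mulmxKV// mulmxK.
Qed.

Definition norm2c c u x : R := bilin (gchart c x) (gradc c u x) (gradc c u x).

Lemma tnorm_grad_chart c Omega u x : atlas S c -> Ck_on S 1 Omega u -> Omega x ->
  cdom c x -> tnorm g x (grad g u x) = Num.sqrt (norm2c c u x).
Proof.
move=> ac hu Ox cx; rewrite /tnorm /inner (grad_chart ac hu Ox cx).
by rewrite bilin_frame.
Qed.

Variables (A : R -> R) (T : M -> 'M[R]_m) (X : M -> 'rV[R]_m).

Lemma weak_form_chart c Omega u psi x : atlas S c -> Ck_on S 1 Omega u ->
  Ck_on S 1 Omega psi -> Omega x -> cdom c x ->
  weak_form g A T X u psi x =
  A (Num.sqrt (norm2c c u x)) * bilin (tensor_in S T c x) (gradc c u x) (gradc c psi x) +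
  bilin (gchart c x) (vector_in S X c x) (gradc c u x) * psi x.
Proof.
move=> ac hu hp Ox cx; rewrite /weak_form (tnorm_grad_chart ac hu Ox cx).
rewrite (grad_chart ac hu Ox cx) (grad_chart ac hp Ox cx) bilin_frame; congr (_ + _ * _).
by rewrite /inner (vector_frame ac cx) bilin_frame.
Qed.

Lemma nbhs_cdom c x : cdom c x -> nbhs x (cdom c).
Proof. by move=> cx; apply: open_nbhs_nbhs; split => //; exact: cdom_open. Qed.

Lemma mx_continuous_gchart c x : atlas S c -> cdom c x -> mx_continuous (gchart c) x.
Proof.
move=> ac cx i j.
have ck := @metric_smooth _ _ _ _ g c ac i j 0%N.
apply: (@near_eq_continuous _ _ ((fun y => tensor_in S g c (cinv c y) i j) \o c)).
  by apply: filterS (nbhs_cdom cx) => z cz; rewrite /= cmapK.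
apply: continuous_comp; first exact: cmap_cont.
by apply: ck; exists x.
Qed.

Lemma mx_continuous_dchart c Omega u x : atlas S c -> open Omega -> Ck_on S 1 Omega u ->
  Omega x -> cdom c x -> mx_continuous (dchart c u) x.
Proof. by move=> ac oO hu Ox cx i j; rewrite (ord1 i); exact: continuous_dchart hu Ox cx. Qed.

Lemma mx_continuous_invg c x : atlas S c -> cdom c x ->
  mx_continuous (fun z => invmx (gchart c z)) x.
Proof.
move=> ac cx; apply: mx_continuous_inv; last exact: mx_continuous_gchart.
by apply: filterS (nbhs_cdom cx) => z cz; exact: gchart_unit.
Qed.

Lemma mx_continuous_gradc c Omega u x : atlas S c -> open Omega -> Ck_on S 1 Omega u ->
  Omega x -> cdom c x -> mx_continuous (gradc c u) x.
Proof.
move=> ac oO hu Ox cx; apply: mx_continuous_mul; last exact: mx_continuous_invg.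
exact: mx_continuous_dchart hu Ox cx.
Qed.

Lemma continuous_bilin (h : M -> 'M[R]_m) (v w : M -> 'rV[R]_m) x :
  mx_continuous h x -> mx_continuous v x -> mx_continuous w x ->
  {for x, continuous (fun z => bilin (h z) (v z) (w z))}.
Proof.
move=> ch cv cw; apply: (mx_continuous_mul (mx_continuous_mul cv ch) (mx_continuous_tr cw)).
Qed.

Lemma continuous_norm2c c Omega u x : atlas S c -> open Omega -> Ck_on S 1 Omega u ->
  Omega x -> cdom c x -> {for x, continuous (norm2c c u)}.
Proof.
move=> ac oO hu Ox cx; have cg := mx_continuous_gradc ac oO hu Ox cx.
by apply: continuous_bilin => //; exact: mx_continuous_gchart.
Qed.

Lemma continuous_tnorm_grad Omega u x : open Omega -> Ck_on S 1 Omega u ->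
  Omega x -> {for x, continuous (fun z => tnorm g z (grad g u z))}.
Proof.
move=> oO hu Ox; pose c := chart_at S x.
have ac : atlas S c by exact: chart_at_atlas.
have cx : cdom c x by exact: chart_at_dom.
apply: (@near_eq_continuous _ _ (Num.sqrt \o norm2c c u)).
  apply: filterS2 (nbhs_cdom cx) (open_nbhs_nbhs (conj oO Ox)) => z cz Oz.
  by rewrite (tnorm_grad_chart ac hu Oz cz).
apply: continuous_comp; first exact: continuous_norm2c hu Ox cx.
exact: sqrt_continuous.
Qed.

Hypotheses (hT1 : T1 S T) (hX : vector_field S X) (hA1 : A1 A) (hA2 : A2 A).

Lemma mx_continuous_tensor c x : atlas S c -> cdom c x -> mx_continuous (tensor_in S T c) x.
Proof. by move=> ac cx i j; exact: hT1.1. Qed.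

Lemma mx_continuous_vector c x : atlas S c -> cdom c x -> mx_continuous (vector_in S X c) x.
Proof. by move=> ac cx i j; rewrite (ord1 i); exact: hX. Qed.

Definition fluxc c u x : 'rV[R]_m := A (Num.sqrt (norm2c c u x)) *: gradc c u x.

End Metric.

(** * The operator *)

Section Phi.
Context {R : realType}.
Variable A : R -> R.
Hypotheses (hA1 : A1 A) (hA2 : A2 A).

Lemma A_continuous t : 0 < t -> {for t, continuous A}.
Proof. by move=> /hA1[dA _]; exact/differentiable_continuous/derivable1_diffP. Qed.

Lemma phi_derivable t : 0 < t -> derivable (phi A) t 1.
Proof.
move=> /hA1[dA _]; exact: (@derivableM _ _ id A t 1 (@derivable_id _ _ _ _) dA).
Qed.

Lemma phi_lt s t : 0 < s -> s < t -> phi A s < phi A t.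
Proof.
move=> s0 st; have pos r : s <= r -> 0 < r by exact: lt_le_trans.
apply: (@gtr0_derive1_lt_cc _ (phi A) s t) => //.
- by move=> r; rewrite in_itv /= => /andP[/ltW/pos r0 _]; exact: phi_derivable.
- by move=> r; rewrite in_itv /= => /andP[/ltW/pos r0 _]; exact: hA2.1.
- apply: continuous_at_within => r /=; rewrite in_itv /= => /andP[/pos r0 _].
  by apply: differentiable_continuous; apply/derivable1_diffP; exact: phi_derivable.
- by rewrite in_itv /= lexx ltW.
- by rewrite in_itv /= lexx ltW.
Qed.

(** [phi A (t / 2)] is at least 0, the limit of the values to its left, and the increase from
    [t / 2] to [t] is strict. *)
Lemma phi_gt0 t : 0 < t -> 0 < phi A t.
Proof.
move=> t0; have t20 : 0 < t / 2 by rewrite divr_gt0.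
apply: le_lt_trans (phi_lt t20 _); last by rewrite ltr_pdivrMr// mulr_natr mulr2n ltrDl.
apply: (cvgr_to_le hA2.2); near=> r.
by apply/ltW/phi_lt; near: r; [exact: nbhs_right_gt|exact: nbhs_right_lt].
Unshelve. all: by end_near. Qed.

Lemma A_gt0 t : 0 < t -> 0 < A t.
Proof. by move=> t0; have := phi_gt0 t0; rewrite /phi pmulr_rgt0. Qed.

Lemma phi_small (e : R) : 0 < e -> exists2 d, 0 < d & forall t, 0 < t -> t < d -> phi A t < e.
Proof.
move=> e0; have := hA2.2 => /cvgrPdist_lt/(_ e e0)/nbhs_ballP[d /= d0 hd].
exists d => // t t0 td.
have := hd t; rewrite /ball /= sub0r normrN (gtr0_norm t0) => /(_ td t0).
by rewrite sub0r normrN; apply: le_lt_trans; exact: ler_norm.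
Qed.

(** [A] may blow up at 0, but with [p = Num.sqrt (n z)] the hypothesis gives
    [A p * |v z| <= phi A p / Num.sqrt a], which tends to 0 by (A2). Where [p = 0] the value [A 0]
    is arbitrary, but it is multiplied by [v z = 0]. *)
Lemma continuous_flux0 (Y : topologicalType) (n v : Y -> R) (x : Y) (a : R) :
  0 < a -> (\forall z \near x, a * (v z) ^+ 2 <= n z) ->
  {for x, continuous n} -> n x = 0 -> {for x, continuous (fun z => A (Num.sqrt (n z)) * v z)}.
Proof.
move=> a0 avn cn nx0.
have v0 : v x = 0.
  have := nbhs_singleton avn; rewrite nx0 pmulr_rle0// => h.
  by apply/eqP; rewrite -sqrf_eq0 eq_le h sqr_ge0.
have csq : Num.sqrt (n z) @[z --> x] --> Num.sqrt (n x).
  by apply: (continuous_comp cn); exact: sqrt_continuous.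
rewrite nx0 sqrtr0 in csq.
suff : A (Num.sqrt (n z)) * v z @[z --> x] --> A (Num.sqrt (n x)) * v x by [].
rewrite v0 mulr0; apply/cvgrPdist_lt => e e0.
pose b := Num.sqrt a; have b0 : 0 < b by rewrite sqrtr_gt0.
have [d d0 hd] := phi_small (mulr_gt0 e0 b0).
move/cvgrPdist_lt : csq => /(_ d d0) hs.
near=> z; rewrite sub0r normrN.
have hz : a * (v z) ^+ 2 <= n z by near: z.
have : `|0 - Num.sqrt (n z)| < d by near: z.
set p := Num.sqrt _ => pd'.
have pd : p < d by move: pd'; rewrite sub0r normrN; apply: le_lt_trans; exact: ler_norm.
have vp : b * `|v z| <= p.
  have -> : b * `|v z| = Num.sqrt (a * (v z) ^+ 2).
    by rewrite sqrtrM ?(ltW a0)// sqrtr_sqr.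
  exact: ler_wsqrtr.
have [p0|p0] := ltP 0 p; last first.
  have -> : v z = 0; last by rewrite mulr0 normr0.
  by apply/eqP; rewrite -normr_le0 -(pmulr_rle0 _ b0); exact: le_trans p0.
rewrite normrM (gtr0_norm (A_gt0 p0)) -(ltr_pM2r b0).
apply: le_lt_trans (hd p p0 pd); rewrite /phi -mulrA (mulrC p) ler_wpM2l//.
  exact/ltW/A_gt0.
by rewrite mulrC.
Unshelve. all: by end_near. Qed.

End Phi.

(** * The integrand of the weak formulation *)

Section WeakForm.
Context {R : realType} {M : ptopologicalType} {m : nat} {S : manifold R M m}.
Variable g : riemannian_metric S.
Implicit Types (c : chart R M m) (Omega W : set M) (f u psi : M -> R).
Variables (A : R -> R) (T : M -> 'M[R]_m) (X : M -> 'rV[R]_m).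
Hypotheses (hT1 : T1 S T) (hX : vector_field S X) (hA1 : A1 A) (hA2 : A2 A).

Lemma tnorm_eq0 x v : (tnorm g x v == 0) = (v == 0).
Proof.
apply/idP/idP => [|/eqP ->]; last by rewrite /tnorm /inner bilin0l sqrtr0.
apply: contraTT => v0; rewrite /tnorm sqrtr_eq0 -ltNge.
by have [_] := metric_sym_posdef g x; exact.
Qed.

Lemma tnorm_gt0 x v : (0 < tnorm g x v) = (v != 0).
Proof. by rewrite lt_def sqrtr_ge0 andbT tnorm_eq0. Qed.

Lemma mx_continuous_fluxc c Omega u x : atlas S c -> open Omega -> Ck_on S 1 Omega u ->
  Omega x -> cdom c x -> mx_continuous (fluxc g A c u) x.
Proof.
move=> ac oO hu Ox cx i j; rewrite (ord1 i).
have cg := (mx_continuous_gradc (g:=g) ac oO hu Ox cx).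
have cn := (continuous_norm2c (g:=g) ac oO hu Ox cx).
have csq : {for x, continuous (fun z => Num.sqrt (norm2c g c u z))}.
  by apply: continuous_comp cn _; exact: sqrt_continuous.
have E : (fun z => fluxc g A c u z 0 j) =
    (fun z => A (Num.sqrt (norm2c g c u z)) * gradc g c u z 0 j).
  by apply/funext => z; rewrite mxE.
rewrite E; have gp := gchart_posdef g ac cx.
have [g0|g0] := eqVneq (gradc g c u x) 0; last first.
  apply: continuousM; last exact: cg.
  apply: continuous_comp csq _; apply: A_continuous => //.
  by rewrite sqrtr_gt0; exact: gp.2.
have [a a0 ha] := posdef_coercive_near gp (mx_continuous_gchart (g:=g) ac cx).
apply: (continuous_flux0 hA1 hA2 a0) => //; last by rewrite /norm2c g0 bilin0l.
apply: filterS ha => z hz; apply: le_trans (hz (gradc g c u z)).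
rewrite ler_wpM2l ?(ltW a0)// -real_normK ?num_real// ler_pXn2r ?nnegrE//.
exact: norm_coord_le.
Qed.

Lemma grad_dchart f x : grad g f x = dchart (chart_at S x) f x *m invmx (g x).
Proof. by []. Qed.

Lemma grad_near f h x : {near x, f =1 h} -> grad g f x = grad g h x.
Proof.
by move=> fh; rewrite !grad_dchart (dchart_near (chart_at_dom S x) fh).
Qed.

Lemma grad_cst (a : R) x : grad g (cst a) x = 0.
Proof. by rewrite grad_dchart dchart_cst mul0mx. Qed.

Lemma gradD Omega f h x : Ck_on S 1 Omega f -> Ck_on S 1 Omega h -> Omega x ->
  grad g (f + h) x = grad g f x + grad g h x.
Proof.
move=> hf hh Ox; rewrite !grad_dchart.
by rewrite (dchartD (chart_at_atlas S x) hf hh Ox (chart_at_dom S x)) mulmxDl.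
Qed.

Lemma gradN Omega f x : Ck_on S 1 Omega f -> Omega x -> grad g (- f) x = - grad g f x.
Proof.
move=> hf Ox; rewrite !grad_dchart.
by rewrite (dchartN (chart_at_atlas S x) hf Ox (chart_at_dom S x)) mulNmx.
Qed.

Lemma grad_comp1 Omega (h h' : R -> R) f x : Ck_on S 1 Omega f ->
  Omega x -> is_derive (f x) (1 : R) h (h' (f x)) ->
  grad g (h \o f) x = h' (f x) *: grad g f x.
Proof.
move=> hf Ox dh; rewrite !grad_dchart.
by rewrite (dchart_comp1 (chart_at_atlas S x) hf Ox (chart_at_dom S x) dh) scalemxAl.
Qed.

(** Coefficients of the differential of [psi] in the weak form: in a fixed chart the integrand is
    linear in [psi] and its first derivatives, with continuous coefficients. The transposed inverse
    metric comes from the gradient of [psi]. *)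
Definition coefc c u x : 'rV[R]_m :=
  fluxc g A c u x *m tensor_in S T c x *m (invmx (gchart g c x))^T.

Definition drift u x : R := inner g x (X x) (grad g u x).

Lemma weak_form_row c Omega u psi x : atlas S c -> Ck_on S 1 Omega u ->
  Ck_on S 1 Omega psi -> Omega x -> cdom c x ->
  weak_form g A T X u psi x =
  (coefc c u x *m (dchart c psi x)^T) 0 0 + drift u x * psi x.
Proof.
move=> ac hu hp Ox cx; rewrite (weak_form_chart _ _ _ _ ac hu hp Ox cx).
rewrite -bilinZl; congr (_ + _ * _).
  by rewrite /bilin /coefc [(gradc _ _ _ _)^T]trmx_mul !mulmxA.
by rewrite /drift /inner (grad_chart g ac hu Ox cx) [in RHS](vector_frame ac cx X) bilin_frame.
Qed.

Lemma continuous_drift Omega u x : open Omega -> Ck_on S 1 Omega u -> Omega x ->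
  {for x, continuous (drift u)}.
Proof.
move=> oO hu Ox; pose c := chart_at S x.
have ac : atlas S c by exact: chart_at_atlas.
have cx : cdom c x by exact: chart_at_dom.
apply: (@near_eq_continuous _ _ (fun z => bilin (gchart g c z) (vector_in S X c z) (gradc g c u z))).
  apply: filterS2 (nbhs_cdom cx) (open_nbhs_nbhs (conj oO Ox)) => z cz Oz.
  by rewrite /drift /inner (grad_chart g ac hu Oz cz) [in RHS](vector_frame ac cz X) bilin_frame.
apply: continuous_bilin.
- exact: mx_continuous_gchart.
- exact: mx_continuous_vector.
- exact: mx_continuous_gradc oO hu Ox cx.
Qed.

Lemma mx_continuous_coefc c Omega u x : atlas S c -> open Omega -> Ck_on S 1 Omega u ->
  Omega x -> cdom c x -> mx_continuous (coefc c u) x.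
Proof.
move=> ac oO hu Ox cx; apply: mx_continuous_mul; last first.
  by apply: mx_continuous_tr; exact: mx_continuous_invg.
apply: mx_continuous_mul; first exact: mx_continuous_fluxc oO hu Ox cx.
exact: mx_continuous_tensor.
Qed.

Lemma continuous_weak_form Omega u psi x : open Omega -> Ck_on S 1 Omega u ->
  Ck_on S 1 Omega psi -> Omega x -> {for x, continuous (weak_form g A T X u psi)}.
Proof.
move=> oO hu hp Ox; pose c := chart_at S x.
have ac : atlas S c by exact: chart_at_atlas.
have cx : cdom c x by exact: chart_at_dom.
apply: (@near_eq_continuous _ _
  ((fun z => (coefc c u z *m (dchart c psi z)^T) 0 0) + (drift u * psi))).
  apply: filterS2 (nbhs_cdom cx) (open_nbhs_nbhs (conj oO Ox)) => z cz Oz.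
  by rewrite (weak_form_row ac hu hp Oz cz).
apply: continuousD.
  apply: mx_continuous_mul; first exact: mx_continuous_coefc oO hu Ox cx.
  by apply: mx_continuous_tr; exact: mx_continuous_dchart oO hp Ox cx.
apply: continuousM; first exact: continuous_drift oO hu Ox.
exact: Ck_on_continuous oO hp Ox.
Qed.

(** The bound is uniform in [psi], so functions close in C^1 on [K] have weak forms that are
    uniformly close there. *)
Lemma weak_form_bound c Omega u (K : set M) : atlas S c -> open Omega ->
  Ck_on S 1 Omega u -> compact K -> K `<=` cdom c -> K `<=` Omega ->
  exists2 B, 0 <= B & forall psi x, Ck_on S 1 Omega psi -> K x ->
    `|weak_form g A T X u psi x| <= B * (`|dchart c psi x| + `|psi x|).
Proof.
move=> ac oO hu cK Kc KO.
have [B1 B10 hB1] : exists2 B, 0 <= B & forall x, K x -> `|\sum_i `|coefc c u x 0 i| | <= B.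
  apply: compact_bound => // x Kx; apply: continuous_big_sum => i.
  apply: (continuous_comp (f := fun z => coefc c u z 0 i)); last exact: norm_continuous.
  exact: (mx_continuous_coefc ac oO hu (KO _ Kx) (Kc _ Kx)).
have [B2 B20 hB2] : exists2 B, 0 <= B & forall x, K x -> `|drift u x| <= B.
  by apply: compact_bound => // x Kx; exact: continuous_drift oO hu (KO _ Kx).
exists (B1 + B2); first exact: addr_ge0.
move=> psi x hp Kx; rewrite (weak_form_row ac hu hp (KO _ Kx) (Kc _ Kx)).
apply: le_trans (ler_normD _ _) _; rewrite mulrDl; apply: lerD; last first.
  by rewrite normrM; apply: ler_pM => //; [exact: hB2|rewrite lerDr].
rewrite mxE; apply: le_trans (ler_norm_sum _ _ _) _.
apply: (@le_trans _ _ ((\sum_i `|coefc c u x 0 i|) * `|dchart c psi x|)).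
  rewrite mulr_suml; apply: ler_sum => i _; rewrite [_^T _ _]mxE normrM.
  by rewrite ler_wpM2l//; exact: norm_coord_le.
apply: ler_pM => //; first exact: sumr_ge0.
  exact: le_trans (ler_norm _) (hB1 _ Kx).
by rewrite lerDl.
Qed.

Lemma weak_formD Omega u f h x : Ck_on S 1 Omega f -> Ck_on S 1 Omega h -> Omega x ->
  weak_form g A T X u (f + h) x = weak_form g A T X u f x + weak_form g A T X u h x.
Proof.
move=> hf hh Ox; rewrite /weak_form (gradD hf hh Ox) bilinDr !fctE; ring.
Qed.

Lemma weak_formN Omega u f x : Ck_on S 1 Omega f -> Omega x ->
  weak_form g A T X u (- f) x = - weak_form g A T X u f x.
Proof.
move=> hf Ox; rewrite /weak_form (gradN hf Ox) bilinNr !fctE; ring.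
Qed.

Lemma weak_form_near u f h x : {near x, f =1 h} ->
  weak_form g A T X u f x = weak_form g A T X u h x.
Proof. by move=> fh; rewrite /weak_form (grad_near fh) (nbhs_singleton fh). Qed.

Lemma weak_form0 u f x : {near x, f =1 cst 0} -> weak_form g A T X u f x = 0.
Proof.
by move=> f0; rewrite (weak_form_near _ f0) /weak_form grad_cst bilin0r mulr0 mulr0 addr0.
Qed.

End WeakForm.

Lemma is_derive_A1 (R : realType) (A : R -> R) (p : R) : A1 A -> 0 < p ->
  is_derive p (1 : R) A (derive1 A p).
Proof.
by move=> hA1 /hA1[dAp _]; apply: (@DeriveDef _ _ _ _ _ _ _ dAp); rewrite derive1E.
Qed.

(** * Monotonicity of the flux *)

Section Monotone.
Context {R : realType} {M : ptopologicalType} {m : nat} {S : manifold R M m}.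
Variable g : riemannian_metric S.
Variables (A : R -> R) (T : M -> 'M[R]_m).
Hypotheses (hT1 : T1 S T) (hA1 : A1 A) (hA2 : A2 A) (hT2 : T2 g A T).
Implicit Types (x : M) (xi zeta v w : 'rV[R]_m).

Lemma is_derive_bilin (h : 'M[R]_m) xi v w (t : R) :
  is_derive t (1 : R) (fun s : R => bilin h (xi + s *: v) w) (bilin h v w).
Proof.
have -> : (fun s : R => bilin h (xi + s *: v) w) = cst (bilin h xi w) + bilin h v w \*: (@id R).
  by apply/funext => s; rewrite bilinDl bilinZl !fctE /= mulrC.
by apply: is_derive_eq; rewrite add0r; exact: mulr1.
Qed.

Lemma is_derive_sq_norm x xi v (t : R) :
  is_derive t (1 : R) (fun s : R => inner g x (xi + s *: v) (xi + s *: v))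
    (2 * inner g x (xi + t *: v) v).
Proof.
have [gs _] := metric_sym_posdef g x.
have -> : (fun s : R => inner g x (xi + s *: v) (xi + s *: v)) =
  (fun s : R => bilin (g x) (xi + s *: v) xi) + (@id R) * (fun s : R => bilin (g x) (xi + s *: v) v).
  by apply/funext => s; rewrite /inner bilinDr bilinZr !fctE.
have d1 := is_derive_bilin (g x) xi v xi t.
have d2 := is_derive_bilin (g x) xi v v t.
have d3 : is_derive t (1 : R) (@id R) (1 : R) by exact: is_derive_id.
apply: (@is_derive_eq _ _ _ _ _ _ _ _ (@is_deriveD _ _ _ _ _ _ _ _ _ d1 (@is_deriveM _ _ _ _ _ _ _ _ d3 d2))).
change (bilin (g x) v xi + (t * bilin (g x) v v + bilin (g x) (xi + t *: v) v * 1) =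
  2 * inner g x (xi + t *: v) v).
by rewrite /inner bilinDl bilinZl (gs v xi); ring.
Qed.

(** The derivative along a line is the quadratic form of (T2) at the current point, evaluated on the
    direction of the line. *)
Lemma is_derive_flux x xi v (t : R) : xi + t *: v != 0 ->
  is_derive t (1 : R)
    (fun s : R => A (tnorm g x (xi + s *: v)) * bilin (T x) (xi + s *: v) v)
    (derive1 A (tnorm g x (xi + t *: v)) / tnorm g x (xi + t *: v) *
        sym_prod (inner g x (xi + t *: v)) (bilin (T x) (xi + t *: v)) v v +
      A (tnorm g x (xi + t *: v)) * bilin (T x) v v).
Proof.
move=> z0; set z := xi + t *: v in z0 *; set p := tnorm g x z.
have p0 : 0 < p by rewrite tnorm_gt0.
have q0 : 0 < inner g x z z by move: p0; rewrite /p /tnorm sqrtr_gt0.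
have dn : is_derive t (1 : R) (fun s : R => tnorm g x (xi + s *: v)) ((2 * p)^-1 * (2 * inner g x z v)).
  exact: (@is_derive1_comp _ Num.sqrt (fun s : R => inner g x (xi + s *: v) (xi + s *: v)) t _ _
     (is_derive1_sqrt q0) (is_derive_sq_norm x xi v t)).
have dA : is_derive p (1 : R) A (derive1 A p).
  exact: is_derive_A1.
have dAn : is_derive t (1 : R) (fun s : R => A (tnorm g x (xi + s *: v)))
    (derive1 A p * ((2 * p)^-1 * (2 * inner g x z v))).
  exact: (@is_derive1_comp _ A (fun s : R => tnorm g x (xi + s *: v)) t _ _ dA dn).
have dB := is_derive_bilin (T x) xi v v t.
apply: (@is_derive_eq _ _ _ _ _ _ _ _ (@is_deriveM _ _ _ _ _ _ _ _ dAn dB)).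
rewrite -/z -/p.
change (A p * bilin (T x) v v + bilin (T x) z v * (derive1 A p * ((2 * p)^-1 * (2 * inner g x z v))) =
 derive1 A p / p * sym_prod (inner g x z) (bilin (T x) z) v v + A p * bilin (T x) v v).
rewrite /sym_prod; field; exact: lt0r_neq0.
Qed.

Lemma flux_along x v (s : R) : 0 <= s -> 0 <= A (tnorm g x (s *: v)) * bilin (T x) (s *: v) v.
Proof.
move=> s0; have [->|v0] := eqVneq v 0; first by rewrite bilin0r mulr0.
have [->|sn0] := eqVneq s 0; first by rewrite scale0r bilin0l mulr0.
rewrite mulr_ge0//; last by rewrite bilinZl mulr_ge0// posdef_ge0//; exact: hT1.2.
by apply/ltW/A_gt0 => //; rewrite tnorm_gt0 scaler_eq0 negb_or sn0.
Qed.

(* Along the segment from [zeta] to [xi] the derivative of the pairing is the form of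
   (T2); if the segment meets 0, both sides have a sign instead. *)
Lemma flux_monotone x xi zeta :
  A (tnorm g x zeta) * bilin (T x) zeta (xi - zeta) <=
  A (tnorm g x xi) * bilin (T x) xi (xi - zeta).
Proof.
set v := xi - zeta.
have [v0|v0] := eqVneq v 0; first by rewrite v0 !bilin0r !mulr0.
have xiE : xi = zeta + 1 *: v by rewrite scale1r /v addrC subrK.
have [[t [t01 zt]]|nz] := pselect (exists t : R, 0 <= t <= 1 /\ zeta + t *: v = 0).
  have /andP[t0 t1] := t01.
  have zE : zeta = - (t *: v) by apply/eqP; rewrite -addr_eq0 zt.
  have xE : xi = (1 - t) *: v by rewrite xiE zE scalerBl addrC.
  apply: (@le_trans _ _ 0); last by rewrite xE; apply: flux_along; rewrite subr_ge0.
  rewrite -oppr_ge0 -mulrN -bilinNl zE opprK.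
  have -> : tnorm g x (- (t *: v)) = tnorm g x (t *: v).
    by rewrite /tnorm /inner bilinNl bilinNr opprK.
  exact: flux_along.
pose F (s : R) := A (tnorm g x (zeta + s *: v)) * bilin (T x) (zeta + s *: v) v.
have nzt (t : R) : 0 <= t <= 1 -> zeta + t *: v != 0.
  by move=> t01; apply/eqP => zt; apply: nz; exists t.
have dF (t : R) (t01 : 0 <= t <= 1) := @is_derive_flux x zeta v t (nzt t t01).
suff : F 0 <= F 1 by rewrite /F scale0r addr0 -xiE.
have wk (t : R) : 0 < t < 1 -> 0 <= t <= 1 by move=> /andP[/ltW-> /ltW->].
apply: (@ger0_derive1_le_cc _ F 0 1).
- by move=> t; rewrite in_itv /= => /wk t01; case: (dF t t01).
- move=> t; rewrite in_itv /= => /wk t01.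
  rewrite derive1E (@derive_val _ _ _ _ _ _ _ (dF t t01)); apply/ltW.
  by have [_] := hT2 x (nzt t t01); apply.
- apply: continuous_at_within => t /=; rewrite in_itv /= => t01.
  by apply: differentiable_continuous; apply/derivable1_diffP; case: (dF t t01).
- by rewrite in_itv /= lexx ler01.
- by rewrite in_itv /= lexx ler01.
- exact: ler01.
Qed.

End Monotone.

(** * Lower bound for the flux term *)

Section FluxLower.
Context {R : realType} {m : nat}.
Variable A : R -> R.
Hypotheses (hA1 : A1 A) (hA2 : A2 A).
Implicit Types (B G : 'M[R]_m) (xi p : 'rV[R]_m).

(* Unless [B (xi, xi) >= B (xi, p)], which makes the right-hand side nonnegative,
   [|xi|] is at most a multiple of [rho] and (A3) applies. *)
Lemma flux_lower (omega C delta a b : R) : 0 < omega -> 0 < C -> 0 < delta ->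
  (forall t, 0 < t < omega -> phi A t <= C * t `^ delta) ->
  0 < a -> 0 < b ->
  exists C' rho0 : R, [/\ 0 < C', 0 < rho0 &
    forall B G xi p rho, sym_posdef (bilin B) -> sym_posdef (bilin G) ->
      (forall v, a * `|v| ^+ 2 <= bilin B v v) ->
      (forall v, a * `|v| ^+ 2 <= bilin G v v) ->
      (forall v w, `|bilin B v w| <= b * (`|v| * `|w|)) ->
      (forall v w, `|bilin G v w| <= b * (`|v| * `|w|)) ->
      0 < rho -> rho < rho0 -> `|p| <= rho ->
      - (C' * (rho * rho `^ delta)) <=
      A (Num.sqrt (bilin G xi xi)) * (bilin B xi xi - bilin B xi p)].
Proof.
move=> omega0 C0 d0 hA3 a0 b0.
have sa0 : 0 < Num.sqrt a by rewrite sqrtr_gt0.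
have k0 : 0 < b / Num.sqrt a by rewrite divr_gt0.
(* In the case that matters [q <= (b / Num.sqrt a) * rho], so [rho0] keeps [q] below [omega]. The
   flux is then at least [- phi A q * (b / Num.sqrt a) * rho], and (A3) bounds [phi A q] by
   [C * ((b / Num.sqrt a) * rho) ^ delta]. *)
exists (C * (b / Num.sqrt a) `^ delta * (b / Num.sqrt a)), (omega / (b / Num.sqrt a)).
have Cd0 : 0 < C * (b / Num.sqrt a) `^ delta by rewrite mulr_gt0// powR_gt0.
split; [exact: mulr_gt0|exact: divr_gt0|].
move=> B G xi p rho hB hG aB aG bB bG rho0 rhol prho.
set q := Num.sqrt (bilin G xi xi).
have lhs0 : - (C * (b / Num.sqrt a) `^ delta * (b / Num.sqrt a) * (rho * rho `^ delta)) <= 0.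
  by rewrite oppr_le0; apply/ltW/mulr_gt0; [exact: mulr_gt0|rewrite mulr_gt0 ?powR_gt0].
have [xi0|xi0] := eqVneq xi 0; first by rewrite xi0 !bilin0l subrr mulr0.
have q2 : 0 < bilin G xi xi by exact: hG.2.
have q0 : 0 < q by rewrite sqrtr_gt0.
have A0 : 0 < A q by exact: A_gt0.
have Bxp : 0 <= bilin B (xi - p) (xi - p) by exact: posdef_ge0.
rewrite bilinDl !bilinDr bilinNl !bilinNr bilinNl opprK (hB.1 p xi) in Bxp.
(* Since [B (xi - p, xi - p) >= 0], the first alternative gives [B (xi, p) <= B (xi, xi)]. In the
   second, coercivity gives [a * |xi| ^ 2 <= b * rho ^ 2]. *)
have [Bp|Bp] := leP (bilin B p p) (bilin B xi xi).
  by apply: le_trans lhs0 _; rewrite mulr_ge0 ?(ltW A0)//; lra.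
have nxi : Num.sqrt a * `|xi| <= q.
  have -> : Num.sqrt a * `|xi| = Num.sqrt (a * `|xi| ^+ 2).
    by rewrite sqrtrM ?(ltW a0)// sqrtr_sqr normr_id.
  exact: ler_wsqrtr.
have nxi' : Num.sqrt a * `|xi| <= Num.sqrt b * rho.
  have -> : Num.sqrt a * `|xi| = Num.sqrt (a * `|xi| ^+ 2).
    by rewrite sqrtrM ?(ltW a0)// sqrtr_sqr normr_id.
  have -> : Num.sqrt b * rho = Num.sqrt (b * rho ^+ 2).
    by rewrite sqrtrM ?(ltW b0)// sqrtr_sqr gtr0_norm.
  apply: ler_wsqrtr; apply: le_trans (aB xi) _; apply: le_trans (ltW Bp) _.
  apply: le_trans (ler_norm _) _; apply: le_trans (bB p p) _.
  by rewrite ler_wpM2l ?(ltW b0)// expr2 ler_pM.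
have qle : q <= b / Num.sqrt a * rho.
  apply: (@le_trans _ _ (Num.sqrt b * `|xi|)).
    have -> : Num.sqrt b * `|xi| = Num.sqrt (b * `|xi| ^+ 2).
      by rewrite sqrtrM ?(ltW b0)// sqrtr_sqr normr_id.
    by apply: ler_wsqrtr; apply: le_trans (ler_norm _) _; rewrite expr2; exact: bG.
  have bb : Num.sqrt b * Num.sqrt b = b by rewrite -expr2 sqr_sqrtr ?(ltW b0).
  rewrite mulrAC ler_pdivlMr// -[X in _ <= X * _]bb -mulrA -[leRHS]mulrA.
  by rewrite ler_wpM2l ?sqrtr_ge0// mulrC.
have qom : q < omega.
  by apply: le_lt_trans qle _; rewrite mulrC -ltr_pdivlMr.
have hphi : phi A q <= C * (b / Num.sqrt a) `^ delta * rho `^ delta.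
  apply: le_trans (hA3 q _) _; first by rewrite q0.
  rewrite -mulrA -powRM ?(ltW k0) ?(ltW rho0)// ler_wpM2l ?(ltW C0)//.
  by apply: ge0_ler_powR => //; rewrite ?nnegrE ?ltW// mulr_gt0.
have B0 : 0 <= bilin B xi xi by exact: posdef_ge0.
apply: (@le_trans _ _ (- (A q * (b * (`|xi| * rho))))); last first.
  rewrite -mulrN ler_wpM2l ?(ltW A0)//.
  apply: (@le_trans _ _ (- bilin B xi p)); last by rewrite lerBrDr addNr.
  rewrite lerN2; apply: le_trans (ler_norm _) _; apply: le_trans (bB _ _) _.
  by rewrite !ler_wpM2l// ltW.
rewrite lerN2; apply: (@le_trans _ _ (phi A q * (b / Num.sqrt a) * rho)); last first.
  have -> : C * (b / Num.sqrt a) `^ delta * (b / Num.sqrt a) * (rho * rho `^ delta) =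
    C * (b / Num.sqrt a) `^ delta * rho `^ delta * (b / Num.sqrt a) * rho by ring.
  by rewrite ler_wpM2r ?(ltW rho0)// ler_wpM2r ?(ltW k0).
rewrite /phi; have -> : q * A q * (b / Num.sqrt a) * rho = A q * (b * rho * (q / Num.sqrt a)) by ring.
rewrite ler_wpM2l ?(ltW A0)// mulrA -mulrA (mulrC `|xi|) mulrA ler_wpM2l//.
  by rewrite mulr_ge0// ltW.
by rewrite ler_pdivlMr// mulrC.
Qed.

End FluxLower.

(** * Admissible test functions *)

Section Pull.
Context {R : realType} {M : ptopologicalType} {m : nat} (S : manifold R M m).
Implicit Types (c : chart R M m) (Omega W : set M) (f : M -> R) (F : 'rV[R]_m -> R).

Lemma Ck1V n (U : set 'rV[R]_n) (f : 'rV[R]_n -> R) : open U ->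
  (forall y, U y -> f y != 0) -> Ck 1 U f -> Ck 1 U (fun y => (f y)^-1).
Proof.
move=> oU f0 [df cf]; split=> [y Uy|i]; first by apply: differentiableV; [exact: df|exact: f0].
apply: (@Ck_eq _ _ 0 _ (fun y => - ((f y)^-1 * (f y)^-1) * pderiv i f y)) => //.
  move=> y; rewrite inE => Uy; rewrite [RHS]/pderiv deriveV; last 2 first.
  - exact: f0.
  - exact/diff_derivable/df.
  by rewrite -[_ *: _]/(_ * _) expr2 invfM.
move=> y Uy; apply: continuousM; last exact: cf.
have cV : {for y, continuous (fun y => (f y)^-1)}.
  by apply: continuousV; [exact: f0|exact/differentiable_continuous/df].
by apply: continuousN; apply: continuousM.
Qed.

Definition pull c F (z : M) : R := if `[< cdom c z >] then F (c z) else 0.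

Lemma pullE c F z : cdom c z -> pull c F z = F (c z).
Proof. by move=> cz; rewrite /pull asboolT. Qed.

Lemma pull_notin c F z : ~ cdom c z -> pull c F z = 0.
Proof. by move=> cz; rewrite /pull asboolF. Qed.

Definition mbox c (a : 'rV[R]_m) (r : R) : set M := cinv c @` cbox a r.

Lemma mbox_compact c a r : cbox a r `<=` c @` cdom c -> compact (mbox c a r).
Proof.
move=> ar; apply: continuous_compact; last exact: cbox_compact.
by apply: continuous_at_within => y /ar; exact: cinv_cont.
Qed.

Lemma mboxP c a r z : cdom c z -> cbox a r (c z) -> mbox c a r z.
Proof. by move=> cz az; exists (c z) => //; rewrite cmapK. Qed.

Lemma mbox_sub c a r Omega : cbox a r `<=` c @` (cdom c `&` Omega) ->
  mbox c a r `<=` cdom c `&` Omega.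
Proof. by move=> ar z [y /ar [x [cx Ox] <-] <-]; rewrite cmapK. Qed.

Lemma mbox_cbox c a r z : cbox a r `<=` c @` cdom c -> mbox c a r z -> cbox a r (c z).
Proof. by move=> ar [y yr <-]; rewrite cinvK//; exact: ar. Qed.

Lemma pull_eq0 c a r F z : (forall y, ~ cbox a r y -> F y = 0) ->
  ~ mbox c a r z -> pull c F z = 0.
Proof.
move=> F0 nz; have [cz|cz] := pselect (cdom c z); last by rewrite pull_notin.
by rewrite pullE//; apply: F0 => h; apply: nz; exact: mboxP.
Qed.

Lemma Ck_on_pull0 k c a r F : atlas S c -> cbox a r `<=` c @` cdom c ->
  Ck k setT F -> (forall y, ~ cbox a r y -> F y = 0) -> Ck_on S k setT (pull c F).
Proof.
move=> ac ar hF F0.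
apply: (@Ck_on_extend0 _ _ _ S k (cdom c) (mbox c a r)).
- exact: cdom_open.
- exact: mbox_compact.
- have : cbox a r `<=` c @` (cdom c `&` setT) by rewrite setIT.
  by move=> /mbox_sub h z /h[].
- have := Ck_on_pull ac openT hF; rewrite preimage_setT setIT.
  apply: Ck_on_eq; first exact: cdom_open.
  by move=> z; rewrite inE => cz; rewrite pullE.
- by move=> z; exact: pull_eq0.
Qed.

End Pull.

(** * Smooth approximation inside one chart *)

Section Pieces.
Context {R : realType} {M : ptopologicalType} {m : nat} {S : manifold R M m}.
Variable g : riemannian_metric S.
Implicit Types (c : chart R M m) (Omega W : set M) (f u psi : M -> R).
Variables (A : R -> R) (T : M -> 'M[R]_m) (X : M -> 'rV[R]_m).
Hypotheses (hT1 : T1 S T) (hX : vector_field S X) (hA1 : A1 A) (hA2 : A2 A).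

Lemma bump_cbox0 (a : 'rV[R]_m) r y : 0 < r -> ~ cbox a r y -> bump a r y = 0.
Proof. by move=> r0 ny; apply: bump_eq0 => // /box_cbox. Qed.

(** The two cutoff factors have different tasks. One, multiplied by [rho] and read in the chart,
    gives a C^1 function [F] on the whole of R^m that vanishes off the cube, as [C1_approx]
    requires. The other is left unapproximated and cuts off the polynomial outside the cube, where
    it is uncontrolled. *)
Lemma piece_approx Omega u c a r rho (e : R) : atlas S c -> open Omega ->
  Ck_on S 1 Omega u -> 0 < r -> cbox a r `<=` c @` (cdom c `&` Omega) ->
  Ck_on S 1 setT rho -> (forall x, 0 <= rho x) -> 0 < e ->
  exists phi, [/\ test_function S Omega phi, forall x, 0 <= phi x,
    forall x, ~ mbox c a r x -> phi x = 0,
    forall x, Omega x -> `|weak_form g A T X u phi x -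
      weak_form g A T X u (pull c (bump a r) * pull c (bump a r) * rho) x| <= e &
    forall x, `|phi x - (pull c (bump a r) * pull c (bump a r) * rho) x| <= e].
Proof.
move=> ac oO hu r0 arO hrho rho0 e0.
have ar : cbox a r `<=` c @` cdom c by move=> y /arO[x [cx _] <-]; exists x.
have cK := mbox_compact ar; have KO := mbox_sub arO.
have Kc : mbox c a r `<=` cdom c by move=> z /KO[].
have KO' : mbox c a r `<=` Omega by move=> z /KO[].
have b0 y : ~ cbox a r y -> bump a r y = 0 by exact: bump_cbox0.
have hchi k : Ck_on S k setT (pull c (bump a r)).
  exact: (Ck_on_pull0 ac ar (Ck_bump a r k openT) b0).
set chi := pull c (bump a r) in hchi *.
have hf : Ck_on S 1 setT (chi * rho) by exact: (Ck_onM openT (hchi 1%N) hrho).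
pose F y := if `[< cbox a r y >] then (chi * rho) (cinv c y) else 0.
have F0 y : ~ cbox a r y -> F y = 0 by move=> ny; rewrite /F asboolF.
have FE y : (c @` cdom c) y -> F y = (chi * rho) (cinv c y).
  move=> cy; rewrite /F; case: asboolP => // ny.
  rewrite !fctE /chi pullE; last exact: cdom_cinv.
  by rewrite cinvK// b0// mul0r.
have hF : Ck 1 setT F.
  apply: Ck_local => y _; have [yr|yr] := pselect (cbox a r y); last first.
    exists (~` cbox a r); split=> //; first exact/closed_openC/cbox_closed.
    apply: (@Ck_eq _ _ _ _ (cst 0)); last exact: Ck_cst.
      exact/closed_openC/cbox_closed.
    by move=> z; rewrite inE => /F0 ->.
  exists (c @` cdom c); split; [exact: cimg_open|exact: ar|].
  apply: (@Ck_eq _ _ _ _ ((chi * rho) \o cinv c)); first exact: cimg_open.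
    by move=> z; rewrite inE => /FE ->.
  by have := hf c ac; rewrite setIT.
have chi_ge0 x : 0 <= chi x by rewrite /chi /pull; case: ifP => // _; exact: bump_ge0.
have F_ge0 y : 0 <= F y by rewrite /F; case: ifP => // _; rewrite mulr_ge0.
have [B B0 hB] := weak_form_bound g hT1 hX hA1 hA2 ac oO hu cK Kc KO'.
have hb1 : Ck 1 setT (bump a r : 'rV[R]_m -> R) by exact: (Ck_bump a r 1 openT).
have [b1 b10 hb1'] := compact_bound (@cbox_compact R m a r)
  (fun y _ => Ck_continuous hb1 (Logic.I : setT y)).
have [b2 b20 hb2] : exists2 b2, 0 <= b2 & forall y, cbox a r y ->
    `|\sum_i `|pderiv i (bump a r) y| | <= b2.
  apply: compact_bound; first exact: cbox_compact.
  move=> y _; apply: continuous_big_sum => i.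
  apply: (continuous_comp (f := pderiv i (bump a r))); last exact: norm_continuous.
  by apply: hb1.2.
(* By the product rule the error [bump * (h - F)] has derivatives at most [(b1 + b2) * d] and values
   at most [b1 * d]; [B] converts their sum into an error of the weak form. *)
pose d := e / ((B + 1) * (b1 + b2 + b1 + 1)).
have D0 : 0 < (B + 1) * (b1 + b2 + b1 + 1) by apply: mulr_gt0; lra.
have d0 : 0 < d by rewrite divr_gt0.
have [h [hs h0 hv hd]] := C1_approx r0 hF F0 F_ge0 d0.
pose H := bump a r * h.
have H0 y : ~ cbox a r y -> H y = 0 by move=> /b0 h1; rewrite /H !fctE h1 mul0r.
have hH k : Ck k setT H.
  exact: (CkM openT (Ck_bump a r k openT) (hs k _ openT)).
have hphi k : Ck_on S k setT (pull c H) by exact: (Ck_on_pull0 ac ar (hH k) H0).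
have out x : ~ mbox c a r x -> (chi * chi * rho) x = 0.
  by move=> nx; rewrite !fctE /chi (pull_eq0 b0 nx) mul0r mul0r.
have pE x : cdom c x -> (chi * chi * rho) x = bump a r (c x) * F (c x).
  move=> cx; rewrite FE; last by exists x.
  by rewrite !fctE cmapK// /chi pullE// mulrA.
have small y : cbox a r y -> `|bump a r y * (h y - F y)| <= b1 * d.
  by move=> yr; rewrite normrM; apply: ler_pM => //; [exact: hb1'|exact: hv].
have ed : (B + 1) * (b1 + b2 + b1 + 1) * d = e by rewrite mulrC /d mulfVK// lt0r_neq0.
have d1 : b1 * d <= e.
  rewrite -ed ler_wpM2r ?(ltW d0)//.
  by have : 0 <= B * (b1 + b2 + b1 + 1) by [apply: mulr_ge0 => //; lra]; lra.
exists (pull c H); split.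
- split; first exact: hphi.
  by exists (mbox c a r); split=> // x nx; exact: pull_eq0 H0 nx.
- move=> x; have [xr|xr] := pselect (mbox c a r x); last by rewrite (pull_eq0 H0 xr).
  rewrite pullE; last exact: Kc.
  by rewrite mulr_ge0 ?bump_ge0//; apply: h0; exact: mbox_cbox xr.
- by move=> x; exact: pull_eq0.
- move=> x Ox.
  have hphi1 : Ck_on S 1 Omega (pull c H) by exact: (Ck_onS (@subsetT _ _) (hphi 1%N)).
  have hpsi1 : Ck_on S 1 Omega (chi * chi * rho).
    exact: (Ck_onS (@subsetT _ _) (Ck_onM openT (Ck_onM openT (hchi 1%N) (hchi 1%N)) hrho)).
  have hN := Ck_onN oO hpsi1.
  rewrite -(weak_formN _ _ _ _ _ hpsi1 Ox) -(weak_formD _ _ _ _ _ hphi1 hN Ox).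
  have [xr|xr] := pselect (mbox c a r x); last first.
    rewrite weak_form0 ?normr0 ?(ltW e0)//.
    have clK := compact_closed (mfd_hausdorff S) cK.
    apply: filterS (open_nbhs_nbhs (conj (closed_openC clK) xr)) => z zr.
    by rewrite [LHS]/GRing.add /= [X in _ + X]/GRing.opp /= (pull_eq0 H0 zr) out// subr0.
  apply: le_trans (hB _ _ (Ck_onD oO hphi1 hN) xr) _.
  have cx := Kc _ xr; have yr := mbox_cbox ar xr.
  set D := pull c H + - (chi * chi * rho).
  have DE z : cdom c z -> D z = bump a r (c z) * (h (c z) - F (c z)).
    move=> cz; rewrite [LHS]/GRing.add /= [X in _ + X]/GRing.opp /= pE// pullE//.
    by rewrite mulrBr.
  have dD : `|dchart c D x| <= (b1 + b2) * d.
    apply: norm_le_coord => [|i]; first by rewrite mulr_ge0 ?(ltW d0)// addr_ge0.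
    have -> : dchart c D x 0 i = pderiv i (bump a r * (h - F)) (c x).
      rewrite mxE; apply: near_eq_pderiv.
      have oc := @cimg_open _ _ _ c.
      have cxi : (c @` cdom c) (c x) by exists x.
      apply: filterS (open_nbhs_nbhs (conj oc cxi)) => _ [z cz <-].
      by rewrite /= cmapK// DE.
    have dfF y : differentiable F y by apply: hF.1.
    have dfh y : differentiable h y by apply: (hs 1%N _ openT).1.
    have dfb y : differentiable (bump a r) y by apply: hb1.1.
    have dfhF : differentiable (h - F) (c x) by apply: differentiableB.
    rewrite (pderivM i (dfb _) dfhF) [leRHS]mulrDl.
    have -> : pderiv i (h - F) (c x) = pderiv i h (c x) - pderiv i F (c x).
      by rewrite /pderiv deriveB//; exact: diff_derivable.
    apply: le_trans (ler_normD _ _) _; apply: lerD.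
      by rewrite normrM; apply: ler_pM => //; [exact: hb1'|exact: hd].
    rewrite mulrC normrM; apply: ler_pM => //; last exact: hv.
    apply: le_trans (hb2 _ yr); apply: le_trans (ler_norm _).
    by rewrite (bigD1 i)//= lerDl sumr_ge0.
  have vD : `|D x| <= b1 * d by rewrite DE//; exact: small.
  apply: (@le_trans _ _ ((B + 1) * ((b1 + b2 + b1 + 1) * d))); last by rewrite mulrA ed.
  apply: ler_pM => //; first by rewrite lerDl.
  by lra.
- move=> x; have [xr|xr] := pselect (mbox c a r x); last first.
    by rewrite (pull_eq0 H0 xr) out// subrr normr0 ltW.
  have cx := Kc _ xr; rewrite pE// pullE// -mulrBr.
  by apply: le_trans d1; apply: small; exact: mbox_cbox xr.
Qed.

End Pieces.

(** * Gluing the local approximations *)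

Section TestApprox.
Context {R : realType} {M : ptopologicalType} {m : nat} {S : manifold R M m}.
Variable g : riemannian_metric S.
Implicit Types (c : chart R M m) (Omega W : set M) (f u psi : M -> R).
Variables (A : R -> R) (T : M -> 'M[R]_m) (X : M -> 'rV[R]_m).
Hypotheses (hT1 : T1 S T) (hX : vector_field S X) (hA1 : A1 A) (hA2 : A2 A).

Lemma test_functionD Omega f h : test_function S Omega f -> test_function S Omega h ->
  test_function S Omega (f + h).
Proof.
move=> [f1 [C [cC CO C0]]] [h1 [D [cD DO D0]]]; split.
  by move=> k; apply: (Ck_onD openT).
exists (C `|` D); split; first exact: compactU.
  by move=> x [/CO|/DO].
by move=> x /not_orP[nC nD]; rewrite fctE C0// D0// addr0.
Qed.

Lemma test_function0 Omega : test_function S Omega (cst 0).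
Proof.
split; first by move=> k; exact: Ck_on_cst.
by exists set0; split=> //; exact: compact0.
Qed.

Lemma Ck_on1V W f : open W -> (forall x, W x -> f x != 0) -> Ck_on S 1 W f ->
  Ck_on S 1 W (fun x => (f x)^-1).
Proof.
move=> oW f0 hf c ac; apply: (@Ck1V _ _ _ (f \o cinv c)).
- exact: cimg_openI.
- by move=> _ [x [cx Wx] <-]; rewrite /= cmapK//; exact: f0.
- exact: hf.
Qed.

(** A partition of unity made of squares of cutoffs, so that each piece has the form treated in one
    chart. [C'] is chosen before [e]: integrals over it provide constants that do not depend on the
    tolerance. *)
Lemma test_approx Omega u psi C : open Omega -> Ck_on S 1 Omega u -> compact C ->
  C `<=` Omega -> Ck_on S 1 setT psi -> (forall x, 0 <= psi x) ->
  (forall x, ~ C x -> psi x = 0) ->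
  exists C', [/\ compact C', C' `<=` Omega, C `<=` C' & forall e : R, 0 < e ->
    exists phi, [/\ test_function S Omega phi, forall x, 0 <= phi x,
      forall x, ~ C' x -> phi x = 0,
      forall x, Omega x ->
        `|weak_form g A T X u phi x - weak_form g A T X u psi x| <= e &
      forall x, `|phi x - psi x| <= e]].
Proof.
move=> oO hu cC CO hpsi psi0 psiC.
pose ch := chart_at S.
have hr x : exists r : R, 0 < r /\ (Omega x -> cbox (ch x x) r `<=` ch x @` (cdom (ch x) `&` Omega)).
  have [Ox|nO] := pselect (Omega x); last by exists 1; split.
  have := @cimg_openI _ _ _ (ch x) _ oO; rewrite openE => /(_ _ (cimg_mem (chart_at_dom S x) Ox)).
  by move=> /nbhs_cbox[r r0 hr]; exists r.
have [r hr'] := choice hr.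
have r0 x : 0 < r x by case: (hr' x).
have rO x : Omega x -> cbox (ch x x) (r x) `<=` ch x @` (cdom (ch x) `&` Omega) by case: (hr' x).
have rM x : Omega x -> cbox (ch x x) (r x) `<=` ch x @` cdom (ch x).
  by move=> /rO h y /h[z [cz _] <-]; exists z.
pose chi x := pull (ch x) (bump (ch x x) (r x)).
have chi_ge0 x z : 0 <= chi x z by rewrite /chi /pull; case: ifP => // _; exact: bump_ge0.
have hchi x : Omega x -> Ck_on S 1 setT (chi x).
  move=> Ox; apply: (Ck_on_pull0 (chart_at_atlas S x) (rM x Ox) (Ck_bump _ _ 1 openT)).
  by move=> y; exact: bump_cbox0.
have [l [lC lcov]] : exists l : seq M, (forall x, x \in l -> C x) /\
    (forall z, C z -> exists2 x, x \in l & 0 < chi x z).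
  pose V x := cdom (ch x) `&` ch x @^-1` box (ch x x) (r x).
  have := cC; rewrite compact_cover => /(_ M C V)[|z Cz|D' DC cov].
  - by move=> x _; apply: cpre_open; exact: box_open.
  - by exists z => //; split; [exact: chart_at_dom|exact: box_center].
  exists (finmap.enum_fset D'); split.
    by move=> x xD; have := DC x xD; rewrite inE.
  move=> z /cov[x /= xD [cz bz]]; exists x => //.
  by rewrite /chi pullE//; exact: bump_gt0.
pose sigma z := \sum_(x <- l) chi x z * chi x z.
have hsum (l' : seq M) : (forall x, x \in l' -> C x) ->
    Ck_on S 1 setT (fun z => \sum_(x <- l') chi x z * chi x z).
  elim: l' => [|x l' IH] hl.
    rewrite (_ : (fun z => _) = cst 0); first exact: Ck_on_cst.
    by apply/funext => z; rewrite big_nil.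
  rewrite (_ : (fun z => _) = (chi x * chi x) + (fun z => \sum_(x <- l') chi x z * chi x z)).
    have Cx : Omega x by apply/CO/hl; rewrite mem_head.
    apply: (Ck_onD openT); first exact: (Ck_onM openT (hchi x Cx) (hchi x Cx)).
    by apply: IH => y yl; apply: hl; rewrite in_cons yl orbT.
  by apply/funext => z; rewrite big_cons.
have hsig := hsum l lC.
have sig0 z : C z -> 0 < sigma z.
  move=> /lcov[x xl cx]; rewrite /sigma (big_rem x)//=.
  by rewrite ltr_wpDr ?mulr_gt0// sumr_ge0// => y _; rewrite mulr_ge0.
pose U := [set z | 0 < sigma z].
have oU : open U.
  have -> : U = sigma @^-1` [set t | 0 < t] by [].
  apply: open_comp; last exact: open_gt.
  by move=> z _; exact: (Ck_on_continuous openT hsig).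
(* [sigma] is positive on an open set around [C]; elsewhere its inverse is harmless because [psi] is
   0. *)
pose rho := psi * (fun z => (sigma z)^-1).
have hrho : Ck_on S 1 setT rho.
  apply: (@Ck_on_extend0 _ _ _ S 1 U C) => //.
    apply: Ck_onM => //; first exact: (Ck_onS (@subsetT _ _) hpsi).
    apply: Ck_on1V => //; last exact: (Ck_onS (@subsetT _ _) hsig).
    by move=> z Uz; exact: lt0r_neq0.
  by move=> z nz; rewrite /rho fctE psiC// mul0r.
have sigma_ge0 z : 0 <= sigma z by apply: sumr_ge0 => y _; rewrite mulr_ge0.
have rho0 z : 0 <= rho z by rewrite /rho fctE mulr_ge0// invr_ge0.
have psiE z : psi z = \sum_(x <- l) (chi x * chi x * rho) z.
  have -> : \sum_(x <- l) (chi x * chi x * rho) z = sigma z * rho z.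
    by rewrite /sigma mulr_suml; apply: eq_bigr => x _; rewrite !fctE.
  have [Cz|nz] := pselect (C z); last by rewrite /rho fctE psiC// mul0r mulr0.
  by rewrite /rho fctE mulrCA mulfV ?mulr1// lt0r_neq0// sig0.
have big (l' : seq M) : (forall x, x \in l' -> C x) ->
    exists C', [/\ compact C', C' `<=` Omega, C `<=` C' &
    forall x, x \in l' -> mbox (ch x) (ch x x) (r x) `<=` C'].
  elim: l' => [|x l' IH] hl; first by exists C; split.
  have [|C1 [cC1 C1O CC1 hC1]] := IH.
    by move=> y yl; apply: hl; rewrite in_cons yl orbT.
  have Ox : Omega x by apply/CO/hl; rewrite mem_head.
  exists (C1 `|` mbox (ch x) (ch x x) (r x)); split.
  - by apply: compactU => //; apply: mbox_compact; exact: rM.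
  - by move=> z [/C1O//|/(mbox_sub (rO x Ox))[]].
  - by move=> z /CC1 ?; left.
  - move=> y; rewrite in_cons => /orP[/eqP ->|/hC1 h]; first by move=> z ?; right.
    by move=> z /h; left.
have [C' [cC' C'O CC' hC']] := big l lC.
exists C'; split=> // e e0.
pose Psi (l' : seq M) := fun z => \sum_(x <- l') (chi x * chi x * rho) z.
(* The tolerance is quantified inside the induction because each member of the list takes half of
   what is left. *)
suff main (l' : seq M) : (forall x, x \in l' -> x \in l) -> forall e : R, 0 < e ->
   Ck_on S 1 setT (Psi l') /\
   exists phi, [/\ test_function S Omega phi, forall x, 0 <= phi x,
      forall x, ~ C' x -> phi x = 0,
      forall x, Omega x ->
        `|weak_form g A T X u phi x - weak_form g A T X u (Psi l') x| <= e &
      forall x, `|phi x - Psi l' x| <= e].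
  have [_] := main l (fun x h => h) e e0.
  have -> : Psi l = psi by apply/funext => z; rewrite psiE.
  by [].
elim: l' => [|x l' IH] hl {e0}e e0.
  have -> : Psi [::] = cst 0 by apply/funext => z; rewrite /Psi big_nil.
  split; first exact: Ck_on_cst.
  exists (cst 0); split=> //; first exact: test_function0.
    by move=> x _; rewrite subrr normr0 ltW.
  by move=> x; rewrite subrr normr0 ltW.
have e20 : 0 < e / 2 by rewrite divr_gt0.
have xl : x \in l by apply: hl; rewrite mem_head.
have Ox : Omega x by apply/CO/lC.
have [|hP [p1 [t1 p10 p1C w1 d1]]] := IH _ (e / 2) e20.
  by move=> y yl; apply: hl; rewrite in_cons yl orbT.
have [p2 [t2 p20 p2C w2 d2]] := piece_approx g hT1 hX hA1 hA2 (chart_at_atlas S x) oO hu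
  (r0 x) (rO x Ox) hrho rho0 e20.
have PE : Psi (x :: l') = chi x * chi x * rho + Psi l'.
  by apply/funext => z; rewrite /Psi big_cons.
have hx : Ck_on S 1 setT (chi x * chi x * rho).
  exact: (Ck_onM openT (Ck_onM openT (hchi x Ox) (hchi x Ox)) hrho).
rewrite PE; split; first exact: (Ck_onD openT).
have dist4 (a b c d : R) : `|a - c| <= e / 2 -> `|b - d| <= e / 2 -> `|a + b - (c + d)| <= e.
  move=> h1 h2; rewrite opprD addrACA [leRHS]splitr.
  by apply: le_trans (ler_normD _ _) _; exact: lerD.
exists (p2 + p1); split.
- exact: test_functionD.
- by move=> z; rewrite fctE addr_ge0.
- move=> z nz; rewrite fctE p1C// p2C ?addr0// => h; apply: nz; exact: hC' h.
- move=> z Oz; rewrite (weak_formD _ _ _ _ _ (t2.1 1%N) (t1.1 1%N) Logic.I).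
  rewrite (weak_formD _ _ _ _ _ hx hP Logic.I); apply: dist4; [exact: w2|exact: w1].
- by move=> z; rewrite !fctE; apply: dist4; [exact: d2|exact: d1].
Qed.

End TestApprox.

(** * Integration *)

Section LebInt.
Context {R : realType}.

(** The integral of a nonnegative function is a supremum over the simple functions below it, so
    monotonicity holds for arbitrary functions, in particular for the inner integrals of
    [leb_int]. *)
Lemma ge0_integral_le d (Y : measurableType d) (mu : {measure set Y -> \bar R})
  (D : set Y) (f h : Y -> \bar R) :
  (forall x, D x -> 0 <= f x)%E -> (forall x, D x -> f x <= h x)%E ->
  (\int[mu]_(x in D) f x <= \int[mu]_(x in D) h x)%E.
Proof.
move=> f0 fh; rewrite !ge0_integralE//; last first.
  by move=> x Dx; apply: le_trans (f0 x Dx) (fh x Dx).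
apply: ereal_sup_le => _ [k hk <-]; exists k => // x; apply: le_trans (hk x) _.
by rewrite /patch; case: ifPn => // /[!inE]; exact: fh.
Qed.

Lemma integral_sub_support d (Y : measurableType d) (mu : {measure set Y -> \bar R})
  (C D : set Y) (f : Y -> \bar R) : C `<=` D -> (forall x, ~ C x -> f x = 0%E) ->
  (\int[mu]_(x in D) f x = \int[mu]_(x in C) f x)%E.
Proof.
move=> CD f0; rewrite integral_mkcond [RHS]integral_mkcond; congr (integral _ _ _).
apply/funext => x; rewrite /patch; case: ifPn => [/[!inE] xD|/negP /[!inE] xD].
  by case: ifPn => // /negP /[!inE] /f0.
by case: ifPn => // /[!inE] /CD.
Qed.

Lemma leb_int_ge0 n (f : 'rV[R]_n -> \bar R) : (forall y, 0 <= f y)%E -> (0 <= leb_int f)%E.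
Proof.
elim: n f => [|n IH] f f0 /=; first exact: f0.
by apply: integral_ge0 => t _; apply: IH.
Qed.

Lemma leb_int_le n (f h : 'rV[R]_n -> \bar R) : (forall y, 0 <= f y)%E ->
  (forall y, f y <= h y)%E -> (leb_int f <= leb_int h)%E.
Proof.
elim: n f h => [|n IH] f h f0 fh /=; first exact: fh.
apply: ge0_integral_le => t _; first by apply: leb_int_ge0.
exact: IH.
Qed.

(** Over each [t] in the first side the slice of the cube contains a cube of one dimension less;
    monotonicity of each iterated integral does the rest. *)
Lemma leb_int_box n (a : 'rV[R]_n) (r k : R) : 0 < r -> 0 <= k ->
  ((k * (2 * r) ^+ n)%:E <= leb_int (fun y => (\1_(box a r) y * k)%:E))%E.
Proof.
move=> r0; elim: n a k => [|n IH] a k k0.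
  rewrite /= mulr1 indicE mem_set ?mul1r// /box /=.
  by apply: norm_lt_coord => // -[].
pose a0 := a 0 ord0; pose a' : 'rV[R]_n := @rsubmx R 1 1 n a.
pose I : set R := `]a0 - r, a0 + r[%classic.
have mI : measurable I by exact: measurable_itv.
have key (t : R) : I t -> ((k * (2 * r) ^+ n)%:E <=
    leb_int (fun y : 'rV[R]_n => (\1_(box a r) (row_mx t%:M y) * k)%:E))%E.
  move=> It; apply: le_trans (IH a' k k0) _.
  apply: leb_int_le => y; first by rewrite lee_fin mulr_ge0// indicE.
  rewrite lee_fin ler_wpM2r// !indicE.
  case: (boolP (y \in box a' r)) => // /[!inE] ya; rewrite mem_set//.
  rewrite /box /=; apply: norm_lt_coord => // i.
  rewrite !mxE; case: (@split_ordP 1 n i) => j ->.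
    rewrite (ord1 j) !mxE eqxx mulr1n.
    move: It; rewrite /I /= in_itv /= => /andP[h1 h2].
    rewrite (_ : fun_of_matrix a _ _ = a0); last by congr (fun_of_matrix a _ _); exact: val_inj.
    by rewrite ltr_norml; lra.
  have := norm_coord_le (y - a') j; rewrite !mxE => h.
  exact: le_lt_trans h ya.
rewrite [leb_int _]/=; apply: (@le_trans _ _ (\int[lebesgue_measure]_(t in I) (k * (2 * r) ^+ n)%:E)%E).
  have mI2 : lebesgue_measure I = (2 * r)%:E.
    rewrite /I lebesgue_measure_itv /= lte_fin ifT; last by rewrite ltrBlDr -addrA ltrDl addr_gt0.
    by rewrite -EFinB; congr EFin; ring.
  have -> : (\int[@lebesgue_measure R]_(t in I) (k * (2 * r) ^+ n)%:E =
      (k * (2 * r) ^+ n)%:E * lebesgue_measure I)%E by exact: integral_cst.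
  by rewrite mI2 -EFinM lee_fin exprSr mulrA.
rewrite integral_mkcond; apply: ge0_integral_le => t _; rewrite /patch.
  by case: ifP => // _; rewrite lee_fin mulr_ge0// exprn_ge0// mulr_ge0// ltW.
case: ifPn => [/[!inE] It|_]; first exact: key.
by apply: leb_int_ge0 => y; rewrite lee_fin mulr_ge0// indicE.
Qed.

(** The segment from the identity to [h] consists of positive definite, hence invertible, matrices,
    so the determinant keeps the sign it has at the identity. *)
Lemma posdef_det_gt0 n (h : 'M[R]_n) : sym_posdef (bilin h) -> 0 < \det h.
Proof.
move=> hp; pose P (t : R) : 'M[R]_n := (1 - t) *: 1%:M + t *: h.
have Pp (t : R) : 0 <= t <= 1 -> \det (P t) != 0.
  move=> /andP[t0 t1]; apply/det0P => -[v v0 vP].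
  have b1 : 0 < bilin 1%:M v v.
    rewrite /bilin mulmx1 mxE; under eq_bigr do rewrite mxE -expr2.
    have [i vi] : exists i, v 0 i != 0.
      apply: contrapT => h0; move: v0; apply/negP/negPn/eqP/rowP => i; rewrite mxE.
      by apply: contrapT => /eqP vi; apply: h0; exists i.
    rewrite (bigD1 i)//= ltr_wpDr ?exprn_even_gt0//.
    by apply: sumr_ge0 => j _; exact: sqr_ge0.
  have b2 := hp.2 v v0.
  have : bilin (P t) v v = 0 by rewrite /bilin vP mul0mx mxE.
  have -> : bilin (P t) v v = (1 - t) * bilin 1%:M v v + t * bilin h v v.
    by rewrite /bilin /P mulmxDr mulmxDl mxE -!scalemxAr -!scalemxAl mxE [X in _ + X]mxE.
  have [t00|t00] := eqVneq t 0; first by rewrite t00; lra.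
  have tp : 0 < t by rewrite lt_def t00.
  have : 0 <= (1 - t) * bilin 1%:M v v by rewrite mulr_ge0 ?subr_ge0// ltW.
  have : 0 < t * bilin h v v by rewrite mulr_gt0.
  lra.
rewrite ltNge; apply/negP => dh.
have cid (t : R) : {for t, continuous (@id R)}.
  by apply: differentiable_continuous; exact/derivable1_diffP/derivable_id.
have cP : {within `[0, 1], continuous (fun t => \det (P t))}.
  apply: continuous_at_within => t _; apply: continuous_det => i j.
  rewrite (_ : (fun z => _) = (fun z : R => (1 - z) * (1%:M : 'M[R]_n) i j + z * h i j)); last first.
    by apply/funext => z; rewrite !mxE.
  apply: (@continuousD _ _ _ (fun z : R => (1 - z) * (1%:M : 'M[R]_n) i j) (fun z : R => z * h i j)).
    apply: (@continuousM _ _ (fun z : R => 1 - z) (cst ((1%:M : 'M[R]_n) i j))); last exact: cst_continuous.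
    by apply: (@continuousB _ _ _ (cst (1 : R)) id); [exact: cst_continuous|exact: cid].
  apply: (@continuousM _ _ id (cst (h i j))); last exact: cst_continuous.
  exact: cid.
have P0 : \det (P 0) = 1 by rewrite /P subr0 scale1r scale0r addr0 det1.
have P1 : \det (P 1) = \det h by rewrite /P subrr scale0r scale1r add0r.
have [|t] := @IVT R (fun t => \det (P t)) 0 1 0 ler01 cP.
  rewrite P0 P1; apply/andP; split.
    by rewrite ge_min dh orbT.
  by rewrite le_max ler01.
by rewrite in_itv /= => /Pp/eqP.
Qed.

End LebInt.

(** * The Riemannian volume and the weight 1/q *)

Section Volume.
Context {R : realType} {M : ptopologicalType} {m : nat} {S : manifold R M m}.
Variable g : riemannian_metric S.
Notation MB := (g_sigma_algebraType (@open M)).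
Implicit Types (c : chart R M m) (Omega W C : set M) (f u psi : M -> R).

Lemma measurable_open W : open W -> measurable (W : set MB).
Proof. by move=> oW; exact: sub_sigma_algebra. Qed.

Lemma measurable_compact C : compact C -> measurable (C : set MB).
Proof.
move=> cC; rewrite -(setCK C); apply: measurableC; apply: measurable_open.
exact/closed_openC/(compact_closed (mfd_hausdorff S)).
Qed.

Lemma continuous_open_measurable W f : open W -> (forall x, W x -> {for x, continuous f}) ->
  measurable_fun (W : set MB) (f : MB -> R).
Proof.
move=> oW cf; apply: (measurability _ (RGenOpens.measurableE R)).
move=> _ [_ [a [b ->] <-]]; apply: measurable_open.
apply: open_preimageI => //; exact: interval_open.
Qed.

Variable vol : {measure set MB -> \bar R}.
Hypothesis hvol : is_riemannian_volume g vol.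

(** Near [x] the determinant of the metric stays above half its value at [x], which supplies [k].
    The uniformity in [r] matters: the cubes will shrink with [t]. *)
Lemma vol_box_lower c x : atlas S c -> cdom c x -> exists k r0 : R,
  [/\ 0 < k, 0 < r0, cbox (c x) r0 `<=` c @` cdom c & forall r, 0 < r -> r <= r0 ->
   ((k * (2 * r) ^+ m)%:E <= vol (cdom c `&` c @^-1` box (c x) r))%E].
Proof.
move=> ac cx.
have cxi : (c @` cdom c) (c x) by exists x.
pose D y := \det (gchart g c (cinv c y)).
have cD : {for c x, continuous D}.
  apply: (@continuous_comp _ _ _ (cinv c) (fun z => \det (gchart g c z))).
    exact: cinv_cont.
  by rewrite cmapK//; apply: continuous_det; exact: mx_continuous_gchart.
have Dx : 0 < D (c x).
  by rewrite /D cmapK//; apply: posdef_det_gt0; exact: gchart_posdef.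
have [r0 r00 hr0] : exists2 r : R, 0 < r & cbox (c x) r `<=` (c @` cdom c) `&` [set y | D (c x) / 2 < D y].
  apply: nbhs_cbox; apply: filterI; first by apply: open_nbhs_nbhs; split => //; exact: cimg_open.
  have : D y @[y --> c x] --> D (c x) by exact: cD.
  move=> /cvgrPdist_lt/(_ (D (c x) / 2) (divr_gt0 Dx (ltr0Sn _ 1))).
  by apply: filterS => y /=; move: (D (c x)) (D y) => p s; rewrite ltr_norml; lra.
exists (Num.sqrt (D (c x) / 2)), r0; split=> //.
- by rewrite sqrtr_gt0 divr_gt0.
- by move=> y /hr0[].
move=> r rp rr0.
have rsub y : box (c x) r y -> (c @` cdom c) y /\ D (c x) / 2 < D y.
  by move=> yr; apply: hr0; apply/ltW/(lt_le_trans yr).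
have oB : open (cdom c `&` c @^-1` box (c x) r) by apply: cpre_open; exact: box_open.
rewrite (hvol ac (measurable_open oB)); last by move=> z [].
have -> : c @` (cdom c `&` c @^-1` box (c x) r) = box (c x) r.
  apply/seteqP; split=> [_ [z [cz bz] <-]//|y yr].
  have [[z cz zy] _] := rsub y yr; exists z => //; split=> //=; by rewrite zy.
apply: le_trans (leb_int_box (c x) rp (sqrtr_ge0 _)) _.
apply: leb_int_le => y; first by rewrite lee_fin mulr_ge0 ?sqrtr_ge0// indicE.
rewrite lee_fin !indicE; case: (boolP (y \in box (c x) r)) => [|_]; last by rewrite !mul0r.
rewrite inE => /rsub[_ hy]; rewrite !mul1r; apply: ler_wsqrtr; exact: ltW.
Qed.

Variable q : M -> R.
Hypotheses (hq_cont : continuous q) (hq_ge0 : forall x, 0 <= q x)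
  (hq_loc : inv_locally_integrable vol q).

(** If [B] bounds [q] on [C], then [1/q >= (B + 1)^-1] there, and [1/q] has a finite integral. *)
Lemma vol_compact_fin C : compact C -> (vol C < +oo)%E.
Proof.
move=> cC; have mC := measurable_compact cC.
have [B B0 hB] := compact_bound cC (fun x _ => @hq_cont x).
have B1 : 0 < B + 1 by rewrite ltr_wpDl.
have /integrableP[_ hI] := hq_loc cC.
have : ((B + 1)^-1%:E * vol C <= \int[vol]_(x in C) `|(q x)%:E^-1%E|)%E.
  rewrite -(integral_cst vol mC); apply: ge0_integral_le => x Cx /=.
    by rewrite lee_fin invr_ge0 ltW.
  have qB : q x <= B by apply: le_trans (ler_norm _) (hB x Cx).
  rewrite /inve; case: ifPn => [_|q0]; first by rewrite leey.
  have qp : 0 < q x by rewrite lt_def q0 hq_ge0.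
  rewrite lee_fin ger0_norm ?invr_ge0// lef_pV2 ?posrE//.
  by apply: le_trans qB _; rewrite lerDl.
move=> /le_lt_trans/(_ hI).
case: (vol C) => [v _||//]; first by rewrite ltry.
by rewrite gt0_muley// lte_fin invr_gt0.
Qed.

Lemma integrable_continuous W C f : open W -> C `<=` W -> compact C ->
  (forall x, W x -> {for x, continuous f}) -> vol.-integrable C (EFin \o f).
Proof.
move=> oW CW cC cf; apply: measurable_bounded_integrable.
- exact: measurable_compact.
- exact: vol_compact_fin.
- apply: (@measurable_funS _ _ _ _ (W : set MB)) => //; first exact: measurable_open.
  exact: continuous_open_measurable.
- have [B B0 hB] := compact_bound cC (fun x Cx => cf x (CW x Cx)).
  exists B; split; first exact: num_real.
  by move=> B' BB' x Cx; apply: le_trans (hB x Cx) (ltW BB').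
Qed.

(** An integrable function is finite almost everywhere, so the zeros of [q] in [C] are negligible
    and the real inverse, 0 at those zeros, may replace the extended one. *)
Lemma ae_inv_q C : compact C -> {ae vol, forall x, C x -> (q x)%:E^-1%E = ((q x)^-1)%:E}.
Proof.
move=> cC; have := integrable_ae (measurable_compact cC) (hq_loc cC).
apply: filterS => x h Cx; have := h Cx; rewrite /inve.
by case: ifPn.
Qed.

Lemma integrable_rq C : compact C -> vol.-integrable C (EFin \o (fun x => (q x)^-1)).
Proof.
move=> cC; have mC := measurable_compact cC; have iq := hq_loc cC.
apply: (le_integrable mC _ _ iq).
  apply/measurable_EFinP.
  have -> : (fun x => (q x)^-1) = fine \o (fun x => (q x)%:E^-1%E).
    by apply/funext => x; rewrite /inve /=; case: ifPn => //= /eqP ->; rewrite invr0.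
  apply: (@measurable_comp _ _ _ _ _ _ setT) => //.
  exact: (measurable_int vol iq).
move=> x _ /=; rewrite /inve; case: ifPn => [_|q0]; last by [].
by rewrite leey.
Qed.

Lemma integrable_rqM W C f : open W -> C `<=` W -> compact C ->
  (forall x, W x -> {for x, continuous f}) ->
  vol.-integrable C (EFin \o (fun x => (q x)^-1 * f x)).
Proof.
move=> oW CW cC cf; have mC := measurable_compact cC.
have [B B0 hB] := compact_bound cC (fun x Cx => cf x (CW x Cx)).
have iB := integrableZl mC B (integrable_rq cC).
apply: (le_integrable mC _ _ iB).
  apply/measurable_EFinP; apply: measurable_funM.
    by apply/measurable_EFinP; exact: (measurable_int vol (integrable_rq cC)).
  apply: (@measurable_funS _ _ _ _ (W : set MB)) => //; first exact: measurable_open.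
  exact: continuous_open_measurable.
move=> x Cx /=; rewrite lee_fin !normrM mulrC ler_wpM2r//.
by apply: le_trans (hB x Cx) (ler_norm _).
Qed.

Lemma integral_inv_q W C (a b : M -> R) (eps : R) : open W -> C `<=` W -> compact C ->
  (forall x, W x -> {for x, continuous a}) -> (forall x, W x -> {for x, continuous b}) ->
  (\int[vol]_(x in C) ((a x)%:E + eps%:E / (q x)%:E * (b x)%:E) =
   \int[vol]_(x in C) (a x + eps * ((q x)^-1 * b x))%:E)%E.
Proof.
move=> oW CW cC ca cb; have mC := measurable_compact cC.
have mcont (h : M -> R) : (forall x, W x -> {for x, continuous h}) -> measurable_fun (C : set MB) h.
  move=> ch; apply: (@measurable_funS _ _ _ _ (W : set MB)) => //; first exact: measurable_open.
  exact: continuous_open_measurable.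
apply: ae_eq_integral => //.
- apply: emeasurable_funD; first by apply/measurable_EFinP; exact: mcont.
  apply: emeasurable_funM; last by apply/measurable_EFinP; exact: mcont.
  apply: emeasurable_funM; first exact: measurable_cst.
  exact: (measurable_int vol (hq_loc cC)).
- apply/measurable_EFinP; apply: measurable_funD; first exact: mcont.
  apply: measurable_funM; first exact: measurable_cst.
  by apply/measurable_EFinP; exact: (measurable_int vol (integrable_rqM oW CW cC cb)).
- have h0 := ae_inv_q cC.
  have FF := ae_filter_ringOfSetsType vol.
  apply: filterS h0 => x h Cx.
  by rewrite (h Cx) -!EFinM -EFinD mulrA.
Qed.

End Volume.

(** * Weak inequalities for C^1 test functions *)

Section Extension.
Context {R : realType} {M : ptopologicalType} {m : nat} {S : manifold R M m}.
Variable g : riemannian_metric S.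
Notation MB := (g_sigma_algebraType (@open M)).
Implicit Types (c : chart R M m) (Omega W C : set M) (f u psi phi : M -> R).
Variables (A : R -> R) (T : M -> 'M[R]_m) (X : M -> 'rV[R]_m).
Hypotheses (hT1 : T1 S T) (hX : vector_field S X) (hA1 : A1 A) (hA2 : A2 A).
Variable vol : {measure set MB -> \bar R}.
Variable q : M -> R.
Hypotheses (hq_cont : continuous q) (hq_ge0 : forall x, 0 <= q x)
  (hq_loc : inv_locally_integrable vol q).

(** Real-valued version of the integrand [weak_form + eps / q * psi]; at the zeros of [q] the weight
    takes the default value 0 in place of [+oo]. *)
Definition form u psi (eps : R) (x : M) : R :=
  weak_form g A T X u psi x + eps * ((q x)^-1 * psi x).

Lemma near_compl0 C f x : compact C -> (forall x, ~ C x -> f x = 0) -> ~ C x ->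
  {near x, f =1 cst 0}.
Proof.
move=> cC f0 nx; have clC := compact_closed (mfd_hausdorff S) cC.
by apply: filterS (open_nbhs_nbhs (conj (closed_openC clC) nx)) => z /f0.
Qed.

Lemma weak_form_compl0 C u f x : compact C -> (forall x, ~ C x -> f x = 0) -> ~ C x ->
  weak_form g A T X u f x = 0.
Proof. by move=> cC f0 nx; apply: weak_form0; exact: near_compl0 cC f0 nx. Qed.

Lemma form_compl0 C u f eps x : compact C -> (forall x, ~ C x -> f x = 0) -> ~ C x ->
  form u f eps x = 0.
Proof.
move=> cC f0 nx; rewrite /form (weak_form_compl0 _ cC f0 nx) f0//.
by rewrite !mulr0 addr0.
Qed.

Lemma integrable_weak_form Omega C u psi : open Omega -> C `<=` Omega -> compact C ->
  Ck_on S 1 Omega u -> Ck_on S 1 Omega psi ->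
  vol.-integrable C (EFin \o weak_form g A T X u psi).
Proof.
move=> oO CO cC hu hp.
apply: (@integrable_continuous _ _ _ S vol q hq_cont hq_ge0 hq_loc Omega) => // x Ox.
exact: (@continuous_weak_form _ _ _ _ g _ _ _ hT1 hX hA1 hA2 _ _ _ _ oO hu hp Ox).
Qed.

Lemma integrable_weight Omega C psi eps : open Omega -> C `<=` Omega -> compact C ->
  Ck_on S 1 Omega psi ->
  vol.-integrable C (EFin \o (fun x => eps * ((q x)^-1 * psi x))).
Proof.
move=> oO CO cC hp.
have i := @integrable_rqM _ _ _ S vol q hq_loc Omega C psi oO CO cC
  (fun x Ox => Ck_on_continuous oO hp Ox).
exact: (integrableZl (@measurable_compact _ _ _ S _ cC) eps i).
Qed.

Lemma integrable_form Omega C u psi eps : open Omega -> C `<=` Omega -> compact C ->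
  Ck_on S 1 Omega u -> Ck_on S 1 Omega psi ->
  vol.-integrable C (EFin \o form u psi eps).
Proof.
move=> oO CO cC hu hp.
apply: (@integrableD _ _ _ vol _ (@measurable_compact _ _ _ S _ cC)
   (EFin \o weak_form g A T X u psi) (EFin \o (fun x => eps * ((q x)^-1 * psi x)))).
  exact: integrable_weak_form oO CO cC hu hp.
exact: integrable_weight oO CO cC hp.
Qed.

Lemma Rintegral_sub_support C D f : C `<=` D -> (forall x, ~ C x -> f x = 0) ->
  \int[vol]_(x in D) f x = \int[vol]_(x in C) f x.
Proof.
move=> CD f0; rewrite /Rintegral (integral_sub_support vol CD)// => x /f0 ->.
by [].
Qed.

Lemma form_approx Omega C u psi (eps : R) : open Omega -> Ck_on S 1 Omega u ->
  compact C -> C `<=` Omega -> Ck_on S 1 setT psi -> (forall x, 0 <= psi x) ->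
  (forall x, ~ C x -> psi x = 0) -> 0 <= eps -> forall d : R, 0 < d ->
  exists phi C', [/\ test_function S Omega phi, forall x, 0 <= phi x, compact C',
    C' `<=` Omega & (forall x, ~ C' x -> phi x = 0) /\
    `|\int[vol]_(x in C') form u phi eps x - \int[vol]_(x in C) form u psi eps x| <= d].
Proof.
move=> oO hu cC CO hpsi psi0 psiC eps0 d d0.
have [C' [cC' C'O CC' H]] := test_approx g hT1 hX hA1 hA2 oO hu cC CO hpsi psi0 psiC.
have mC' := @measurable_compact _ _ _ S _ cC'.
have hp : Ck_on S 1 Omega psi by exact: (Ck_onS (@subsetT _ _) hpsi).
have i1 : vol.-integrable C' (EFin \o (fun x : M => eps * ((q x)^-1 * cst 1 x))).
  by apply: integrable_weight oO C'O cC' _; exact: Ck_on_cst.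
have i2 : vol.-integrable C' (EFin \o (cst 1 : M -> R)).
  apply: (@integrable_continuous _ _ _ S vol q hq_cont hq_ge0 hq_loc Omega) => // x Ox.
  exact: cst_continuous.
(* An approximation with tolerance [e] changes [form] by at most [e * w], and the integral [K] of
   [w] over [C'] does not depend on [e]. *)
pose w (x : M) : R := 1 + eps * ((q x)^-1 * 1).
have iw : vol.-integrable C' (EFin \o w) by exact: (integrableD mC' i2 i1).
pose K := \int[vol]_(x in C') w x.
have w0 x : 0 <= w x by rewrite addr_ge0// mulr1 mulr_ge0// invr_ge0.
have K0 : 0 <= K by apply: Rintegral_ge0.
pose e := d / (K + 1).
have K1 : 0 < K + 1 by rewrite ltr_wpDl.
have e0 : 0 < e by rewrite divr_gt0.
have [phi [tphi phi0 phiC hw hv]] := H e e0.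
exists phi, C'; split=> //; split=> //.
have -> : \int[vol]_(x in C) form u psi eps x = \int[vol]_(x in C') form u psi eps x.
  by apply/esym/Rintegral_sub_support => // x; exact: form_compl0.
have hphi : Ck_on S 1 Omega phi by exact: (Ck_onS (@subsetT _ _) (tphi.1 1%N)).
have if1 := integrable_form eps oO C'O cC' hu hphi.
have if2 := integrable_form eps oO C'O cC' hu hp.
have iew : vol.-integrable C' (EFin \o (fun x => e * w x)) by exact: (integrableZl mC' e iw).
have pt x : C' x -> `|form u phi eps x - form u psi eps x| <= e * w x.
  move=> C'x; have Ox := C'O _ C'x; rewrite /form opprD addrACA -mulrBr -mulrBr.
  apply: le_trans (ler_normD _ _) _; rewrite /w [leRHS]mulrDr [X in _ <= X + _]mulr1; apply: lerD; first exact: hw.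
  rewrite !normrM (ger0_norm eps0) ger0_norm ?invr_ge0// mulr1 mulrA mulrC.
  by rewrite ler_wpM2r// mulr_ge0// invr_ge0.
have eK : e * K <= d.
  by rewrite /e mulrAC ler_pdivrMr// ler_wpM2l ?(ltW d0)// lerDl.
apply: le_trans eK; rewrite /K -RintegralZl//.
rewrite ler_norml; apply/andP; split.
  rewrite lerBrDr addrC lerBlDr.
  rewrite -RintegralD//; apply: le_Rintegral => //.
    exact: (integrableD mC' if1 iew).
  move=> x C'x; have := pt x C'x; rewrite ler_norml => /andP[+ _].
  by rewrite lerBrDr addrC lerBlDr.
rewrite lerBlDr -RintegralD//; apply: le_Rintegral => //.
  exact: (integrableD mC' iew if2).
by move=> x C'x; have := pt x C'x; rewrite ler_norml lerBlDr => /andP[_].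
Qed.

Lemma integral_form Omega C u psi eps : open Omega -> C `<=` Omega -> compact C ->
  Ck_on S 1 Omega u -> Ck_on S 1 Omega psi -> (forall x, ~ C x -> psi x = 0) ->
  (\int[vol]_(x in Omega) ((weak_form g A T X u psi x)%:E + eps%:E / (q x)%:E * (psi x)%:E) =
   (\int[vol]_(x in C) form u psi eps x)%:E)%E.
Proof.
move=> oO CO cC hu hp psiC.
rewrite (integral_sub_support vol CO); last first.
  by move=> x nx; rewrite (weak_form_compl0 _ cC psiC nx) psiC// mule0 add0e.
rewrite (@integral_inv_q _ _ _ S vol q hq_loc Omega) //; last 2 first.
- move=> x Ox; exact: (@continuous_weak_form _ _ _ _ g _ _ _ hT1 hX hA1 hA2 _ _ _ _ oO hu hp Ox).
- by move=> x Ox; exact: (Ck_on_continuous oO hp Ox).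
rewrite /Rintegral fineK//; apply: integrable_fin_num; first exact: (@measurable_compact _ _ _ S).
exact: integrable_form oO CO cC hu hp.
Qed.

Lemma integral_form_split Omega C u psi eps : open Omega -> C `<=` Omega -> compact C ->
  Ck_on S 1 Omega u -> Ck_on S 1 Omega psi -> (forall x, ~ C x -> psi x = 0) ->
  (\int[vol]_(x in Omega) (eps%:E / (q x)%:E * (psi x)%:E) <=
   - \int[vol]_(x in Omega) (weak_form g A T X u psi x)%:E)%E ->
  \int[vol]_(x in C) form u psi eps x <= 0.
Proof.
move=> oO CO cC hu hp psiC.
have mC := @measurable_compact _ _ _ S _ cC.
have i1 := integrable_weak_form oO CO cC hu hp.
have i2 := integrable_weight eps oO CO cC hp.
rewrite [in X in (_ <= - X)%E](integral_sub_support vol CO); last first.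
  by move=> x nx; rewrite (weak_form_compl0 _ cC psiC nx).
rewrite (integral_sub_support vol CO); last by move=> x nx; rewrite psiC// mule0.
have -> : (\int[vol]_(x in C) (eps%:E / (q x)%:E * (psi x)%:E) =
    \int[vol]_(x in C) (eps * ((q x)^-1 * psi x))%:E)%E.
  have := @integral_inv_q _ _ _ S vol q hq_loc Omega C (cst 0) psi eps oO CO cC.
  move=> /(_ (fun x _ => @cst_continuous _ _ 0 x)) /(_ (fun x Ox => Ck_on_continuous oO hp Ox)).
  by under eq_integral do rewrite add0e; under [in RHS]eq_integral do rewrite add0r.
have f1 := integrable_fin_num mC i1; have f2 := integrable_fin_num mC i2.
rewrite -(fineK f1) -(fineK f2) -EFinN lee_fin => h.
rewrite (@RintegralD _ _ _ vol C (weak_form g A T X u psi) (fun x => eps * ((q x)^-1 * psi x)))//.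
by rewrite addrC -lerBrDr sub0r; exact: h.
Qed.

Lemma weak_ge_C1 Omega C u psi (eps : R) : open Omega -> Ck_on S 1 Omega u ->
  compact C -> C `<=` Omega -> Ck_on S 1 setT psi -> (forall x, 0 <= psi x) ->
  (forall x, ~ C x -> psi x = 0) -> 0 <= eps ->
  weak_qL_le g vol A T X q Omega u eps -> 0 <= \int[vol]_(x in C) form u psi eps x.
Proof.
move=> oO hu cC CO hpsi psi0 psiC eps0 hweak; apply/ler_addgt0Pr => d d0.
have [phi [C' [tphi phi0 cC' C'O [phiC' h]]]] := form_approx oO hu cC CO hpsi psi0 psiC eps0 d0.
have hphi : Ck_on S 1 Omega phi by exact: (Ck_onS (@subsetT _ _) (tphi.1 1%N)).
have := hweak phi tphi phi0.
rewrite (integral_form eps oO C'O cC' hu hphi phiC') lee_fin => h0.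
by move: h; rewrite ler_norml => /andP[_]; rewrite lerBlDr => h; apply: le_trans h0 _; rewrite addrC.
Qed.

Lemma weak_le_C1 Omega C u psi (eps : R) : open Omega -> Ck_on S 1 Omega u ->
  compact C -> C `<=` Omega -> Ck_on S 1 setT psi -> (forall x, 0 <= psi x) ->
  (forall x, ~ C x -> psi x = 0) -> 0 <= eps ->
  (forall phi, test_function S Omega phi -> (forall x, 0 <= phi x) ->
   (\int[vol]_(x in Omega) (eps%:E / (q x)%:E * (phi x)%:E) <=
    - \int[vol]_(x in Omega) (weak_form g A T X u phi x)%:E)%E) ->
  \int[vol]_(x in C) form u psi eps x <= 0.
Proof.
move=> oO hu cC CO hpsi psi0 psiC eps0 hweak; apply/ler_addgt0Pr => d d0; rewrite add0r.
have [phi [C' [tphi phi0 cC' C'O [phiC' h]]]] := form_approx oO hu cC CO hpsi psi0 psiC eps0 d0.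
have hphi : Ck_on S 1 Omega phi by exact: (Ck_onS (@subsetT _ _) (tphi.1 1%N)).
have h0 := integral_form_split oO C'O cC' hu hphi phiC' (hweak phi tphi phi0).
move: h; rewrite ler_norml => /andP[+ _]; rewrite lerNl opprB lerBlDr => h.
by apply: le_trans h _; rewrite -[leRHS]addr0 lerD2l.
Qed.

End Extension.

(** * Comparison near an interior maximum *)

Section PosPart.
Context {R : realType}.

Definition pos_pow (n : nat) (t : R) : R := (Num.max t 0) ^+ n.

Lemma pos_pow_ge0 n t : 0 <= pos_pow n t.
Proof. by rewrite exprn_ge0// le_max lexx orbT. Qed.

Lemma pos_pow_le0 n t : t <= 0 -> pos_pow n.+1 t = 0.
Proof. by move=> t0; rewrite /pos_pow max_r// expr0n. Qed.

Lemma pos_powE n t : 0 <= t -> pos_pow n t = t ^+ n.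
Proof. by move=> t0; rewrite /pos_pow max_l. Qed.

Lemma continuous_pos_pow n : continuous (pos_pow n).
Proof.
move=> t; have -> : pos_pow n = (fun s => s ^+ n) \o (fun s => (s + `|s|) / 2).
  by apply/funext => s; rewrite /pos_pow /= maxr_absE subr0 addr0.
apply: continuous_comp; last exact: exprn_continuous.
apply: (@continuousM _ _ (fun s : R => s + `|s|) (cst (2^-1))); last exact: cst_continuous.
apply: (@continuousD _ _ _ id (fun s : R => `|s|)); last exact: norm_continuous.
by apply: differentiable_continuous; exact/derivable1_diffP/derivable_id.
Qed.

Lemma is_derive_pos_pow n (t : R) :
  is_derive t (1 : R) (pos_pow n.+2) (n.+2%:R * pos_pow n.+1 t).
Proof.
have [t0|t0|->] := ltgtP t 0.
- rewrite pos_pow_le0 ?ltW// mulr0; apply: (@near_eq_is_derive R R R (cst 0)).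
  near=> s; rewrite pos_pow_le0// ltW//; near: s; exact: lt_nbhsl.
- rewrite pos_powE ?(ltW t0)//; apply: (@near_eq_is_derive R R R (fun s : R => s ^+ n.+2)).
    near=> s; rewrite pos_powE// ltW//; near: s; exact: lt_nbhsr.
  apply: DeriveDef; first exact: exprn_derivable.
  by rewrite exp_derive [LHS]mulr1.
(* The difference quotient at 0 is the next lower power, which is continuous and vanishes at 0. *)
- apply/is_derive1_caratheodory; exists (pos_pow n.+1); split.
  + move=> z; rewrite [X in _ - X]pos_pow_le0// !subr0.
    have [z0|z0] := leP z 0; first by rewrite !pos_pow_le0// mul0r.
    by rewrite !pos_powE ?ltW// [LHS]exprSr.
  + exact: continuous_pos_pow.
  + by rewrite pos_pow_le0// mulr0.
Unshelve. all: by end_near. Qed.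

Lemma Ck1_comp1 m (U : set 'rV[R]_m) (h h' : R -> R) (f : 'rV[R]_m -> R) : open U ->
  (forall t : R, is_derive t (1 : R) h (h' t)) -> continuous h' ->
  Ck 1 U f -> Ck 1 U (h \o f).
Proof.
move=> oU dh ch' [df cf].
have dhd t : differentiable h t by apply/derivable1_diffP; case: (dh t).
split=> [y Uy|i]; first by apply: differentiable_comp => //; exact: df.
apply: (@Ck_eq _ _ 0 _ ((h' \o f) * pderiv i f)) => //.
  move=> y; rewrite inE => Uy; have dfy := df y Uy.
  rewrite [RHS]pderiv_diff; last exact: differentiable_comp.
  rewrite (diff_comp dfy (dhd _)) /= deriv1E; last by case: (dh (f y)).
  have -> : h^`()%classic (f y) = h' (f y) by rewrite derive1E; case: (dh (f y)).
  by rewrite -pderiv_diff// mulrC.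
move=> y Uy; apply: continuousM; last exact: cf.
apply: continuous_comp; last exact: ch'.
exact/differentiable_continuous/df.
Qed.

End PosPart.

(** * First-order conditions at a local maximum *)

Section LocalMax.
Context {R : realType} {M : ptopologicalType} {m : nat} {S : manifold R M m}.
Variable g : riemannian_metric S.
Implicit Types (c : chart R M m) (Omega W C : set M) (f u v psi phi : M -> R).

Lemma Ck1_on_comp1 Omega (h h' : R -> R) f : open Omega ->
  (forall t : R, is_derive t (1 : R) h (h' t)) -> continuous h' ->
  Ck_on S 1 Omega f -> Ck_on S 1 Omega (h \o f).
Proof.
move=> oO dh ch' hf c ac.
by apply: (@Ck1_comp1 _ _ _ h h' (f \o cinv c)) => //; [exact: cimg_openI|exact: hf].
Qed.

Lemma is_derive_line n (F : 'rV[R]_n -> R) y i (t : R) :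
  differentiable F (y + t *: delta_mx 0 i) ->
  is_derive t (1 : R) (fun s : R => F (y + s *: delta_mx 0 i))
    (pderiv i F (y + t *: delta_mx 0 i)).
Proof.
move=> dF; set h := fun s : R => _.
have E : (fun k : R => k^-1 *: ((h \o shift t) (k *: (1 : R)) - h t)) =
    (fun k : R => k^-1 *: ((F \o shift (y + t *: delta_mx 0 i)) (k *: delta_mx 0 i)
                            - F (y + t *: delta_mx 0 i))).
  apply/funext => k; congr (_ *: (_ - _)); rewrite /h /=; congr (F _).
  by rewrite scalerDl [k *: 1]mulr1 addrCA.
apply: DeriveDef; last by rewrite /derive E.
by rewrite /derivable E; exact/diff_derivable.
Qed.

Lemma pderiv_local_max n (F : 'rV[R]_n -> R) y i :
  (\forall z \near y, differentiable F z) ->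
  (\forall z \near y, F z <= F y) -> pderiv i F y = 0.
Proof.
move=> dF hmax; pose h (t : R) := F (y + t *: delta_mx 0 i).
have [d d0 hd] := nbhs_cbox (filterI dF hmax).
have line (t : R) : `|t| < d -> differentiable F (y + t *: delta_mx 0 i) /\
    F (y + t *: delta_mx 0 i) <= F y.
  move=> td; apply: hd; rewrite /cbox /= addrC addKr normrZ.
  apply: le_trans (ltW td); rewrite ler_piMr//; apply: norm_le_coord => // j.
  by rewrite mxE eqxx /=; case: (j == i); rewrite ?normr1 ?normr0.
have : is_derive (0 : R) (1 : R) h 0.
  apply: (@derive1_at_max R h (- d) d 0).
  - by move: d0; lra.
  - move=> t; rewrite in_itv /= -ltr_norml => /line[dt _].
    by case: (is_derive_line dt).
  - by rewrite in_itv /= oppr_lt0 d0.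
  - move=> t; rewrite in_itv /= -ltr_norml => /line[_]; rewrite /h.
    by rewrite scale0r addr0.
move=> [_ <-]; have [|dF0 _] := line 0; first by rewrite normr0.
by case: (is_derive_line dF0) => _; rewrite scale0r addr0.
Qed.

Lemma grad_local_max Omega f x : open Omega -> Ck_on S 1 Omega f -> Omega x ->
  (\forall z \near x, f z <= f x) -> grad g f x = 0.
Proof.
move=> oO hf Ox hmax; pose c := chart_at S x.
have ac : atlas S c by exact: chart_at_atlas.
have cx : cdom c x by exact: chart_at_dom.
rewrite grad_dchart -/c; suff -> : dchart c f x = 0 by rewrite mul0mx.
apply/rowP => i; rewrite !mxE; apply: pderiv_local_max.
  have oW := @cimg_openI _ _ _ c _ oO.
  apply: filterS (open_nbhs_nbhs (conj oW (cimg_mem cx Ox))) => y yW.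
  by apply: (hf c ac).1.
have cc : {for c x, continuous (cinv c)} by apply: cinv_cont; exists x.
have h : nbhs (cinv c (c x)) [set z | f z <= f x] by rewrite cmapK.
by rewrite /= cmapK//; exact: (cc _ h).
Qed.

End LocalMax.

Section IntegralLower.

Lemma integral_lower d (Y : measurableType d) (R : realType) (mu : {measure set Y -> \bar R})
  (B C : set Y) (f : Y -> R) (k : R) : measurable B -> B `<=` C -> 0 <= k ->
  (forall x, C x -> 0 <= f x) -> (forall x, B x -> k <= f x) ->
  (k%:E * mu B <= \int[mu]_(x in C) (f x)%:E)%E.
Proof.
move=> mB BC k0 f0 kf; rewrite -(integral_cst mu mB).
rewrite integral_mkcond [leRHS]integral_mkcond; apply: ge0_integral_le => x _; rewrite /patch.
  by case: ifP => // _; rewrite lee_fin.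
case: ifPn => [/[!inE] Bx|_].
  by rewrite mem_set ?lee_fin ?kf//; exact: BC.
by case: ifPn => // /[!inE] Cx; rewrite lee_fin f0.
Qed.

End IntegralLower.

(** Pointwise core of the comparison: [au * tu] and [av * tv] are the flux pairings with the
    difference of the gradients, [k] the derivative of the power, [p] the test function and
    [r = 1/q]. The drift difference uses half of the gap [e1 - e2]; the other half remains. *)
Lemma form_diff_ge (R : realFieldType) (au av tu tv bu bv k r p e1 e2 : R) :
  av * tv <= au * tu -> 0 <= k -> 0 <= p -> `|bu - bv| <= (e1 - e2) / 2 * r ->
  (e1 - e2) / 2 * (r * p) <=
  (au * (k * tu) + bu * p + e1 * (r * p)) - (av * (k * tv) + bv * p + e2 * (r * p)).
Proof.
move=> mono k0 p0; rewrite ler_norml => /andP[hb _].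
have h1 : - ((e1 - e2) / 2 * r) * p <= (bu - bv) * p by rewrite ler_wpM2r.
have h2 : k * (av * tv) <= k * (au * tu) by rewrite ler_wpM2l.
by nra.
Qed.

(** * A subsolution touched by a supersolution *)

Section Compare.
Context {R : realType} {M : ptopologicalType} {m : nat} {S : manifold R M m}.
Variable g : riemannian_metric S.
Notation MB := (g_sigma_algebraType (@open M)).
Implicit Types (c : chart R M m) (Omega W C : set M) (f u v psi phi : M -> R).
Variables (A : R -> R) (T : M -> 'M[R]_m) (X : M -> 'rV[R]_m).
Hypotheses (hT1 : T1 S T) (hX : vector_field S X) (hA1 : A1 A) (hA2 : A2 A)
  (hT2 : T2 g A T).
Variable vol : {measure set MB -> \bar R}.
Hypothesis hvol : is_riemannian_volume g vol.
Variable q : M -> R.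
Hypotheses (hq_cont : continuous q) (hq_ge0 : forall x, 0 <= q x)
  (hq_loc : inv_locally_integrable vol q).

(** The negation of the weak infimum inequality at a given [eps]: the statement to be refuted. *)
Definition weak_ge_on Omega u (eps : R) : Prop :=
  forall phi, test_function S Omega phi -> (forall x, 0 <= phi x) ->
   (\int[vol]_(x in Omega) (eps%:E / (q x)%:E * (phi x)%:E) <=
    - \int[vol]_(x in Omega) (weak_form g A T X u phi x)%:E)%E.

Lemma vol_small_box (W : set M) x : open W -> W x -> exists B : set M,
  [/\ measurable (B : set MB), B `<=` W & (0 < vol B)%E].
Proof.
move=> oW Wx; pose c := chart_at S x.
have ac : atlas S c by exact: chart_at_atlas.
have cx : cdom c x by exact: chart_at_dom.
have [k [r0 [k0 r00 rc hk]]] := vol_box_lower hvol ac cx.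
have oV := @cimg_openI _ _ _ c _ oW.
have [r1 r10 hr1] := nbhs_cbox (open_nbhs_nbhs (conj oV (cimg_mem cx Wx))).
pose r := Num.min r0 r1.
have rp : 0 < r by rewrite lt_min r00.
exists (cdom c `&` c @^-1` box (c x) r); split.
- by apply: measurable_open; apply: cpre_open; exact: box_open.
- move=> z [cz bz]; have [|z' [cz' Wz'] e] := hr1 (c z).
    by apply/ltW/(lt_le_trans bz); rewrite ge_min lexx orbT.
  by rewrite -(cmapK cz) -e cmapK.
- have rr0 : r <= r0 by rewrite ge_min lexx.
  apply: lt_le_trans (hk r rp rr0).
  by rewrite lte_fin mulr_gt0// exprn_gt0// mulr_gt0.
Qed.

(** [F] confines the high values of [u - v] to a compact part of [E]; superlevel sets close to the
    maximum are then compact in [E] and in [B], so one function can test both inequalities. *)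
Lemma compare_max (E B F : set M) u v x1 (lam0 eps1 eps2 : R) :
  open E -> open B -> Ck_on S 1 setT u -> Ck_on S 1 E v -> compact F -> F `<=` E ->
  (forall x, E x -> lam0 <= u x - v x -> F x) -> E x1 -> lam0 < u x1 - v x1 ->
  (forall x, E x -> u x - v x <= u x1 - v x1) ->
  (forall x, E x -> u x - v x = u x1 - v x1 -> B x) ->
  (forall x, E x -> 0 < q x) -> 0 <= eps2 -> eps2 < eps1 ->
  weak_ge_on B u eps1 -> weak_qL_le g vol A T X q E v eps2 -> False.
Proof.
move=> oE oB hu hv cF FE lamF Ex1 lam01 wmax wB qE eps20 eps12 hge hle.
have eps10 : 0 <= eps1 by exact: le_trans eps20 (ltW eps12).
have huE : Ck_on S 1 E u by exact: (Ck_onS (@subsetT _ _) hu).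
have huB : Ck_on S 1 B u by exact: (Ck_onS (@subsetT _ _) hu).
pose w := u - v.
have hw : Ck_on S 1 E w by exact: (Ck_onD oE huE (Ck_onN oE hv)).
have wE x : w x = u x - v x by [].
have gw x : E x -> grad g w x = grad g u x - grad g v x.
  by move=> Ex; rewrite (gradD g huE (Ck_onN oE hv) Ex) (gradN g hv Ex).
pose h := (eps1 - eps2) / 2.
have h0 : 0 < h by rewrite divr_gt0// subr_gt0.
(* A neighbourhood of the maximum set, where the gradient of [w] is 0. The drift is weighted by [q]
   because it has to be absorbed by a multiple of [1/q]. *)
pose O := (E `&` B) `&` (fun x => q x * `|drift g X w x|) @^-1` [set t | t < h].
have oO : open O.
  apply: open_preimageI; [exact: openI| |exact: open_lt].
  move=> x [Ex _]; apply: (@continuousM _ _ q (fun x => `|drift g X w x|)); first exact: hq_cont.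
  apply: (continuous_comp (f := drift g X w)); last exact: norm_continuous.
  exact: (continuous_drift hX oE hw Ex).
have GO x : E x -> w x = w x1 -> O x.
  move=> Ex wx; split; first by split=> //; exact: wB.
  have g0 : grad g w x = 0.
    apply: (grad_local_max g oE hw Ex).
    apply: filterS (open_nbhs_nbhs (conj oE Ex)) => z Ez.
    by rewrite wx; exact: wmax.
  by rewrite /= /drift g0 /inner bilin0r normr0 mulr0.
have Fx1 : F x1 by apply: lamF => //; exact: ltW.
have cwE : forall x, E x -> {for x, continuous w}.
  by move=> x Ex; exact: (Ck_on_continuous oE hw Ex).
(* Off [O] the compact set [F] contains no maximum point, so [w] has a smaller maximum there; [lam]
   lies strictly between that maximum and [w x1]. *)
have [lam [lam0l lam1 lamO]] : exists lam, [/\ lam0 <= lam, lam < w x1 &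
    forall x, E x -> lam <= w x -> O x].
  have clF := compact_closed (mfd_hausdorff S) cF.
  have cD : compact (F `&` ~` O).
    by apply: (subclosed_compact _ cF) => [|x []//]; apply: closedI => //; exact: open_closedC.
  have [D0|] := pselect (F `&` ~` O !=set0); last first.
    move=> D0; exists lam0; split=> // x Ex lx; apply: contrapT => nO.
    by apply: D0; exists x; split=> //; exact: lamF.
  have cw : {within F `&` ~` O, continuous w}.
    by apply: continuous_at_within => x [/FE Ex _]; exact: cwE.
  have [z /[!inE] -[Fz nOz] hz] := compact_EVT_max D0 cD cw.
  have wz : w z < w x1.
    rewrite lt_neqAle wmax ?andbT//; last exact: FE.
    by apply/eqP => wz; apply: nOz; apply: GO => //; exact: FE.
  have ml : Num.max lam0 (w z) < w x1 by rewrite gt_max wz lam01.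
  have l0 : lam0 <= Num.max lam0 (w z) by rewrite le_max lexx.
  have lz : w z <= Num.max lam0 (w z) by rewrite le_max lexx orbT.
  exists ((Num.max lam0 (w z) + w x1) / 2); split; [by lra|by lra|].
  move=> x Ex lx; apply: contrapT => nO.
  have Fx : F x by apply: lamF => //; rewrite -wE; lra.
  have : w x <= w z by apply: hz; rewrite inE.
  lra.
pose C := [set x | E x /\ lam <= w x].
have CF : C `<=` F by move=> x [Ex lx]; apply: lamF => //; exact: le_trans lx.
have CE : C `<=` E by move=> x [].
have CO : C `<=` O by move=> x [Ex lx]; exact: lamO.
have CB : C `<=` B by move=> x /CO[[]].
have cC : compact C.
  have clF := compact_closed (mfd_hausdorff S) cF.
  apply: (subclosed_compact _ cF) => //.
  have -> : C = F `&` ~` (E `&` w @^-1` [set t | t < lam]).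
    apply/seteqP; split=> x.
      move=> Cx; split; first exact: CF.
      by move=> [_ /=]; case: Cx => _; rewrite ltNge => ->.
    move=> [Fx nx]; split; first exact: FE.
    by rewrite leNgt; apply/negP => lx; apply: nx; split=> //; exact: FE.
  apply: closedI => //; apply: open_closedC; exact: open_preimageI.
(* The exponent 2 is the smallest integer for which the power of the positive part is C^1. *)
pose psi x := if `[< E x >] then pos_pow 2 (w x - lam) else 0.
have psiE x : E x -> psi x = pos_pow 2 (w x - lam) by move=> Ex; rewrite /psi asboolT.
have psi0 x : 0 <= psi x by rewrite /psi; case: ifP => // _; exact: pos_pow_ge0.
have psiC x : ~ C x -> psi x = 0.
  move=> nC; have [Ex|nE] := pselect (E x); last by rewrite /psi asboolF.
  rewrite psiE// pos_pow_le0// subr_le0 leNgt; apply/negP => lx.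
  by apply: nC; split=> //; exact: ltW.
have hwl : Ck_on S 1 E (w + cst (- lam)).
  by apply: (Ck_onD oE hw); exact: Ck_on_cst.
have hpE : Ck_on S 1 E (pos_pow 2 \o (w + cst (- lam))).
  apply: (Ck1_on_comp1 oE (is_derive_pos_pow 0)) hwl => t.
  apply: (@continuousM _ _ (cst 2%:R) (pos_pow 1)); first exact: cst_continuous.
  exact: continuous_pos_pow.
have hpsi : Ck_on S 1 setT psi.
  apply: (@Ck_on_extend0 _ _ _ S 1 E C psi oE cC CE _ psiC).
  apply: (Ck_on_eq oE) hpE => x; rewrite inE => Ex.
  by rewrite psiE.
have hpsiE : Ck_on S 1 E psi by exact: (Ck_onS (@subsetT _ _) hpsi).
have hpsiB : Ck_on S 1 B psi by exact: (Ck_onS (@subsetT _ _) hpsi).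
have I1 := weak_le_C1 hT1 hX hA1 hA2 hq_cont hq_ge0 hq_loc oB huB cC CB hpsi psi0 psiC eps10 hge.
have I2 := weak_ge_C1 hT1 hX hA1 hA2 hq_cont hq_ge0 hq_loc oE hv cC CE hpsi psi0 psiC eps20 hle.
have if1 := integrable_form g hT1 hX hA1 hA2 hq_cont hq_ge0 hq_loc eps1 oB CB cC huB hpsiB.
have if2 := integrable_form g hT1 hX hA1 hA2 hq_cont hq_ge0 hq_loc eps2 oE CE cC hv hpsiE.
have iw := integrable_weight hq_loc h oE CE cC hpsiE.
have gpsi x : E x -> grad g psi x = (2%:R * pos_pow 1 (w x - lam)) *: (grad g u x - grad g v x).
  move=> Ex; rewrite -gw//.
  have -> : grad g psi x = grad g (pos_pow 2 \o (w + cst (- lam))) x.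
    apply: grad_near; apply: filterS (open_nbhs_nbhs (conj oE Ex)) => z Ez.
    by rewrite psiE.
  have dp := is_derive_pos_pow 0 ((w + cst (- lam)) x).
  rewrite (@grad_comp1 _ _ _ _ g E (pos_pow 2) (fun t => 2%:R * pos_pow 1 t) _ _ hwl Ex dp).
  rewrite (gradD g hw (@Ck_on_cst _ _ _ S 1 E (- lam)) Ex) grad_cst addr0.
  by [].
have key x : C x -> h * ((q x)^-1 * psi x) <=
    form g A T X q u psi eps1 x - form g A T X q v psi eps2 x.
  move=> Cx; have Ex := CE _ Cx; have qx := qE x Ex.
  have [_ /=] := CO _ Cx => hdr.
  have mono := flux_monotone hT1 hA1 hA2 hT2 x (grad g u x) (grad g v x).
  have dE : drift g X w x = inner g x (X x) (grad g u x) - inner g x (X x) (grad g v x).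
    by rewrite /drift gw// /inner bilinDr bilinNr.
  rewrite /form /weak_form gpsi// !bilinZr.
  apply: form_diff_ge mono _ (psi0 x) _.
    by rewrite mulr_ge0//; exact: pos_pow_ge0.
  by rewrite -dE ler_pdivlMr// mulrC ltW.
have Jle : \int[vol]_(x in C) (h * ((q x)^-1 * psi x)) <= 0.
  have mC := @measurable_compact _ _ _ S _ cC.
  apply: (@le_trans _ _ (\int[vol]_(x in C) (form g A T X q u psi eps1 x - form g A T X q v psi eps2 x))).
    by apply: le_Rintegral => //; exact: (integrableB mC if1 if2).
  by rewrite RintegralB// subr_le0; exact: le_trans I1 I2.
pose W := E `&` (fun x => w x - lam) @^-1` [set t | (w x1 - lam) / 2 < t].
have oW : open W.
  apply: open_preimageI => //.
  move=> x Ex; apply: (@continuousB _ _ _ w (cst lam)); first exact: cwE.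
  exact: cst_continuous.
pose W' := W `&` q @^-1` [set t | t < q x1 + 1].
have oW' : open W'.
  apply: open_preimageI => //.
  by move=> x _; exact: hq_cont.
have W'x1 : W' x1.
  split; [split=> //=|by rewrite /= ltrDl].
  by move: lam1; lra.
have [Bx [mBx BxW volBx]] := vol_small_box oW' W'x1.
have wx1 : 0 < (w x1 - lam) / 2 by move: lam1; lra.
pose kap := h * ((q x1 + 1)^-1 * ((w x1 - lam) / 2) ^+ 2).
have q1 : 0 < q x1 + 1 by rewrite ltr_wpDl.
have kap0 : 0 < kap by rewrite /kap mulr_gt0// mulr_gt0 ?invr_gt0// exprn_gt0.
have BxC : Bx `<=` C.
  by move=> x /BxW[[Ex /= wx] _]; split=> //; move: wx wx1; lra.
have low : (kap%:E * vol Bx <= \int[vol]_(x in C) (h * ((q x)^-1 * psi x))%:E)%E.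
  apply: integral_lower => //; first exact: ltW.
    move=> x _; apply: mulr_ge0; first exact: ltW.
    by apply: mulr_ge0 => //; rewrite invr_ge0.
  move=> x /BxW[[Ex /= wx] /= qx]; rewrite /kap ler_wpM2l ?(ltW h0)//.
  have qp := qE x Ex.
  apply: ler_pM => //; [by rewrite invr_ge0 ltW|exact: sqr_ge0| |].
    by rewrite lef_pV2 ?posrE// ltW.
  have wl : 0 <= w x - lam by apply: ltW; apply: lt_trans wx.
  by rewrite psiE// pos_powE// ler_pXn2r ?nnegrE// ltW.
have : (0 < kap%:E * vol Bx)%E by rewrite mule_gt0.
move=> /lt_le_trans/(_ low).
have mC := @measurable_compact _ _ _ S _ cC.
rewrite -(fineK (integrable_fin_num mC iw)) lte_fin.
by rewrite ltNge => /negP; apply.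
Qed.

End Compare.

(** * Maxima of subsolutions *)

Section LowerBounds.
Context {R : realType}.

(** The larger of [w] and [l] can replace the other in the product. *)
Lemma young_pow (n : nat) (w l : R) : 0 <= w -> 0 <= l ->
  l * w ^+ n.+1 <= w ^+ n.+2 + l ^+ n.+2.
Proof.
move=> w0 l0; have [lw|wl] := leP l w.
  by rewrite (exprS w n.+1) ler_wpDr ?exprn_ge0// ler_wpM2r ?exprn_ge0.
rewrite (exprS l n.+1) ler_wpDl ?exprn_ge0// ler_wpM2l// ler_pXn2r ?nnegrE//.
exact: ltW.
Qed.

(** The remainder of the first-order expansion is eventually at most [|z - y|]. A slope of fixed
    size is enough, since the cubes used later have side proportional to the height [t * sigma]. *)
Lemma diff0_lower m (F : 'rV[R]_m -> R) (y : 'rV[R]_m) : differentiable F y ->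
  (forall i, pderiv i F y = 0) -> \forall z \near y, F y - `|z - y| <= F z.
Proof.
move=> dF d0; have := dF => /diff_locally/eqaddoP/(_ 1 ltr01) h.
have {}h : \forall k \near (0 : 'rV[R]_m), F y - `|k| <= F (k + y).
  apply: filterS h => k; rewrite mul1r.
  have dk : 'd F y k = 0.
    by rewrite row_sum_pderiv// big1// => i _; rewrite d0 mulr0.
  have -> : (F \o shift y - (cst (F y) + 'd F y)) k = F (k + y) - (F y + 'd F y k) by [].
  by rewrite dk addr0 ler_norml => /andP[+ _]; rewrite lerBrDr addrC.
have := h; rewrite (near_shift y) => hy; apply: filterS hy => z /=.
by rewrite sub0r addrC subrK.
Qed.

End LowerBounds.

(** * Estimates away from the zeros of [q] *)

Section LowerAE.
Context {R : realType} {M : ptopologicalType} {m : nat} {S : manifold R M m}.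
Variable g : riemannian_metric S.
Notation MB := (g_sigma_algebraType (@open M)).
Implicit Types (c : chart R M m) (Omega W C : set M) (f u v psi phi : M -> R).
Variables (A : R -> R) (T : M -> 'M[R]_m) (X : M -> 'rV[R]_m).
Hypotheses (hT1 : T1 S T) (hX : vector_field S X) (hA1 : A1 A) (hA2 : A2 A).
Variable vol : {measure set MB -> \bar R}.
Variable q : M -> R.
Hypotheses (hq_cont : continuous q) (hq_ge0 : forall x, 0 <= q x)
  (hq_loc : inv_locally_integrable vol q).

Lemma Rintegral_ae_ge0 C f : compact C -> measurable_fun (C : set MB) (f : MB -> R) ->
  (forall x, C x -> q x != 0 -> 0 <= f x) -> 0 <= \int[vol]_(x in C) f x.
Proof.
move=> cC mf f0; have mC := @measurable_compact _ _ _ S _ cC.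
rewrite /Rintegral.
have -> : (\int[vol]_(x in C) (f x)%:E = \int[vol]_(x in C) (pos_pow 1 (f x))%:E)%E.
  apply: ae_eq_integral => //.
  - exact/measurable_EFinP.
  - apply/measurable_EFinP.
    apply: (measurableT_comp (f := pos_pow 1)) mf.
    by apply: continuous_measurable_fun; exact: continuous_pos_pow.
  - have h0 := @ae_inv_q _ _ _ S vol q hq_loc _ cC.
    have FF := ae_filter_ringOfSetsType vol.
    apply: filterS h0 => x h Cx; congr EFin.
    have qx : q x != 0 by apply/eqP => qx; have := h Cx; rewrite /inve qx eqxx.
    by rewrite pos_powE ?expr1// f0.
rewrite fine_ge0//; apply: integral_ge0 => x _; rewrite lee_fin; exact: pos_pow_ge0.
Qed.

(** At a zero of [q] the default inverse 0 would break the pointwise comparison with a positive [k];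
    such points are negligible in [C]. *)
Lemma form_lower_ae Omega C u psi (eps k : R) : open Omega -> C `<=` Omega -> compact C ->
  Ck_on S 1 Omega u -> Ck_on S 1 Omega psi -> (forall x, 0 <= psi x) ->
  (forall x, C x -> q x != 0 -> k <= eps / q x) ->
  \int[vol]_(x in C) (weak_form g A T X u psi x + k * psi x) <=
  \int[vol]_(x in C) form g A T X q u psi eps x.
Proof.
move=> oO CO cC hu hp psi0 hk; have mC := @measurable_compact _ _ _ S _ cC.
have i1 := integrable_form g hT1 hX hA1 hA2 hq_cont hq_ge0 hq_loc eps oO CO cC hu hp.
have iw := integrable_weak_form g hT1 hX hA1 hA2 hq_cont hq_ge0 hq_loc oO CO cC hu hp.
have ip : vol.-integrable C (EFin \o psi).
  apply: (@integrable_continuous _ _ _ S vol q hq_cont hq_ge0 hq_loc Omega) => // x Ox.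
  exact: (Ck_on_continuous oO hp Ox).
have i2 : vol.-integrable C (EFin \o (fun x => weak_form g A T X u psi x + k * psi x)).
  exact: (integrableD mC iw (integrableZl mC k ip)).
rewrite -subr_ge0 -RintegralB//; apply: Rintegral_ae_ge0 => //.
  by apply/measurable_EFinP; exact: (measurable_int vol (integrableB mC i1 i2)).
move=> x Cx qx; rewrite /form opprD addrACA subrr add0r mulrA -mulrBl.
by rewrite mulr_ge0// subr_ge0 hk.
Qed.

End LowerAE.

(** * Comparison of powers of [t] *)

Section Decay.
Context {R : realType}.

(** With [t <= 1] and [delta * N >= m + 1], cancelling [t ^ N] and [t ^ m] leaves [K1 <= t * K2].
    The spare power beyond [m] supplies the factor [t], and the choice of [t] makes
    [t * K2 < K1]. *)
Lemma powR_decay (m N : nat) (s k b D V delta t0 : R) :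
  0 < s -> 0 < k -> 0 < b -> 0 < t0 -> 0 <= V -> 0 <= D -> m.+1%:R <= delta * N%:R ->
  (forall t, 0 < t -> t <= t0 ->
    (t * s) ^+ N * (k * (2 * (t * b)) ^+ m) <= (D * (t * t `^ delta)) ^+ N * V) -> False.
Proof.
move=> s0 k0 b0 t00 V0 D0 hN h.
pose K1 := s ^+ N * (k * (2 * b) ^+ m); pose K2 := D ^+ N * V.
have K10 : 0 < K1 by rewrite !mulr_gt0// exprn_gt0// mulr_gt0.
have K20 : 0 <= K2 by rewrite mulr_ge0// exprn_ge0.
pose t := Num.min (Num.min t0 1) (K1 / (2 * (K2 + 1))).
have t0' : 0 < t by rewrite !lt_min t00 ltr01 divr_gt0// mulr_gt0// ltr_wpDl.
have tt0 : t <= t0 by rewrite !ge_min lexx.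
have t1 : t <= 1 by rewrite !ge_min lexx !orbT.
have tK : t * (2 * (K2 + 1)) <= K1.
  by rewrite -ler_pdivlMr ?mulr_gt0 ?ltr_wpDl// !ge_min lexx orbT.
have := h t t0' tt0.
have -> : (t * s) ^+ N * (k * (2 * (t * b)) ^+ m) = (t ^+ N * t ^+ m) * K1.
  by rewrite mulrCA [t * b]mulrC !exprMn /K1 exprMn; ring.
have -> : (D * (t * t `^ delta)) ^+ N * V = t ^+ N * ((t `^ delta) ^+ N * K2).
  by rewrite !exprMn /K2; ring.
rewrite -mulrA ler_pM2l ?exprn_gt0//.
have : (t `^ delta) ^+ N <= t ^+ m.+1.
  rewrite -powR_mulrn ?powR_ge0// -powRrM -powR_mulrn ?(ltW t0')//.
  by apply: ger_powR => //; rewrite t0' t1.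
move=> /(ler_wpM2r K20) /[swap] /le_trans h1 /h1.
rewrite exprSr -mulrA ler_pM2l ?exprn_gt0//; nra.
Qed.

End Decay.

(** * Paraboloids in coordinates *)

Section Quadratic.
Context {R : realType} {m : nat}.
Implicit Types (a y : 'rV[R]_m).

(** The sum of squares keeps the paraboloid smooth; [quad_le] and [quad_ge] compare it with the
    square of the sup norm, in which the cubes are measured. *)
Definition quad a (k t : R) (y : 'rV[R]_m) : R := k - t * \sum_i (y 0 i - a 0 i) ^+ 2.

Lemma quadE a k t : quad a k t =
  cst k + cst (- t) * (fun y => \sum_i ((@coor R m i + cst (- a 0 i)) * (@coor R m i + cst (- a 0 i))) y).
Proof.
by apply/funext => y; rewrite /quad -mulNr; congr (_ + _ * _); apply: eq_bigr => i _.
Qed.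

Lemma Ck_quad a k t n (U : set 'rV[R]_m) : open U -> Ck n U (quad a k t).
Proof.
move=> oU; rewrite quadE; apply: (CkD oU (Ck_cst _ _ _)).
apply: (CkM oU (Ck_cst _ _ _)); apply: Ck_sum => // i.
have h : Ck n U (@coor R m i + cst (- a 0 i)) by apply: (CkD oU (Ck_coor _ _ _) (Ck_cst _ _ _)).
exact: CkM.
Qed.

Lemma differentiable_quad a k t y : differentiable (quad a k t) y.
Proof. by have [h _] := @Ck_quad a k t 1 setT openT; exact: h. Qed.

Lemma pderiv_quad a k t i y : pderiv i (quad a k t) y = - (2 * t * (y 0 i - a 0 i)).
Proof.
rewrite pderiv_diff; last exact: differentiable_quad.
rewrite -deriveE; last exact: differentiable_quad.
set v := delta_mx 0 i.
have h j : is_derive y v (fun y : 'rV[R]_m => (y 0 j - a 0 j) ^+ 2) ((i == j)%:R * (2 * (y 0 j - a 0 j))).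
  have hj : is_derive y v (@coor R m j) (i == j)%:R.
    apply: DeriveDef; first by apply: diff_derivable; exact: differentiable_coor.
    by have := pderiv_coor (R := R) i j => /(congr1 (fun f => f y)).
  have := is_deriveX 2 (is_deriveB hj (is_derive_cst (a 0 j) y v)).
  move=> H; apply: (is_derive_eq H).
  by rewrite subr0 expr1 [LHS]/GRing.scale/= mulrC /coor.
pose F j := fun y : 'rV[R]_m => (y 0 j - a 0 j) ^+ 2.
have hs : is_derive y v (\sum_j F j) (\sum_j ((i == j)%:R * (2 * (y 0 j - a 0 j)))).
  by apply: is_derive_sum => j; exact: h.
have -> : quad a k t = cst k - t *: \sum_j F j.
  by apply/funext => z; rewrite /quad !fctE fct_sumE.
have := is_deriveB (is_derive_cst k y v) (is_deriveZ t hs).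
move=> /@derive_val ->.
rewrite (bigD1 i)//= eqxx mul1r big1 ?addr0; last first.
  by move=> j /negPf; rewrite eq_sym => ->; rewrite mul0r.
by rewrite sub0r /GRing.scale/=; congr (- _); ring.
Qed.

Lemma quad_le a k t y : 0 <= t -> quad a k t y <= k - t * `|y - a| ^+ 2.
Proof.
move=> t0; rewrite lerD2l lerN2 ler_wpM2l//.
have := norm_sqr_le_sum (y - a); congr (_ <= _); apply: eq_bigr => i _.
by rewrite !mxE.
Qed.

Lemma quad_ge a k t y : 0 <= t -> k - t * (m%:R * `|y - a| ^+ 2) <= quad a k t y.
Proof.
move=> t0; rewrite lerD2l lerN2 ler_wpM2l// -(sum_ord_const (m:=m)) ler_sum// => i _.
rewrite -[leLHS]real_normK ?num_real// ler_pXn2r ?nnegrE//.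
by have := norm_coord_le (y - a) i; rewrite !mxE.
Qed.

End Quadratic.

Lemma bilin_bounded_near (R : realType) m (Y : topologicalType) (h : Y -> 'M[R]_m) x :
  mx_continuous h x ->
  exists2 b, 0 < b & \forall z \near x, forall v w, `|bilin (h z) v w| <= b * (`|v| * `|w|).
Proof.
move=> hc.
pose b := \sum_i \sum_j (`|h x i j| + 1).
have b0 : 0 <= b by apply: sumr_ge0 => i _; apply: sumr_ge0 => j _; rewrite addr_ge0.
exists (m%:R ^+ 2 * b + 1); first by rewrite ltr_wpDl// mulr_ge0// exprn_ge0.
have near_ij : \forall z \near x, forall i j, `|h z i j| <= `|h x i j| + 1.
  have h1 : \forall z \near x, forall ij : 'I_m * 'I_m, `|h z ij.1 ij.2| < `|h x ij.1 ij.2| + 1.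
    apply: filter_forall => -[i j] /=.
    have cn : {for x, continuous (fun z => `|h z i j|)}.
      by apply: (continuous_comp (f := fun z => h z i j)); [exact: hc|exact: norm_continuous].
    have := cn; rewrite /prop_for /continuous_at => /cvgr_lt; apply.
    by rewrite ltrDl.
  by apply: filterS h1 => z hz i j; apply/ltW; exact: (hz (i, j)).
apply: filterS near_ij => z hz v w.
apply: (@le_trans _ _ (m%:R ^+ 2 * b * (`|v| * `|w|))).
  apply: bilin_norm_le => // i j; apply: (le_trans (hz i j)).
  rewrite /b (bigD1 i)//= (bigD1 j)//= -addrA lerDl addr_ge0//; apply: sumr_ge0 => k _.
    by rewrite addr_ge0.
  by apply: sumr_ge0 => l _; rewrite addr_ge0.
by rewrite mulrDl lerDl mul1r mulr_ge0.
Qed.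

(** * Pointwise energy estimate *)

Section EnergyEstimate.
Context {R : realType} {M : ptopologicalType} {m : nat} {S : manifold R M m}.
Variable g : riemannian_metric S.
Notation MB := (g_sigma_algebraType (@open M)).
Implicit Types (c : chart R M m) (Omega W C : set M) (f u v psi phi : M -> R).
Variables (A : R -> R) (T : M -> 'M[R]_m) (X : M -> 'rV[R]_m).

(** The metric paired with the gradient twice is the differential applied to the gradient; one
    factor [|gradc g c f z|] then cancels. *)
Lemma gradc_norm_le c f z (a : R) : atlas S c -> cdom c z -> 0 < a ->
  (forall p : 'rV[R]_m, a * `|p| ^+ 2 <= bilin (gchart g c z) p p) ->
  a * `|gradc g c f z| <= m%:R * `|dchart c f z|.
Proof.
move=> ac cz a0 ha; set p := gradc g c f z; set d := dchart c f z.
have [->|p0] := eqVneq p 0; first by rewrite normr0 mulr0 mulr_ge0.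
have h : bilin (gchart g c z) p p <= m%:R * (`|d| * `|p|).
  have -> : bilin (gchart g c z) p p = \sum_i d 0 i * p 0 i.
    rewrite /bilin {1}/p /gradc mulmxKV ?gchart_unit// !mxE.
    by apply: eq_bigr => i _; rewrite !mxE.
  rewrite -(sum_ord_const (m := m)) ler_sum// => i _.
  apply: le_trans (ler_norm _) _; rewrite normrM ler_pM// norm_coord_le//.
have pp : 0 < `|p| by rewrite normr_gt0.
by rewrite -(ler_pM2r pp) -!mulrA -expr2 (le_trans (ha p)).
Qed.

(** Of the zero-order coefficient [c0], one half absorbs the drift and one quarter pays for Young's
    inequality; the last quarter is the factor on the left. The parameter [l = 4 * N * theta / c0],
    with [N = n.+2], is the one for which Young's inequality produces exactly the flux error. *)
Lemma energy_lower c Omega u f n z (theta c0 : R) : atlas S c -> open Omega ->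
  Ck_on S 1 Omega u -> Ck_on S 1 Omega f -> Omega z -> cdom c z -> 0 < c0 -> 0 <= theta ->
  - theta <= A (Num.sqrt (norm2c g c u z)) *
    (bilin (tensor_in S T c z) (gradc g c u z) (gradc g c u z) -
     bilin (tensor_in S T c z) (gradc g c u z) (- gradc g c f z)) ->
  `|drift g X u z| <= c0 / 2 ->
  c0 / 4 * ((pos_pow n.+2 \o (u + f)) z - (4 * n.+2%:R * theta / c0) ^+ n.+2) <=
  weak_form g A T X u (pos_pow n.+2 \o (u + f)) z + c0 * (pos_pow n.+2 \o (u + f)) z.
Proof.
move=> ac oO hu hf Oz cz c00 th0 hth hd.
have hw : Ck_on S 1 Omega (u + f) by exact: Ck_onD.
have hcont : continuous (fun t : R => n.+2%:R * pos_pow n.+1 t).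
  move=> t; apply: (@continuousM _ _ (cst n.+2%:R) (pos_pow n.+1)).
    exact: cst_continuous.
  exact: continuous_pos_pow.
have hp : Ck_on S 1 Omega (pos_pow n.+2 \o (u + f)).
  exact: (Ck1_on_comp1 oO (is_derive_pos_pow n) hcont hw).
have gp : gradc g c (pos_pow n.+2 \o (u + f)) z =
    (n.+2%:R * pos_pow n.+1 ((u + f) z)) *: (gradc g c u z + gradc g c f z).
  rewrite /gradc (dchart_comp1 (h' := fun t => n.+2%:R * pos_pow n.+1 t) ac hw Oz cz (is_derive_pos_pow n _)).
  by rewrite (dchartD ac hu hf Oz cz) -scalemxAl mulmxDl.
rewrite (weak_form_chart g A T X ac hu hp Oz cz) gp bilinZr bilinDr.
have -> : bilin (gchart g c z) (vector_in S X c z) (gradc g c u z) = drift g X u z.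
  rewrite /drift /inner (grad_chart g ac hu Oz cz) (vector_frame ac cz X).
  by rewrite bilin_frame.
move: hth hd; rewrite bilinNr opprK /=.
set a := A _; set b1 := bilin _ _ _; set b2 := bilin _ _ _; set dr := drift _ _ _ _.
have -> : (u + f) z = u z + f z by [].
set t := u z + f z; rewrite /pos_pow; set W := Num.max t 0.
have W0 : 0 <= W by rewrite le_max lexx orbT.
move=> hth; rewrite ler_norml => /andP[hd _].
set l := 4 * n.+2%:R * theta / c0.
have l0 : 0 <= l by rewrite /l !mulr_ge0// invr_ge0 ltW.
have hy := young_pow n W0 l0.
have e : l * c0 = 4 * n.+2%:R * theta by rewrite /l divfK// gt_eqF.
have h1 : - theta * (n.+2%:R * W ^+ n.+1) <= a * (b1 + b2) * (n.+2%:R * W ^+ n.+1).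
  by rewrite ler_wpM2r// mulr_ge0// exprn_ge0.
have h2 : - (c0 / 2) * W ^+ n.+2 <= dr * W ^+ n.+2 by rewrite ler_wpM2r// exprn_ge0.
have h3 : c0 / 4 * (l * W ^+ n.+1) <= c0 / 4 * (W ^+ n.+2 + l ^+ n.+2).
  by rewrite ler_wpM2l// divr_ge0 ?ltW.
have h4 : c0 / 4 * (l * W ^+ n.+1) = theta * (n.+2%:R * W ^+ n.+1).
  have -> : c0 / 4 * (l * W ^+ n.+1) = (l * c0) / 4 * W ^+ n.+1 by ring.
  by rewrite e; field.
move: h1 h2 h3; rewrite h4 -/l.
have -> : a * (n.+2%:R * W ^+ n.+1 * (b1 + b2)) = a * (b1 + b2) * (n.+2%:R * W ^+ n.+1) by ring.
move: (n.+2%:R * W ^+ n.+1) => k; lra.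
Qed.

End EnergyEstimate.

(** * Upper bound at an attained maximum *)

Section Attained.
Context {R : realType} {M : ptopologicalType} {m : nat} {S : manifold R M m}.
Variable g : riemannian_metric S.
Notation MB := (g_sigma_algebraType (@open M)).
Implicit Types (c : chart R M m) (Omega W C B : set M) (f u psi phi : M -> R).
Variables (A : R -> R) (T : M -> 'M[R]_m) (X : M -> 'rV[R]_m).
Hypotheses (hT1 : T1 S T) (hX : vector_field S X) (hA1 : A1 A) (hA2 : A2 A).
Variable vol : {measure set MB -> \bar R}.
Hypothesis hvol : is_riemannian_volume g vol.
Variable q : M -> R.
Hypotheses (hq_cont : continuous q) (hq_ge0 : forall x, 0 <= q x)
  (hq_loc : inv_locally_integrable vol q).

Lemma near_lower_of_max c u x0 : atlas S c -> cdom c x0 -> Ck_on S 1 setT u ->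
  (forall x, u x <= u x0) -> \forall z \near x0, u x0 - `|c z - c x0| <= u z.
Proof.
move=> ac cx hu umax.
have oc : open (cdom c) by exact: cdom_open.
have oi : open (c @` cdom c) by exact: cimg_open.
have ic : (c @` cdom c) (c x0) by exists x0.
have dF y : (c @` cdom c) y -> differentiable (u \o cinv c) y.
  move=> iy; rewrite -(cinvK iy).
  exact: (Ck_on_differentiable ac hu _ (cdom_cinv iy)).
have d0 i : pderiv i (u \o cinv c) (c x0) = 0.
  apply: pderiv_local_max; apply: filterS (open_nbhs_nbhs (conj oi ic)) => y iy.
    exact: dF.
  by rewrite /= cmapK.
have h := diff0_lower (dF _ ic) d0.
have hc : \forall z \near x0, (u \o cinv c) (c x0) - `|c z - c x0| <= (u \o cinv c) (c z).
  exact: (cmap_cont cx h).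
apply: filterS2 hc (open_nbhs_nbhs (conj oc cx)) => z + cz.
by rewrite /= !cmapK.
Qed.

(* The gradient of the paraboloid is of order [t], so (A3) bounds the flux term below
   by a multiple of [- t `^ (1 + delta)], which Young's inequality turns into the bound. *)
Lemma decay_upper c Om C B u x0 (a0 b sigma r eps1 c0 omega Cd delta : R) n :
  atlas S c -> open Om -> Om `<=` cdom c -> open B -> compact C -> C `<=` Om -> C `<=` B ->
  Ck_on S 1 setT u -> 0 < a0 -> 0 < b -> 0 < c0 -> 0 < r -> 0 < sigma -> sigma < r ^+ 2 ->
  (forall z, Om z -> u z <= u x0) ->
  (forall z, Om z -> `|c z - c x0| <= r -> C z) ->
  (forall z, C z -> [/\ `|c z - c x0| <= r, `|drift g X u z| <= c0 / 2 &
     q z != 0 -> c0 <= eps1 / q z]) ->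
  (forall z, C z -> forall p : 'rV[R]_m, a0 * `|p| ^+ 2 <= bilin (gchart g c z) p p) ->
  (forall z, C z -> forall p : 'rV[R]_m, a0 * `|p| ^+ 2 <= bilin (tensor_in S T c z) p p) ->
  (forall z, C z -> forall p p', `|bilin (gchart g c z) p p'| <= b * (`|p| * `|p'|)) ->
  (forall z, C z -> forall p p', `|bilin (tensor_in S T c z) p p'| <= b * (`|p| * `|p'|)) ->
  0 < omega -> 0 < Cd -> 0 < delta ->
  (forall t, 0 < t < omega -> phi A t <= Cd * t `^ delta) ->
  0 <= eps1 -> weak_ge_on g A T X vol q B u eps1 ->
  exists D t0 : R, [/\ 0 <= D, 0 < t0 & forall t : R, 0 < t -> t <= t0 ->
    exists psi, [/\ forall z, Om z ->
        psi z = pos_pow n.+2 (u z + quad (c x0) (- u x0 + t * sigma) t (c z)),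
      forall z, 0 <= psi z, Ck_on S 1 setT psi &
      \int[vol]_(z in C) psi z <= (D * (t * t `^ delta)) ^+ n.+2 * fine (vol C)]].
Proof.
move=> ac oO Oc oB cC CO CB hu a00 b0 c00 r0 sg0 sgr umax OC hC hG hT hGb hTb om0 Cd0 dl0 hA3 eps10 hge.
have [C' [rho0 [C'0 rho00 hfl]]] := flux_lower (m := m) hA1 hA2 om0 Cd0 dl0 hA3 a00 b0.
(* The differential of the paraboloid is at most [2 * r * t] on the cube, so its gradient is at most
   [kap * t]; the [+ 1] keeps [kap] positive. *)
pose kap := m%:R * (2 * r) / a0 + 1.
have r20 : 0 <= 2 * r by rewrite mulr_ge0// ltW.
have kap0 : 0 < kap by rewrite ltr_wpDl// divr_ge0 ?(ltW a00)// mulr_ge0.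
pose D := 4 * n.+2%:R * (C' * (kap * kap `^ delta)) / c0.
have D0 : 0 <= D.
  by rewrite divr_ge0 ?(ltW c00)// !mulr_ge0 ?powR_ge0 ?(ltW C'0) ?(ltW kap0).
exists D, (rho0 / (2 * kap)); split=> //; first by rewrite divr_gt0// mulr_gt0.
move=> t t0 tt0.
pose rho := kap * t.
have rhop : 0 < rho by rewrite mulr_gt0.
have rhol : rho < rho0.
  have : t * (2 * kap) <= rho0 by rewrite -ler_pdivlMr ?mulr_gt0.
  by rewrite /rho; nra.
pose theta := C' * (rho * rho `^ delta).
have th0 : 0 <= theta by rewrite !mulr_ge0 ?powR_ge0 ?(ltW C'0) ?(ltW rhop)//; exact: ltW.
have eL : 4 * n.+2%:R * theta / c0 = D * (t * t `^ delta).
  by rewrite /theta /rho (powRM _ (ltW kap0) (ltW t0)) /D; ring.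
have huO : Ck_on S 1 Om u by exact: (Ck_onS (@subsetT _ _) hu).
have huB : Ck_on S 1 B u by exact: (Ck_onS (@subsetT _ _) hu).
pose Q := quad (c x0) (- u x0 + t * sigma) t.
have hf : Ck_on S 1 Om (Q \o c).
  apply: (Ck_onS (W := cdom c `&` c @^-1` setT)); first by move=> z Oz; split=> //; exact: Oc.
  by apply: (Ck_on_pull ac openT); exact: (Ck_quad _ _ _ _ openT).
pose p0 := pos_pow n.+2 \o (u + (Q \o c)).
have hcont : continuous (fun t : R => n.+2%:R * pos_pow n.+1 t).
  move=> s; apply: (@continuousM _ _ (cst n.+2%:R) (pos_pow n.+1)).
    exact: cst_continuous.
  exact: continuous_pos_pow.
have hp0 : Ck_on S 1 Om p0.
  exact: (Ck1_on_comp1 oO (is_derive_pos_pow n) hcont (Ck_onD oO huO hf)).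
pose psi z := if `[< Om z >] then p0 z else 0.
have psiE z : Om z -> psi z = p0 z by move=> Oz; rewrite /psi asboolT.
have psi0 z : 0 <= psi z by rewrite /psi; case: ifP => // _; exact: pos_pow_ge0.
(* Off the cube [|y| >= r] and [sigma < r ^+ 2], so the paraboloid is already below [- u x0]. The
   factor [t] plays no part in this comparison, so one [C] serves all [t]. *)
have psiC z : ~ C z -> psi z = 0.
  move=> nC; have [Oz|nO] := pselect (Om z); last by rewrite /psi asboolF.
  rewrite psiE// /p0 /= pos_pow_le0//.
  have rz : r < `|c z - c x0|.
    by rewrite ltNge; apply/negP => rz; apply: nC; exact: OC.
  have h2 : r ^+ 2 <= `|c z - c x0| ^+ 2 by rewrite ler_pXn2r ?nnegrE ?(ltW r0)// ltW.
  have h3 := quad_le (c x0) (- u x0 + t * sigma) (c z) (ltW t0).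
  have h4 : t * sigma <= t * `|c z - c x0| ^+ 2.
    by rewrite ler_pM2l//; exact: ltW (lt_le_trans sgr h2).
  have -> : (u + (Q \o c)) z = u z + Q (c z) by [].
  have := umax z Oz; rewrite /Q; lra.
have hpsi : Ck_on S 1 setT psi.
  apply: (@Ck_on_extend0 _ _ _ S 1 Om C psi oO cC CO _ psiC).
  by apply: (Ck_on_eq oO) hp0 => z; rewrite inE => Oz; rewrite psiE.
exists psi; split=> //.
have hpsiO : Ck_on S 1 Om psi by exact: (Ck_onS (@subsetT _ _) hpsi).
have I1 := weak_le_C1 hT1 hX hA1 hA2 hq_cont hq_ge0 hq_loc oB huB cC CB hpsi psi0 psiC eps10 hge.
have I2 : \int[vol]_(z in C) (weak_form g A T X u psi z + c0 * psi z) <= 0.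
  apply: le_trans I1.
  apply: (form_lower_ae g hT1 hX hA1 hA2 hq_cont hq_ge0 hq_loc oO CO cC huO hpsiO psi0).
  by move=> z Cz qz; have [_ _] := hC z Cz; exact.
pose L := (D * (t * t `^ delta)) ^+ n.+2.
have pw z : C z -> c0 / 4 * (psi z - L) <= weak_form g A T X u psi z + c0 * psi z.
  move=> Cz; have Oz := CO _ Cz; have cz := Oc _ Oz.
  have [zr zd _] := hC z Cz.
  have -> : weak_form g A T X u psi z = weak_form g A T X u p0 z.
    apply: weak_form_near.
    by apply: filterS (open_nbhs_nbhs (conj oO Oz)) => y Oy; rewrite psiE.
  rewrite psiE// /L -eL.
  apply: (energy_lower n ac oO huO hf Oz cz c00 th0 _ zd).
  apply: hfl (rhop) (rhol) _ => //.
  - by apply: tensor_in_posdef => //; have [_] := hT1; exact.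
  - exact: gchart_posdef.
  - exact: hT.
  - exact: hG.
  - exact: hTb.
  - exact: hGb.
  - rewrite normrN.
    have dle : `|dchart c (Q \o c) z| <= t * (2 * r).
      apply: norm_le_coord => [|i]; first by rewrite mulr_ge0 ?(ltW t0).
      rewrite mxE.
      have -> : pderiv i ((Q \o c) \o cinv c) (c z) = pderiv i Q (c z).
        apply: near_eq_pderiv.
        have iz : (c @` cdom c) (c z) by exists z.
        have oi : open (c @` cdom c) by exact: cimg_open.
        apply: filterS (open_nbhs_nbhs (conj oi iz)) => y iy.
        by rewrite /= cinvK.
      rewrite pderiv_quad normrN !normrM ger0_norm ?ler0n// (ger0_norm (ltW t0)).
      have h := norm_coord_le (c z - c x0) i; rewrite !mxE in h.
      have h' := le_trans h zr.
      have -> : t * (2 * r) = 2 * t * r by ring.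
      by rewrite ler_wpM2l// mulr_ge0// ltW.
    have := gradc_norm_le (Q \o c) ac cz a00 (hG z Cz).
    rewrite -ler_pdivlMl// => /le_trans; apply.
    have h5 : m%:R * `|dchart c (Q \o c) z| <= m%:R * (t * (2 * r)) by rewrite ler_wpM2l.
    apply: (@le_trans _ _ (a0^-1 * (m%:R * (t * (2 * r))))).
      by rewrite ler_wpM2l// invr_ge0 ltW.
    have -> : a0^-1 * (m%:R * (t * (2 * r))) = m%:R * (2 * r) / a0 * t by ring.
    by rewrite /rho (ler_wpM2r (ltW t0))// /kap lerDl ler01.
have mC := @measurable_compact _ _ _ S _ cC.
have ip : vol.-integrable C (EFin \o psi).
  apply: (@integrable_continuous _ _ _ S vol q hq_cont hq_ge0 hq_loc Om) => // x Ox.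
  exact: (Ck_on_continuous oO hpsiO Ox).
have iw := integrable_weak_form g hT1 hX hA1 hA2 hq_cont hq_ge0 hq_loc oO CO cC huO hpsiO.
have ic : vol.-integrable C (EFin \o (cst L : M -> R)).
  apply: (@integrable_continuous _ _ _ S vol q hq_cont hq_ge0 hq_loc Om) => // x Ox.
  exact: cst_continuous.
have i1 : vol.-integrable C (EFin \o (fun z => weak_form g A T X u psi z + c0 * psi z)).
  exact: (integrableD mC iw (integrableZl mC c0 ip)).
have i2 : vol.-integrable C (EFin \o (fun z => psi z - L)) by exact: (integrableB mC ip ic).
have i3 : vol.-integrable C (EFin \o (fun z => c0 / 4 * (psi z - L))).
  exact: (integrableZl mC (c0 / 4) i2).
have : \int[vol]_(z in C) (c0 / 4 * (psi z - L)) <= 0.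
  apply: le_trans I2; exact: le_Rintegral.
rewrite RintegralZl// pmulr_rle0 ?divr_gt0// RintegralB// subr_le0 => /le_trans; apply.
by rewrite Rintegral_cst.
Qed.

End Attained.

(** * Contradiction at an attained maximum *)

Section NoMax.
Context {R : realType} {M : ptopologicalType} {m : nat} {S : manifold R M m}.
Variable g : riemannian_metric S.
Notation MB := (g_sigma_algebraType (@open M)).
Implicit Types (c : chart R M m) (Omega W C B : set M) (f u psi phi : M -> R).
Variables (A : R -> R) (T : M -> 'M[R]_m) (X : M -> 'rV[R]_m).
Hypotheses (hT1 : T1 S T) (hX : vector_field S X) (hA1 : A1 A) (hA2 : A2 A) (hA3 : A3 A).
Variable vol : {measure set MB -> \bar R}.
Hypothesis hvol : is_riemannian_volume g vol.
Variable q : M -> R.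
Hypotheses (hq_cont : continuous q) (hq_ge0 : forall x, 0 <= q x)
  (hq_loc : inv_locally_integrable vol q).

Lemma no_max_attained B u x0 (eps1 : R) : open B -> B x0 -> Ck_on S 1 setT u ->
  (forall x, u x <= u x0) -> 0 < eps1 -> ~ weak_ge_on g A T X vol q B u eps1.
Proof.
move=> oB Bx hu umax eps10 hge.
have [omega [Cd [delta [om0 Cd0 dl0 hphi]]]] := hA3.
pose c := chart_at S x0.
have ac : atlas S c by exact: chart_at_atlas.
have cx : cdom c x0 by exact: chart_at_dom.
(* A lower bound for [eps1 / q] where [0 < q < q x0 + 1], valid even if [q x0 = 0]. *)
pose c0 := eps1 / (q x0 + 1).
have q1 : 0 < q x0 + 1 by rewrite ltr_wpDl.
have c00 : 0 < c0 by rewrite divr_gt0.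
have n1 : \forall z \near x0, q z < q x0 + 1.
  have cq : {for x0, continuous q} by exact: hq_cont.
  by have := cq; rewrite /prop_for /continuous_at => /cvgr_lt; apply; rewrite ltrDl.
have n2 : \forall z \near x0, `|drift g X u z| < c0 / 2.
  have cd : {for x0, continuous (fun z => `|drift g X u z|)}.
    apply: (continuous_comp (f := drift g X u)); last exact: norm_continuous.
    exact: (continuous_drift hX openT hu).
  have := cd; rewrite /prop_for /continuous_at => /cvgr_lt; apply.
  have g0 : grad g u x0 = 0.
    by apply: (grad_local_max g openT hu I); apply: nearW => z; exact: umax.
  by rewrite /drift g0 /inner bilin0r normr0 divr_gt0.
have mG : mx_continuous (gchart g c) x0 by exact: mx_continuous_gchart.
have mT : mx_continuous (tensor_in S T c) x0 by exact: mx_continuous_tensor.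
have pT : sym_posdef (bilin (tensor_in S T c x0)).
  by apply: tensor_in_posdef => //; have [_] := hT1; exact.
have [a1 a10 n3] := posdef_coercive_near (gchart_posdef g ac cx) mG.
have [a2 a20 n4] := posdef_coercive_near pT mT.
have [b1 b10 n5] := bilin_bounded_near mG.
have [b2 b20 n6] := bilin_bounded_near mT.
have n7 := near_lower_of_max ac cx hu umax.
pose P z := [/\ [/\ q z < q x0 + 1, `|drift g X u z| < c0 / 2,
   u x0 - `|c z - c x0| <= u z, cdom c z & B z],
   forall p : 'rV[R]_m, a1 * `|p| ^+ 2 <= bilin (gchart g c z) p p,
   forall p : 'rV[R]_m, a2 * `|p| ^+ 2 <= bilin (tensor_in S T c z) p p,
   forall p p', `|bilin (gchart g c z) p p'| <= b1 * (`|p| * `|p'|) &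
   forall p p', `|bilin (tensor_in S T c z) p p'| <= b2 * (`|p| * `|p'|)].
have nP : \forall z \near x0, P z.
  have n8 := nbhs_cdom cx.
  have n9 : \forall z \near x0, B z by exact: open_nbhs_nbhs.
  by near=> z; split=> //; [split=> //|..]; near: z.
pose Om := interior [set z | P z].
have oO : open Om by exact: open_interior.
have OP z : Om z -> P z by move=> /interior_subset.
have Ox : Om x0 by exact: nP.
have Oc : Om `<=` cdom c by move=> z /OP[[]].
have OB : Om `<=` B by move=> z /OP[[]].
have oV := @cimg_openI _ _ _ c _ oO.
have [r r0 hr] := nbhs_cbox (open_nbhs_nbhs (conj oV (cimg_mem cx Ox))).
have rc : cbox (c x0) r `<=` c @` cdom c.
  by move=> y /hr[z [cz _] <-]; exists z.
pose C := mbox c (c x0) r.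
have cC : compact C by exact: mbox_compact.
have CO : C `<=` Om by move=> z /(mbox_sub hr)[].
have CB : C `<=` B by move=> z /CO/OB.
pose a0 := Num.min a1 a2.
have a00 : 0 < a0 by rewrite lt_min a10.
pose b := b1 + b2.
have b0 : 0 < b by rewrite addr_gt0.
(* The exponent [N = n.+2] is taken so large that [delta * N] exceeds the dimension by one. *)
have [n hn] : exists n, m.+1%:R <= delta * n.+2%:R.
  exists (Num.bound (m.+1%:R / delta)).
  have := archi_boundP (divr_ge0 (ler0n R m.+1) (ltW dl0)).
  rewrite ltr_pdivrMr// => /ltW/le_trans; apply.
  by rewrite mulrC ler_pM2l// ler_nat; exact: leqW.
pose sg := r ^+ 2 / 2.
have r2 : 0 < r ^+ 2 by rewrite exprn_gt0.
have sg0 : 0 < sg by rewrite divr_gt0.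
have sgr : sg < r ^+ 2 by rewrite /sg; lra.
have [] // := @decay_upper R M m S g A T X hT1 hX hA1 hA2 vol q hq_cont hq_ge0 hq_loc
  c Om C B u x0 a0 b sg r eps1 c0 omega Cd delta n ac oO Oc oB cC CO CB hu a00 b0 c00
  r0 sg0 sgr (fun z _ => umax z) _ _ _ _ _ _ om0 Cd0 dl0 hphi (ltW eps10) hge.
- by move=> z Oz zr; apply: mboxP => //; exact: Oc.
- move=> z Cz; have [[qz dz _ _ _] _ _ _ _] := OP _ (CO _ Cz).
  split; [exact: (mbox_cbox rc Cz)|exact: ltW|].
  move=> qz0; rewrite /c0 ler_pM2l// lef_pV2 ?posrE// ?ltW//.
  by rewrite lt_neqAle eq_sym qz0 hq_ge0.
- move=> z Cz p; have [_ h _ _ _] := OP _ (CO _ Cz).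
  by apply: le_trans (h p); rewrite ler_wpM2r ?exprn_ge0// ge_min lexx.
- move=> z Cz p; have [_ _ h _ _] := OP _ (CO _ Cz).
  by apply: le_trans (h p); rewrite ler_wpM2r ?exprn_ge0// ge_min lexx orbT.
- move=> z Cz p p'; have [_ _ _ h _] := OP _ (CO _ Cz).
  by apply: le_trans (h p p') _; rewrite ler_wpM2r ?mulr_ge0// lerDl ltW.
- move=> z Cz p p'; have [_ _ _ _ h] := OP _ (CO _ Cz).
  by apply: le_trans (h p p') _; rewrite ler_wpM2r ?mulr_ge0// lerDr ltW.
move=> D [t0 [D0 t00 hdec]].
have [k1 [r1 [k10 r10 _ hv]]] := vol_box_lower hvol ac cx.
have m1 : 0 < 2 * (m%:R + 1) :> R by rewrite mulr_gt0// ltr_wpDl.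
(* On the cube of radius [t * be], [u] loses at most [t * be] and the paraboloid at most
   [t * (m * be)], using [be <= 1] and [t <= 1]; so [be * (m + 1) <= sg / 2] leaves at least
   [t * sg / 2]. *)
pose be := Num.min (Num.min r r1) (Num.min 1 (sg / (2 * (m%:R + 1)))).
have be0 : 0 < be by rewrite !lt_min r0 r10 ltr01 divr_gt0.
have ber : be <= r by rewrite !ge_min lexx.
have ber1 : be <= r1 by rewrite !ge_min lexx !orbT.
have be1 : be <= 1 by rewrite !ge_min lexx !orbT.
have besg : be * (2 * (m%:R + 1)) <= sg by rewrite -ler_pdivlMr// !ge_min lexx !orbT.
have V0 : 0 <= fine (vol C) by rewrite fine_ge0.
have t10 : 0 < Num.min t0 1 by rewrite lt_min t00 ltr01.
have s0 : 0 < sg / 2 by rewrite divr_gt0.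
apply: (@powR_decay R m n.+2 (sg / 2) k1 be D (fine (vol C)) delta (Num.min t0 1) s0 k10 be0 t10 V0 D0 hn).
move=> t tp; rewrite le_min => /andP[tt0 t1].
have [psi [psiE psi0 hpsi]] := hdec t tp tt0; apply: le_trans.
have tb0 : 0 < t * be by rewrite mulr_gt0.
have tbb : t * be <= be by rewrite ler_piMl// ltW.
have tbr1 : t * be <= r1 by exact: le_trans tbb ber1.
pose Q : set M := cdom c `&` c @^-1` box (c x0) (t * be).
have hvt := hv (t * be) tb0 tbr1.
have mQ : measurable (Q : set MB).
  by apply: measurable_open; apply: cpre_open; exact: box_open.
have QC : Q `<=` C.
  move=> z [cz bz]; apply: mboxP => //; apply/ltW/(lt_le_trans bz).
  exact: le_trans tbb ber.
have hpsiO : Ck_on S 1 Om psi by exact: (Ck_onS (@subsetT _ _) hpsi).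
have ip : vol.-integrable C (EFin \o psi).
  apply: (@integrable_continuous _ _ _ S vol q hq_cont hq_ge0 hq_loc Om) => // x Oxx.
  exact: (Ck_on_continuous oO hpsiO Oxx).
have ts0 : 0 <= (t * (sg / 2)) ^+ n.+2 by rewrite exprn_ge0// mulr_ge0// ltW.
have low z : Q z -> (t * (sg / 2)) ^+ n.+2 <= psi z.
  move=> Qz; have Cz := QC _ Qz; have Oz := CO _ Cz.
  have [[_ _ uz _ _] _ _ _ _] := OP _ Oz.
  have [cz bz] := Qz.
  rewrite psiE//; set w := u z + _.
  have hw : t * (sg / 2) <= w.
    have hq := quad_ge (c x0) (- u x0 + t * sg) (c z) (ltW tp).
    have d0 : `|c z - c x0| <= t * be by exact: ltW.
    have d2 : `|c z - c x0| ^+ 2 <= be.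
      apply: (@le_trans _ _ `|c z - c x0|); last exact: le_trans d0 tbb.
      rewrite expr2 ler_piMl//; exact: le_trans d0 (le_trans tbb be1).
    have d3 : t * (m%:R * `|c z - c x0| ^+ 2) <= t * (m%:R * be).
      by rewrite ler_pM2l// ler_wpM2l.
    have d4 : t * (be * (2 * (m%:R + 1))) <= t * sg by rewrite ler_pM2l.
    rewrite /w; move: uz hq d0 d3 d4; set d := `|_|; set Qv := quad _ _ _ _.
    set mR : R := m%:R; move=> uz hq d0 d3 d4.
    have d5 : t * (be * (2 * (mR + 1))) = 2 * (t * be) + 2 * (t * (mR * be)) by ring.
    move: hq d0 d3 d4; rewrite d5 [t * (sg / 2)]mulrA.
    move: (t * be) (t * sg) (t * (mR * be)) (t * (mR * _)) => X1 X2 X3 X4 hq d0 d3 d4.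
    clear -uz hq d0 d3 d4; lra.
  have w0 : 0 <= w by apply: le_trans hw; rewrite mulr_ge0// ltW.
  by rewrite pos_powE// ler_pXn2r ?nnegrE// mulr_ge0// ltW.
have h := integral_lower vol mQ QC ts0 (fun z _ => psi0 z) low.
have h2 := le_trans (lee_wpmul2l (ts0 : (0 <= ((t * (sg / 2)) ^+ n.+2)%:E)%E) hvt) h.
rewrite -lee_fin EFinM; apply: le_trans h2 _.
by rewrite /Rintegral fineK//; exact: (integrable_fin_num (@measurable_compact _ _ _ S _ cC) ip).
Unshelve. all: by end_near.
Qed.

End NoMax.

(** * The weak maximum principle at infinity *)

Lemma closed_within_ge (R : realType) (Y : topologicalType) (D : set Y) (f : Y -> R) (l : R) :
  closed D -> {within D, continuous f} -> closed (D `&` [set x | l <= f x]).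
Proof.
move=> cD /continuous_closedP /(_ [set t | l <= t] (@closed_ge _ l)).
by rewrite -(closed_setSI _ cD).
Qed.

Theorem theoremB (R : realType) (M : ptopologicalType) (m : nat) (hm : (2 <= m)%N)
    (S : manifold R M m) (g : riemannian_metric S)
    (hconn : connected [set: M])
    (vol : {measure set (g_sigma_algebraType (@open M)) -> \bar R})
    (hvol : is_riemannian_volume g vol)
    (A : R -> R) (T : M -> 'M[R]_m) (X : M -> 'rV[R]_m)
    (hA1 : A1 A) (hA2 : A2 A) (hA3 : A3 A)
    (hT1 : T1 S T) (hT2 : T2 g A T) (hX : vector_field S X)
    (q : M -> R) (K : set M)
    (hq_cont : continuous q) (hq_ge0 : forall x, 0 <= q x)
    (hK : compact K) (hq_gt0 : forall x, ~ K x -> 0 < q x)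
    (hq_loc : inv_locally_integrable vol q)
    (hSK : qSKgrad g vol A T X q K)
    (u : M -> R) (hu : Ck_on S 1 [set: M] u) (hu_bd : has_ubound (range u))
    (eta : R) (heta : 0 < eta) :
  weak_inf_qL_le0 g vol A T X q
    [set x | sup (range u) - eta < u x /\ tnorm g x (grad g u x) < eta] u.
Proof.
move=> eps eps0; apply: contrapT => nex.
set B := [set x | _] in nex.
have hge : weak_ge_on g A T X vol q B u eps.
  move=> psi hpsi psi0; rewrite leNgt; apply/negP => h.
  by apply: nex; exists psi.
have hs : has_sup (range u) by split=> //; exists (u point), point.
have ule x : u x <= sup (range u) by apply: sup_upper_bound => //; exists x.
move: ule hs => /=; set su := sup (range u) => ule hs.
have cu x : {for x, continuous u} by exact: (Ck_on_continuous openT hu).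
have oB : open B.
  have -> : B = (setT `&` u @^-1` [set t | su - eta < t]) `&`
      (fun x => tnorm g x (grad g u x)) @^-1` [set t | t < eta].
    by rewrite setTI.
  apply: open_preimageI; [apply: open_preimageI => //|..].
  - exact: openT.
  - by move=> x _; exact: (continuous_tnorm_grad openT hu).
  - exact: open_lt.
have [[x0 ux0]|natt] := pselect (exists x0, u x0 = su).
  apply: (no_max_attained hT1 hX hA1 hA2 hA3 hvol hq_cont hq_ge0 hq_loc oB _ hu _ eps0 hge (x0 := x0)).
    have g0 : grad g u x0 = 0.
      by apply: (grad_local_max g openT hu I); apply: nearW => z; rewrite ux0.
    by split; rewrite ?ux0 ?ltrBlDr ?ltrDl// g0 /tnorm /inner bilin0r sqrtr0.
  by move=> x; rewrite ux0.
have ult x : u x < su.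
  by rewrite lt_neqAle ule andbT; apply/eqP => e; apply: natt; exists x.
have [Sigma [[hop hclo hcov] [KS hgam]]] := hSK.
pose K0 := closure (Sigma 0); pose E := ~` K0.
have [oS0 cK0] := hop 0%N.
have S0K : Sigma 0 `<=` K0 by exact: subset_closure.
have oE : open E by apply: closed_openC; exact: closed_closure.
(* The maximum of [u] over the compact set [K0] is below [su] because the supremum is not
   attained. *)
have [al [al1 al2 al3]] : exists al, [/\ su - eta <= al, al < su & forall x, K0 x -> u x <= al].
  have [K00|] := pselect (K0 !=set0); last first.
    move=> K00; exists (su - eta); split=> //; first by rewrite ltrBlDr ltrDl.
    by move=> x Kx; exfalso; apply: K00; exists x.
  have cw : {within K0, continuous u} by apply: continuous_at_within => x _; exact: cu.
  have [z _ hz] := compact_EVT_max K00 cK0 cw.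
  exists (Num.max (u z) (su - eta)); split.
  - by rewrite le_max lexx orbT.
  - by rewrite gt_max ult ltrBlDr ltrDl.
  - by move=> x Kx; rewrite le_max hz// inE.
have al20 : 0 < su - al by rewrite subr_gt0.
have [_ [xt _ <-] uxt] := sup_adherent al20 hs.
have {}uxt : al < u xt by rewrite -/su opprB addrC subrK in uxt.
have nKxt : ~ K0 xt by move=> /al3; rewrite leNgt uxt.
have [j2 j20 Sxt] : exists2 j2, (0 < j2)%N & Sigma j2 xt.
  have : (\bigcup_j Sigma j) xt by rewrite hcov.
  move=> [[|j] _ Sj]; last by exists j.+1.
  by exfalso; apply: nKxt; exact: S0K.
(* The three bounds give, in order, the gradient condition of [B], a value of [u - gam] above [al]
   at [xt], and a strict gap between the two weak inequalities. *)
pose e := Num.min eta (Num.min ((u xt - al) / 2) (eps / 2)).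
have e0 : 0 < e by rewrite !lt_min heta !divr_gt0// subr_gt0.
have [gam [cgam [hgam1 [gam0 [gampos [gamle [gaminf [gamL gamgrad]]]]]]]] := hgam 0%N j2 j20 e e0.
have gam_out x : K0 x -> ~ Sigma 0 x -> gam x = 0.
  by move=> Kx nS; apply: gam0; split=> // /interior_subset.
have nS x : E x -> ~ Sigma 0 x by move=> nK /S0K.
pose w x := u x - gam x.
have wxt : al < w xt.
  have h1 : gam xt <= e by apply: gamle; split=> //; exact: nS.
  have h2 : e <= (u xt - al) / 2 by rewrite !ge_min lexx !orbT.
  by rewrite /w; lra.
(* Outside [C0], [gam] exceeds [su - al], hence [u - gam < al]. *)
have [C0 [cC0 hC0]] := gaminf (su - al).
pose l0 := (al + w xt) / 2.
have l01 : al < l0 by rewrite /l0; lra.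
have l02 : l0 < w xt by rewrite /l0; lra.
pose F := ~` Sigma 0 `&` [set x | l0 <= w x].
have cw : {within ~` Sigma 0, continuous w}.
  move=> x; apply: (@continuousB _ _ _ (u : subspace (~` Sigma 0) -> R) gam); last exact: cgam.
  by apply: continuous_subspaceT => y; exact: cu.
have clF : closed F by apply: closed_within_ge => //; exact: open_closedC.
have FC0 : F `<=` C0.
  move=> x [nSx /= lx]; apply: contrapT => nC; have := hC0 x nSx nC.
  by have := ule x; rewrite /w in lx *; lra.
have cF : compact F by exact: subclosed_compact clF cC0 FC0.
(* On the boundary of [Sigma 0], [gam] is 0 and [u <= al < l0]; so [F] stays in the open exterior
   although it is cut out of the larger closed set. *)
have FE : F `<=` E.
  move=> x [nSx /= lx] Kx; move: lx; rewrite /w gam_out// subr0.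
  by have := al3 x Kx; lra.
have EF x : E x -> l0 <= w x -> F x by move=> Ex lx; split=> //; exact: nS.
have Fxt : F xt by apply: EF => //; exact: ltW.
have cwF : {within F, continuous w} by apply: continuous_subspaceW cw => x [].
have [x1 /[!inE] Fx1 hx1] := compact_EVT_max (ex_intro _ xt Fxt) cF cwF.
have wx1 : w xt <= w x1 by apply: hx1; rewrite inE.
have wmax x : E x -> w x <= w x1.
  move=> Ex; have [lx|/ltW lx] := leP l0 (w x); first by apply: hx1; rewrite inE; exact: EF.
  by apply: le_trans wx1; exact: le_trans lx (ltW l02).
have huE : Ck_on S 1 E u by exact: (Ck_onS (@subsetT _ _) hu).
apply: (compare_max hT1 hX hA1 hA2 hT2 hvol hq_cont hq_ge0 hq_loc oE oB hu hgam1 cF FE EF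
  (FE _ Fx1) (lt_le_trans l02 wx1) wmax _ _ (ltW e0) _ hge gamL).
(* At a maximum point [u = w x1 + gam > al >= su - eta], and the gradient of [u] inherits the bound
   on that of [gam]. *)
- move=> x Ex wx; have gux : grad g u x = grad g gam x.
    have hng := Ck_onN oE hgam1.
    have := gradD g huE hng Ex; rewrite (gradN g hgam1 Ex).
    have -> : grad g (u + - gam) x = 0.
      apply: (grad_local_max g oE (Ck_onD oE huE hng) Ex).
      apply: filterS (open_nbhs_nbhs (conj oE Ex)) => z Ez.
      by have := wmax z Ez; rewrite -[w x1]wx.
    by move=> /esym/eqP; rewrite subr_eq0 => /eqP.
  split.
    have := gampos x Ex; have -> : u x = w x1 + gam x by rewrite -[w x1]wx subrK.
    by rewrite -/su; lra.
  by rewrite gux; apply: lt_le_trans (gamgrad x Ex) _; rewrite ge_min lexx.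
- by move=> x Ex; apply: hq_gt0 => /KS/S0K.
- by apply: (@le_lt_trans _ _ (eps / 2)); [rewrite !ge_min lexx !orbT|lra].
Qed.
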